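(* Suppose $g$ and $\bar g$ are saturated graph grid diagrams that differ by a commutation$'$ move. Let $f:G\to S^3$ be the transverse spatial graph associated to $g$ and $\bar g$ and let $V$ be the number of vertices of $G$. Then there is an $(H_1(E(f)),\mathbb{Z})$ bigraded $\mathbb{F}[U_1,\dots,U_V]$-module quasi-isomorphism $(C^-(g),\partial^-_g)\to(C^-(\bar g),\partial^-_{\bar g})$ of degree $(\delta(g,\bar g),0)$ for some $\delta(g,\bar g)\in H_1(E(f))$.
   Context: Transverse spatial graphs. Everything is PL. A graph is a finite 1-dimensional complex (loops and multiple edges allowed). An oriented disk graph $G$ is obtained from an oriented graph $Y$ (its underlying graph) by gluing to each vertex $v$ a standard 2-disk, identifying its centre with $v$; vertices and edges of $G$ mean those of $Y$. A transverse spatial graph is an embedding $f:G\to S^3$ such that each standard disk lies in a plane and, near each vertex $v$, all incoming edges lie on one side of the disk at $v$ and all outgoing edges on the other side. Equivalence is ambient isotopy of oriented disk graphs. $E(f)=S^3\smallsetminus N(f(G))$ is the exterior. Graph grid diagrams. A graph grid diagram $g$ is an $n\times n$ grid $[0,n]\times[0,n]$ of unit squares, each empty or containing an $X$ or an $O$, with some $O$'s decorated by $*$ (vertex $O$'s), such that: exactly one $O$ lies in each row and each column; if a row (column) does not contain exactly one $X$ then its $O$ is decorated; each class of the equivalence relation on $X$'s and $O$'s generated by sharing a row or column contains a decorated $O$. It is saturated if each row and each column contains at least one $X$. $\mathbb{X},\mathbb{O}$ denote the sets of $X$'s and $O$'s, viewed as points at the centres of their squares. The transverse spatial graph associated to $g$: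 put a vertex at each vertex $O$; in each row draw disjoint arcs from the $O$ to each $X$, pushed below the plane; in each column draw disjoint arcs from each $X$ to the $O$, pushed above the plane; put a disk in the plane centred at each vertex $O$; it is defined up to equivalence. The $O$'s are numbered $O_1,\dots,O_n$ with $O_1,\dots,O_V$ the vertex $O$'s. Diagrams differing by a move have equivalent associated transverse spatial graphs, and vertices, edges and $H_1(E(f))$ are identified accordingly. Commutation$'$. On the torus obtained by identifying opposite sides of the grid, two adjacent columns are exchanged; this is allowed if there are vertical line segments $LS_1$ and $LS_2$ on the torus (one in each of the two columns) such that $LS_1\cup LS_2$ contains all the $X$'s and $O$'s in the two columns, the projection of $LS_1\cup LS_2$ to a single vertical circle is the whole circle, and the projection of $\partial(LS_1)\cup\partial(LS_2)$ to that circle is precisely two points. There is the analogous move for rows. Chain complex. Identify opposite sides of the grid to get an oriented torus $\mathcal{T}$ with horizontal circles $\alpha_1,\dots,\alpha_n$ and vertical circles $\beta_1,\dots,\beta_n$. $\mathbf{S}(g)$ is the set of $\mathbf{x}=\{x_i\}_{i=1}^n$ with $x_i\in\alpha_i\cap\beta_{\sigma(i)}$, $\sigma$ a permutation. $\mathbb{F}=\mathbb{Z}/2$, and $C^-(g)$ is the free $\mathbb{F}[U_1,\dots,U_n]$-module on $\mathbf{S}(g)$, viewed as a module over $\mathbb{F}[U_1,\dots,U_V]\subset\mathbb{F}[U_1,\dots,U_n]$. If $\mathbf{x},\mathbf{y}$ differ in exactly two points, $\mathrm{Rect}(\mathbf{x},\mathbf{y})$ is the set of embedded rectangles $r\subset\mathcal{T}$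 with sides on the $\alpha$ and $\beta$ circles, with corners the points where $\mathbf{x},\mathbf{y}$ differ, whose horizontal sides, with the boundary orientation of $\partial r$, run from points of $\mathbf{x}$ to points of $\mathbf{y}$; otherwise it is empty. $\mathrm{Rect}^o(\mathbf{x},\mathbf{y})$ consists of those with $\mathrm{Int}(r)\cap\mathbf{x}=\emptyset$. $O_i(r)\in\{0,1\}$ records whether $O_i\in r$. The $\mathbb{F}[U_1,\dots,U_n]$-linear differential is $$\partial_g^-(\mathbf{x})=\sum_{\mathbf{y}\in\mathbf{S}(g)}\ \sum_{r\in\mathrm{Rect}^o(\mathbf{x},\mathbf{y}),\ \mathrm{Int}(r)\cap\mathbb{X}=\emptyset}U_1^{O_1(r)}\cdots U_n^{O_n(r)}\,\mathbf{y}.$$ Gradings. For an edge $e$, $w(e)\in H_1(E(f))$ is the class of its meridian, oriented by the right-hand rule. For an $X$ or non-vertex $O$ on the interior of $e$ set $w=w(e)$; for a vertex $O$ at $v$ set $w(O)=\sum_{e\text{ incoming at }v}w(e)=\sum_{e\text{ outgoing at }v}w(e)$. For finite planar sets $A,B$ let $\mathcal{I}(A,B)$ be the number of pairs $(a,b)\in A\times B$ with $a_1<b_1,a_2<b_2$, and $\mathcal{J}(A,B)=(\mathcal{I}(A,B)+\mathcal{I}(B,A))/2$, extended bilinearly. Viewing $\mathbf{x}$ as lattice points in $[0,n)\times[0,n)$, set $M(\mathbf{x})=\mathcal{J}(\mathbf{x}-\mathbb{O},\mathbf{x}-\mathbb{O})+1\in\mathbb{Z}$ and $A^g(\mathbf{x})=\sum_{p\in\mathbb{X}}\mathcal{J}(\mathbf{x},p)w(p)-\sum_{p\in\mathbb{O}}\mathcal{J}(\mathbf{x},p)w(p)\in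 H_1(E(f))$. Multiplication by $U_i$ changes $(A^g,M)$ by $(-w(O_i),-2)$. A map is bigraded of degree $(a,m)$ if it shifts $(A,M)$ by $(a,m)$; a quasi-isomorphism is a chain map inducing an isomorphism on homology. *)

(* Defs.v *)
From HB Require Import structures.
From mathcomp Require Import all_boot all_order all_algebra perm ring lra.
From mathcomp.multinomials Require Import -(notations) freeg mpoly.
From mathcomp Require Import all_classical reals topology normedtype.
Import Order.TTheory GRing.Theory Num.Theory.
Import numFieldNormedType.Exports.

Set Implicit Arguments.
Unset Strict Implicit.
Unset Printing Implicit Defensive.

Local Open Scope ring_scope.

Section Simplices.
Local Open Scope classical_set_scope.
Variable R : realType.

Definition std_simplex (k : nat) : set 'rV[R]_k.+1 :=
  [set x | (forall i, 0 <= x 0 i) /\ \sum_i x 0 i = 1].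
Arguments std_simplex : clear implicits.

Lemma rV_continuous (T : topologicalType) (m : nat) (f : T -> 'rV[R]_m) :
  (forall j, continuous (fun t => f t 0 j)) -> continuous f.
Proof.
move=> fc t A [P Pnbhs PA]; rewrite nbhs_simpl /=.
have : \forall s \near t, forall j, P 0 j (f s 0 j).
  by apply: filter_forall => j; apply: (fc j t); exact: Pnbhs.
by apply: filterS => s Ps; apply: PA => i j; rewrite (ord1 i).
Qed.

Lemma set_val_continuous (T : topologicalType) (A : set T) :
  continuous (set_val : A -> T).
Proof. exact: (@initial_continuous A T set_val). Qed.

Lemma set_type_continuous (S T : topologicalType) (A : set T) (f : S -> A) :
  continuous (set_val \o f) -> continuous f.
Proof. by move=> fc; apply: continuous_comp_initial. Qed.

Definition face_fun k (i : 'I_k.+2) (x : 'rV[R]_k.+1) : 'rV[R]_k.+2 :=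
  \row_j (if unlift i j is Some j' then x 0 j' else 0).

Lemma face_subproof k (i : 'I_k.+2) (x : std_simplex k) :
  face_fun i (set_val x) \in std_simplex k.+1.
Proof.
have [x0 x1] := set_valP x; apply/mem_set; split.
  by move=> j; rewrite mxE; case: unliftP.
rewrite (bigD1_ord i) //= mxE unlift_none add0r -[RHS]x1.
by apply: eq_bigr => j _; rewrite mxE liftK.
Qed.

(* The inclusion of the face opposite to the [i]-th vertex. *)
Definition face k (i : 'I_k.+2) (x : std_simplex k) : std_simplex k.+1 :=
  exist _ (face_fun i (set_val x)) (face_subproof i x).

Lemma face_continuous k (i : 'I_k.+2) : continuous (@face k i).
Proof.
apply: set_type_continuous; apply: rV_continuous => j.
rewrite (_ : (fun t => _) = fun t : std_simplex k =>
    if unlift i j is Some j' then (set_val t : 'rV[R]_k.+1) 0 j' else 0); last first.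
  by apply/funext => t /=; rewrite mxE.
case: unliftP => [j' _|_] t; last exact: cst_continuous.
apply: (@continuous_comp _ _ _ (set_val : std_simplex k -> _)
          (fun M : 'rV[R]_k.+1 => M 0 j')).
  exact: set_val_continuous.
exact: coord_continuous.
Qed.

End Simplices.
Arguments std_simplex R k : clear implicits.

Section Homology.
Local Open Scope classical_set_scope.
Variables (R : realType) (X : topologicalType).

Definition simplex (k : nat) : choiceType := continuousType (std_simplex R k) X.

Definition chain (k : nat) : lmodType int :=
  FreegDefs.type_of (Phant int) (Phant (simplex k)).

Definition of_simplex k (s : simplex k) : chain k := Freeg [:: (1, s)].

Definition facet k (s : simplex k.+1) (i : 'I_k.+2) : simplex k :=
  s \o mkcts (@face_continuous R k i).

Definition boundary k (c : chain k.+1) : chain k :=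
  fglift (fun s => \sum_(i < k.+2) (-1) ^+ i *: of_simplex (facet s i)) c.

Lemma boundary_is_additive k : zmod_morphism (@boundary k).
Proof. exact: lift_is_additive. Qed.

HB.instance Definition _ k :=
  GRing.isZmodMorphism.Build (chain k.+1) (chain k) (@boundary k)
    (@boundary_is_additive k).

Definition is_cycle : {pred chain 1} := fun c => boundary c == 0.

Lemma is_cycle_zmod_closed : zmod_closed is_cycle.
Proof.
split=> [|a b]; rewrite /is_cycle !unfold_in ?raddf0 //.
by move=> /eqP az /eqP bz; rewrite raddfB /= az bz subrr.
Qed.

HB.instance Definition _ :=
  GRing.isZmodClosed.Build (chain 1) is_cycle is_cycle_zmod_closed.

Record cycle := Cycle { cycle_chain :> chain 1; _ : cycle_chain \in is_cycle }.

HB.instance Definition _ := [isSub for cycle_chain].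
HB.instance Definition _ := [Choice of cycle by <:].
HB.instance Definition _ := [SubChoice_isSubZmodule of cycle by <:].

Definition is_boundary : {pred cycle} :=
  fun z => `[< exists b : chain 2, boundary b = z >].

Lemma is_boundary_zmod_closed : zmod_closed is_boundary.
Proof.
split=> [|a b]; rewrite /is_boundary !unfold_in.
  by apply/asboolP; exists 0; rewrite raddf0; exact/esym/(raddf0 (val : cycle -> chain 1)).
move=> /asboolP[a' aE] /asboolP[b' bE]; apply/asboolP; exists (a' - b').
by rewrite raddfB /= aE bE; exact/esym/(raddfB (val : cycle -> chain 1)).
Qed.

HB.instance Definition _ :=
  GRing.isZmodClosed.Build cycle is_boundary is_boundary_zmod_closed.

Definition H1 : zmodType := Quotient.quot is_boundary.

Definition homology_class (z : cycle) : H1 := (\pi_(Quotient.quot is_boundary) z)%qT.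

End Homology.
Arguments H1 R X : clear implicits.

(* A square of the grid, given by its (column, row); the square (i, j) is
   [i, i+1] x [j, j+1], the second coordinate pointing upwards. *)
Definition cell (n : nat) : finType := ('I_n * 'I_n)%type.

(* The X's, the numbered O's and the number of decorated ones; the decorated O's
   (the vertex O's) are the first [gV] ones. *)
Record grid (n : nat) := Grid {
  gX : {set cell n};
  gO : 'I_n -> cell n;
  gV : nat
}.

Definition marks n (g : grid n) : {set cell n} := gX g :|: [set gO g k | k : 'I_n].

Definition share_line n (g : grid n) : rel (cell n) := fun a b =>
  [&& a \in marks g, b \in marks g & (a.1 == b.1) || (a.2 == b.2)].

Record graph_grid (n : nat) := GraphGrid {
  grid_of :> grid n;
  _ : (gV grid_of <= n)%N;
  _ : forall k, gO grid_of k \notin gX grid_of;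
  _ : forall i, #|[set k | (gO grid_of k).1 == i]| = 1%N;
  _ : forall j, #|[set k | (gO grid_of k).2 == j]| = 1%N;
  _ : forall k, #|[set c in gX grid_of | c.1 == (gO grid_of k).1]| != 1%N ->
        (k < gV grid_of)%N;
  _ : forall k, #|[set c in gX grid_of | c.2 == (gO grid_of k).2]| != 1%N ->
        (k < gV grid_of)%N;
  _ : forall c, c \in marks grid_of ->
        exists2 k : 'I_n, (k < gV grid_of)%N &
          connect (share_line grid_of) c (gO grid_of k)
}.

Definition saturated n (g : grid n) : Prop :=
  (forall i, exists2 c, c \in gX g & c.1 = i) /\
  (forall j, exists2 c, c \in gX g & c.2 = j).

Section Commutation.
Variable R : realType.

(* The circle of circumference n is the interval [0, n). *)
Definition wrap (n : nat) (p : R) : R := if p < n%:R then p else p - n%:R.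

(* The segment of length l starting at s, and its boundary, on that circle. *)
Definition circle_segment n (s l : R) : set R :=
  [set wrap n (s + t) | t in `[0, l]]%classic.
Definition circle_segment_ends n (s l : R) : set R :=
  [set s; wrap n (s + l)]%classic.

(* For [b = true] the lines are the columns, for [b = false] the rows. *)
Definition line n (b : bool) (c : cell n) : 'I_n := if b then c.1 else c.2.
Definition along n (b : bool) (c : cell n) : R :=
  (nat_of_ord (if b then c.2 else c.1))%:R + 2^-1.
Definition swap_lines n (b : bool) (i j : 'I_n) (c : cell n) : cell n :=
  if b then (tperm i j c.1, c.2) else (c.1, tperm i j c.2).

(* The condition on the segments LS_1 and LS_2, in the lines i and j. *)
Definition segments_condition n (g : grid n) (b : bool) (i j : 'I_n) : Prop :=
  exists s1 l1 s2 l2 : R,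
    [/\ (0 <= s1 < n%:R) && (0 <= l1 < n%:R),
        (0 <= s2 < n%:R) && (0 <= l2 < n%:R),
        forall c, c \in marks g ->
          (line b c = i -> circle_segment n s1 l1 (along b c)) /\
          (line b c = j -> circle_segment n s2 l2 (along b c)),
        (circle_segment n s1 l1 `|` circle_segment n s2 l2 = [set p | 0 <= p < n%:R])%classic &
        exists p q, p != q /\
          (circle_segment_ends n s1 l1 `|` circle_segment_ends n s2 l2 = [set p; q])%classic].

(* [s] records the correspondence between the squares (hence between the marks)
   of [g] and [g']. Adjacency is on the torus: [ordS] is the cyclic successor. *)
Definition commutation' n (g g' : grid n) (s : {perm cell n}) : Prop :=
  exists (b : bool) (i : 'I_n),
    [/\ i != ordS i,
        segments_condition g b i (ordS i),
        s =1 swap_lines b i (ordS i) &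
        [/\ gX g' = [set s c | c in gX g],
            gO g' =1 s \o gO g &
            gV g' = gV g]].

End Commutation.

Section SpatialGraph.
Local Open Scope classical_set_scope.
Variable R : realType.

Definition pt (x y z : R) : 'rV[R]_3 := \row_k [:: x; y; z]`_k.

Definition center n (i : 'I_n) : R := (nat_of_ord i)%:R + 2^-1.

(* An arc is a union of two segments, whose common end is at height
   (b - a)^2. The arcs from one O to the X's of its row (or column) are disjoint
   away from it, as their slopes increase with the distance. *)
Definition height n (a b : 'I_n) (t : R) : R :=
  2 * (center b - center a) ^+ 2 * Num.min t (1 - t).

Definition row_arc n (o x : cell n) : set 'rV[R]_3 :=
  [set pt ((1 - t) * center o.1 + t * center x.1) (center o.2)
          (- height o.1 x.1 t) | t in `[0, 1]].

Definition column_arc n (x o : cell n) : set 'rV[R]_3 :=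
  [set pt (center o.1) ((1 - t) * center x.2 + t * center o.2)
          (height x.2 o.2 t) | t in `[0, 1]].

Definition vertex_disk n (o : cell n) : set 'rV[R]_3 :=
  [set v | exists x y : R,
    (x - center o.1) ^+ 2 + (y - center o.2) ^+ 2 <= 4^-1 ^+ 2 /\ v = pt x y 0].

(* The image f(G) in R^3. *)
Definition spatial_graph n (g : grid n) : set 'rV[R]_3 :=
  [set v | (exists k x, [/\ x \in gX g, x.2 = (gO g k).2 & row_arc (gO g k) x v]) \/
           (exists k x, [/\ x \in gX g, x.1 = (gO g k).1 & column_arc x (gO g k) v]) \/
           (exists2 k : 'I_n, (k < gV g)%N & vertex_disk (gO g k) v)].

Definition S3 : topologicalType := one_point_compactification 'rV[R]_3.

(* S^3 minus f(G), which deformation retracts onto the complement of an open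
   regular neighbourhood of f(G). *)
Definition exterior n (g : grid n) : set S3 := ~` (Some @` spatial_graph g).

Lemma pt_inj x y z x' y' z' :
  pt x y z = pt x' y' z' -> [/\ x = x', y = y' & z = z'].
Proof.
move=> e; have ej j := congr1 (fun v : 'rV[R]_3 => v 0 j) e.
by split; [have := ej ord0|have := ej (fintype.lift ord0 ord0)|have := ej ord_max];
  rewrite !mxE.
Qed.

Lemma natr_half_neq (m k : nat) : m%:R <> k%:R + 2^-1 :> R.
Proof.
move=> /(congr1 (fun x : R => x * 2)).
rewrite mulrDl mulVf ?pnatr_eq0// -!natrM natr1 => /eqP.
by rewrite eqr_nat => /eqP /(congr1 odd); rewrite /= !oddM !andbF.
Qed.

Lemma natr_half_far (m k : nat) : 4^-1 ^+ 2 < (m%:R - (k%:R + 2^-1)) ^+ 2 :> R.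
Proof.
have [mk|km] := leqP m k.
  have mkR : m%:R <= k%:R :> R by rewrite ler_nat.
  by nra.
have kmR : k%:R + 1 <= m%:R :> R by rewrite natr1 ler_nat.
by nra.
Qed.

Lemma min_t1t_eq0 (t : R) : Num.min t (1 - t) = 0 -> t = 0 \/ t = 1.
Proof.
rewrite /Num.min; case: ifP => _ h; [left; exact: h|right; apply/esym/eqP].
by rewrite -subr_eq0; apply/eqP.
Qed.

Lemma height_eq0 n (a b : 'I_n) t : height a b t = 0 ->
  exists c : 'I_n, (1 - t) * center a + t * center b = center c.
Proof.
move=> /eqP; rewrite /height mulf_eq0 => /orP[|/eqP].
  rewrite mulf_eq0 pnatr_eq0 /= expf_eq0 /= => /eqP ab; exists a.
  have -> : center b = center a by apply/eqP; rewrite -subr_eq0; apply/eqP.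
  by ring.
by case/min_t1t_eq0 => ->; [exists a|exists b]; ring.
Qed.

(* The lines of the grid, in the plane z = 0, avoid the graph. *)
Lemma grid_line_avoids n (g : grid n) (x y : R) (m : nat) :
  x = m%:R \/ y = m%:R -> ~ spatial_graph g (pt x y 0).
Proof.
move=> xym.
have avoid_center (i j : 'I_n) : x = center i -> y = center j -> False.
  by move=> xi yj; case: xym => e; [apply: (@natr_half_neq m i)|apply: (@natr_half_neq m j)];
    rewrite -e.
case=> [[k [c [_ _ [t _ /pt_inj[xE yE /eqP]]]]]|].
  rewrite oppr_eq0 => /eqP /height_eq0[i iE].
  by apply: (avoid_center i (gO g k).2); [rewrite -xE|rewrite -yE].
case=> [[k [c [_ _ [t _ /pt_inj[xE yE /height_eq0[j jE]]]]]]|].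
  by apply: (avoid_center (gO g k).1 j); [rewrite -xE|rewrite -yE].
case=> k _ [x' [y' [far /pt_inj[xE yE _]]]].
have sq0 (u : R) : 0 <= u ^+ 2 by exact: sqr_ge0.
move: far; rewrite -{}xE -{}yE; apply/negP; rewrite -ltNge.
case: xym => ->.
  by rewrite (lt_le_trans (natr_half_far m (gO g k).1))// lerDl.
by rewrite (lt_le_trans (natr_half_far m (gO g k).2))// lerDr.
Qed.

Section Path.
Variables (n : nat) (g : grid n) (a b : 'rV[R]_3).
Hypothesis ab : forall s t : R, s + t = 1 -> ~ spatial_graph g (s *: a + t *: b).

Definition path_point (x : std_simplex R 1) : 'rV[R]_3 :=
  set_val x 0 ord0 *: a + set_val x 0 ord_max *: b.

Lemma path_subproof (x : std_simplex R 1) :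
  (Some (path_point x) : S3) \in exterior g.
Proof.
apply/mem_set => -[v gv [vE]]; have [_] := set_valP x.
rewrite big_ord_recr big_ord1 /= => s1.
have {}s1 : set_val x 0 ord0 + set_val x 0 ord_max = 1.
  by rewrite -s1; congr (set_val x 0 _ + _); exact: val_inj.
by have := ab s1; rewrite -/(path_point x) -vE.
Qed.

Definition path_fun (x : std_simplex R 1) : exterior g :=
  exist _ (Some (path_point x) : S3) (path_subproof x).

Lemma path_continuous : continuous path_fun.
Proof.
apply: set_type_continuous.
have -> : set_val \o path_fun = (Some : _ -> S3) \o path_point by [].
move=> x; apply: continuous_comp; last exact: one_point_compactification_some_continuous.
have coordc j : continuous (fun x : std_simplex R 1 => (set_val x : 'rV[R]_2) 0 j).
  move=> y; apply: (@continuous_comp _ _ _ (set_val : std_simplex R 1 -> _)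
    (fun M : 'rV[R]_2 => M 0 j)); first exact: set_val_continuous.
  exact: coord_continuous.
by apply: continuousD; apply: continuousZl; exact: coordc.
Qed.

Definition segment_path : simplex R (exterior g) 1 := mkcts path_continuous.

Lemma segment_path_end (x : std_simplex R 0) :
  set_val (facet segment_path ord0 x) = Some b.
Proof.
have [_] := set_valP x; rewrite big_ord1 => x1; congr Some; rewrite /path_point /=.
have <- : fintype.lift ord0 ord0 = ord_max :> 'I_2 by exact: val_inj.
by rewrite !mxE unlift_none liftK x1 scale0r scale1r add0r.
Qed.

Lemma segment_path_start (x : std_simplex R 0) :
  set_val (facet segment_path ord_max x) = Some a.
Proof.
have [_] := set_valP x; rewrite big_ord1 => x1; congr Some; rewrite /path_point /=.
have <- : fintype.lift ord_max ord0 = ord0 :> 'I_2 by exact: val_inj.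
by rewrite !mxE unlift_none liftK x1 scale0r scale1r addr0.
Qed.

Lemma boundary_segment_path :
  boundary (of_simplex segment_path) =
  of_simplex (facet segment_path ord0) - of_simplex (facet segment_path ord_max).
Proof.
rewrite /boundary /of_simplex liftU scale1r big_ord_recr big_ord1 /=.
rewrite expr0 expr1 scale1r scaleN1r; congr (Freeg [:: (1, facet _ _)] - _).
exact: val_inj.
Qed.

End Path.

Lemma segment_path_glue n (g : grid n) a b c Hab Hbc :
  facet (@segment_path n g a b Hab) ord0 = facet (@segment_path n g b c Hbc) ord_max.
Proof.
apply/continuousEP => x; apply: val_inj.
exact: etrans (segment_path_end Hab x) (esym (segment_path_start Hbc x)).
Qed.

Section Meridian.
Variables (n : nat) (g : grid n) (c : cell n).

Let corner (d e : nat) : 'rV[R]_3 := pt (c.1 + d)%:R (c.2 + e)%:R 0.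

Lemma corner_segment d e d' e' (s t : R) : d = d' \/ e = e' -> s + t = 1 ->
  ~ spatial_graph g (s *: corner d e + t *: corner d' e').
Proof.
move=> dd st; have -> : s *: corner d e + t *: corner d' e' =
    pt (s * (c.1 + d)%:R + t * (c.1 + d')%:R) (s * (c.2 + e)%:R + t * (c.2 + e')%:R) 0.
  apply/rowP => j; rewrite !mxE; case: j => -[|[|[|//]]] //= _.
  by rewrite !mulr0 addr0.
case: dd => <-; [apply: (@grid_line_avoids _ _ _ _ (c.1 + d)); left
                |apply: (@grid_line_avoids _ _ _ _ (c.2 + e)); right];
  by rewrite -mulrDl st mul1r.
Qed.

Definition side_path d e d' e' (h : d = d' \/ e = e') : simplex R (exterior g) 1 :=
  segment_path (fun s t => corner_segment h).

(* The boundary of the square c, counterclockwise. *)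
Definition square_chain : chain R (exterior g) 1 :=
  of_simplex (@side_path 0 0 1 0 (or_intror erefl)) +
  of_simplex (@side_path 1 0 1 1 (or_introl erefl)) +
  of_simplex (@side_path 1 1 0 1 (or_intror erefl)) +
  of_simplex (@side_path 0 1 0 0 (or_introl erefl)).

Lemma square_chain_cycle : square_chain \in @is_cycle R (exterior g).
Proof.
have tele (V : zmodType) (p q r s : V) : q - p + (r - q) + (s - r) + (p - s) = 0.
  by rewrite [q - p + _]addrC subrKA [r - p + _]addrC subrKA addrC subrKA subrr.
rewrite unfold_in /is_cycle /square_chain !raddfD /= !boundary_segment_path.
have glue d e d' e' d2 e2 (h : d = d' \/ e = e') (h' : d' = d2 \/ e' = e2) :
    facet (side_path h) ord0 = facet (side_path h') ord_max.
  exact: segment_path_glue.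
rewrite -!/(side_path _).
set s1 := side_path _; set s2 := side_path _; set s3 := side_path _.
set s4 := side_path _.
have -> : facet s1 ord_max = facet s4 ord0 by exact/esym/glue.
have -> : facet s2 ord_max = facet s1 ord0 by exact/esym/glue.
have -> : facet s3 ord_max = facet s2 ord0 by exact/esym/glue.
have -> : facet s4 ord_max = facet s3 ord0 by exact/esym/glue.
by rewrite tele.
Qed.

(* If the square contains an X then this is the meridian, oriented by the
   right-hand rule, of the edge through that X: the square meets the graph only
   there, and the edge goes from the row arc below to the column arc above. *)
Definition meridian : H1 R (exterior g) :=
  homology_class (Cycle square_chain_cycle).

End Meridian.

End SpatialGraph.
Arguments exterior R {n} g.
Arguments meridian R {n} g c.

(* The weights on the X's of [g'] when [commutation' R g g' s] and [w] gives those
   on the X's of [g]: the edges of the two spatial graphs, hence the homology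
   groups of their exteriors, are identified through [s]. *)
Definition moved_weight (H : Type) n (s : {perm cell n}) (w : cell n -> H) :
  cell n -> H := fun p => w ((s^-1)%g p).

Section Complex.
Variable n : nat.

(* F[U_1, .., U_n], with F = Z/2. *)
Definition Uring : comNzRingType := mpoly n 'F_2.
Definition Uvar (i : 'I_n) : Uring := mpolyX 'F_2 (mnm1 i).

(* The subring F[U_1, .., U_V]. *)
Definition in_vertex_subring (V : nat) (p : Uring) : Prop :=
  forall m, m \in msupp p -> forall i : 'I_n, (V <= i)%N -> m i = 0%N.

(* A state x is a permutation, [x j] being the index of the vertical circle
   through its point on the j-th horizontal circle: its points are (x j, j). *)
Definition state : finType := {perm 'I_n}.

(* The free F[U_1, .., U_n]-module on the states, by coordinates. *)
Definition Cminus : zmodType := {ffun state -> Uring}.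

Definition Uscale (p : Uring) (c : Cminus) : Cminus := [ffun x => p * c x].

(* The distance from a to k in the positive direction of the cyclic order. *)
Definition cyc_dist (a k : 'I_n) : nat := ((k + (n - a)) %% n)%N.

(* The rectangle going rightwards from the vertical circle [rleft] to [rright]
   and upwards from the horizontal circle [rbot] to [rtop], on the torus. *)
Definition rectangle : finType := ('I_n * 'I_n * ('I_n * 'I_n))%type.
Definition rleft (r : rectangle) := r.1.1.
Definition rright (r : rectangle) := r.1.2.
Definition rbot (r : rectangle) := r.2.1.
Definition rtop (r : rectangle) := r.2.2.

Definition in_rect (r : rectangle) (c : cell n) : bool :=
  (cyc_dist (rleft r) c.1 < cyc_dist (rleft r) (rright r))%N &&
  (cyc_dist (rbot r) c.2 < cyc_dist (rbot r) (rtop r))%N.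

Definition in_interior (r : rectangle) (i j : 'I_n) : bool :=
  (0 < cyc_dist (rleft r) i < cyc_dist (rleft r) (rright r))%N &&
  (0 < cyc_dist (rbot r) j < cyc_dist (rbot r) (rtop r))%N.

Definition Rect (x y : state) : {set rectangle} :=
  [set r | [&& rleft r != rright r, rbot r != rtop r,
    x (rbot r) == rleft r, x (rtop r) == rright r,
    y (rbot r) == rright r, y (rtop r) == rleft r &
    [forall j, (j != rbot r) && (j != rtop r) ==> (x j == y j)]]].

Definition Rect0 (x y : state) : {set rectangle} :=
  [set r in Rect x y | [forall j, ~~ in_interior r (x j) j]].

Definition differential (g : grid n) (c : Cminus) : Cminus :=
  [ffun y => \sum_(x : state) c x *
     \sum_(r in Rect0 x y | [forall p in gX g, ~~ in_rect r p])
        \prod_(k < n) Uvar k ^+ in_rect r (gO g k)].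

End Complex.

Section Gradings.
Variable n : nat.

(* Coordinates are doubled so as to be natural numbers. *)
Definition state_points (x : state n) : seq (nat * nat) :=
  [seq ((x j).*2, j.*2) | j <- enum 'I_n].
Definition cell_point (c : cell n) : nat * nat := (c.1.*2.+1, c.2.*2.+1).
Definition O_points (g : grid n) : seq (nat * nat) :=
  [seq cell_point (gO g k) | k <- enum 'I_n].

Definition Icount (A B : seq (nat * nat)) : nat :=
  \sum_(a <- A) \sum_(b <- B) ((a.1 < b.1)%N && (a.2 < b.2)%N).

(* Twice J(A, B). *)
Definition J2 (A B : seq (nat * nat)) : nat := (Icount A B + Icount B A)%N.
Definition J (A B : seq (nat * nat)) : rat := (J2 A B)%:R / 2.

Definition maslov (g : grid n) (x : state n) : rat :=
  J (state_points x) (state_points x) - J (state_points x) (O_points g)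
  - J (O_points g) (state_points x) + J (O_points g) (O_points g) + 1.

Variable H : zmodType.

(* The weight of an O, from the weights w of the X's: the X's in the column of a
   vertex O are on the edges coming into the vertex (one on each), and the only X
   in the column of any other O is on the same edge as this O. *)
Definition O_weight (g : grid n) (w : cell n -> H) (k : 'I_n) : H :=
  \sum_(p in gX g | p.1 == (gO g k).1) w p.

(* Twice A(x). *)
Definition alexander2 (g : grid n) (w : cell n -> H) (x : state n) : H :=
  \sum_(p in gX g) w p *+ J2 (state_points x) [:: cell_point p] -
  \sum_(k < n) O_weight g w k *+ J2 (state_points x) [:: cell_point (gO g k)].

(* The monomial U^m x has bidegree (a, d), where the equation for the Alexander
   grading is multiplied by 2 as J is half-integral. The groups H_1(E(f)) have no
   torsion. *)
Definition monomial_bidegree (g : grid n) (w : cell n -> H)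
    (m : multinom n) (x : state n) (a : H) (d : int) : Prop :=
  alexander2 g w x - (\sum_(k < n) O_weight g w k *+ m k) *+ 2 = a *+ 2 /\
  maslov g x - (mdeg m)%:R * 2 = d%:~R.

Definition homogeneous (g : grid n) (w : cell n -> H) (c : Cminus n) (a : H) (d : int) :=
  forall x m, m \in msupp (c x) -> monomial_bidegree g w m x a d.

End Gradings.

Section Maps.
Variable n : nat.
Variables (g g' : grid n) (Phi : Cminus n -> Cminus n).

Definition vertex_linear : Prop :=
  forall p c d, in_vertex_subring (gV g) p ->
    Phi (Uscale p c + d) = Uscale p (Phi c) + Phi d.

Definition chain_map : Prop :=
  forall c, Phi (differential g c) = differential g' (Phi c).

(* Injectivity and surjectivity of the induced map ker / im -> ker / im. *)
Definition homology_iso : Prop :=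
  (forall c, differential g c = 0 -> (exists b, differential g' b = Phi c) ->
     exists b, differential g b = c) /\
  (forall c', differential g' c' = 0 ->
     exists2 c, differential g c = 0 & exists b, differential g' b = c' - Phi c).

Definition quasi_isomorphism : Prop := chain_map /\ homology_iso.

Definition bigraded (H : zmodType) (w w' : cell n -> H) (a : H) (d : int) : Prop :=
  forall c a0 d0, homogeneous g w c a0 d0 -> homogeneous g' w' (Phi c) (a0 + a) (d0 + d).

End Maps.

(* Main.v *)
Require Import Defs.
From HB Require Import structures.
From mathcomp Require Import all_boot all_order all_algebra perm zify ring lra.
From mathcomp.multinomials Require Import -(notations) freeg mpoly.
From mathcomp Require Import generic_quotient ring_quotient.
From mathcomp Require Import all_classical reals topology normedtype.
Import Order.TTheory GRing.Theory Num.Theory.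
Import numFieldNormedType.Exports.
Import Defs.

Set Implicit Arguments.
Unset Strict Implicit.
Unset Printing Implicit Defensive.

Local Open Scope ring_scope.

(** The two grids differ in one vertical circle (or, after exchanging rows and columns,
    one horizontal circle). Drawn on a single torus, the circles [beta] of the first grid
    and [gamma] of the second one meet in two points, in rows [a] and [q], because the
    segments of the commutation cover the circle and have two end points in all: the marks
    of one column lie on one of the arcs between [a] and [q], those of the other column on
    the other arc ([segments_rows]). The quasi-isomorphism counts empty pentagons which
    have the intersection point in the row [q] as a corner; its homotopy inverse counts
    those at the other point, and the homotopies count hexagons with both points as
    corners. Instead of cutting regions with such corners one by one, the proof treats
    all of them, and both differentials, at the same time.

    To the common vertical circle is attached, for each row, a 2 x 2 matrix over the
    polynomials in one variable [X]. Its two indices say whether the side of a region runs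
    along [beta] or along [gamma]; the diagonal entries are the weights of the adjacent
    squares, and the off-diagonal ones, 1 in the row [q] and [X] in the row [a], permit
    to change from one circle to the other. A rectangle with a side on this circle is
    weighted by the ordered product of these matrices along that side, so that the counts
    of rectangles form a matrix, the kernel [K]. Two rectangles which make an L-shaped
    region can be composed in two ways, with the same product of weights, provided that
    the elements on the two sides of a circle are inverse to each other up to a scalar
    ([side_inv]) and commute with those on the other circles. Hence the proof that the
    square of a grid differential only counts annuli applies to [K] ([kernel_square]). An
    annulus between two horizontal circles meets an X and counts zero. The only annuli
    between two vertical circles that count are the two next to the special circle, and
    together they contribute the trace of the product of all its matrices, which is [X]
    ([trace_loop]). Hence [K] has square [X], and its coefficients are the two
    differentials (on the diagonal, in degree 0), chain maps in the two directions (off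
    the diagonal, in degrees 0 and 1) and homotopies (on the diagonal, in degree 1); the
    equation [K^2 = X] says that the chain maps are homotopy inverse to each other
    ([phi_chain], [psi_chain], [phi_psi], [psi_phi]).

    A grading which changes under each empty rectangle by a sum over its squares, up to a
    constant, is shifted by a constant under the pentagons ([hom_entry]): the difference
    of the two gradings of a state only depends on the row of its point on the special
    circle ([gap_const]), and moving that point by one row changes this difference as it
    changes the weight of a pentagon ([jumpS]). For the Maslov grading the constant is
    found to be zero on the state formed by the O's ([shift_O]). For the Alexander grading
    the change under a rectangle is a sum over its squares ([alexander_move]) once the
    weights of the marks cancel in each row and column of the grid. In a column this is
    the definition of the weight of an O; in a row it is a relation between meridians in
    the homology of the exterior. It holds since the meridians of all the squares of a
    row, and likewise of a column, add up to the boundary of a strip across the grid,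
    which bounds in the exterior: the remaining faces of a box over the column, or under
    the row, avoid the graph ([strip_null], [meridian_row_weight]). *)

(** * The cyclic order *)

Section CyclicOrder.
Variable n : nat.
Implicit Types a b c k l : 'I_n.

(** The lines through the interior of a rectangle form an open arc [btw], its squares a
    half-open arc [arc]. *)
Definition btw a k b : bool := (0 < cyc_dist a k < cyc_dist a b)%N.

Definition arc a b k : bool := (cyc_dist a k < cyc_dist a b)%N.

Lemma cyc_distE a k :
  cyc_dist a k = if (a <= k)%N then (k - a)%N else (n + k - a)%N.
Proof.
have := (ltn_ord a, ltn_ord k) => -[an kn].
rewrite /cyc_dist; case: leqP => ak; last by rewrite modn_small; lia.
have -> : (k + (n - a) = (k - a) + n)%N by lia.
by rewrite modnDr modn_small //; lia.
Qed.

Lemma btwE a k b : btw a k b =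
  [|| (a < k)%N && (k < b)%N, (k < b)%N && (b < a)%N | (b < a)%N && (a < k)%N].
Proof.
rewrite /btw !cyc_distE; have := (ltn_ord a, ltn_ord b, ltn_ord k) => -[[? ?] ?].
by case: (leqP a k) => ?; case: (leqP a b) => ?; lia.
Qed.

Lemma arcE a b k : arc a b k = (a != b) && ((k == a) || btw a k b).
Proof.
rewrite btwE /arc !cyc_distE -!val_eqE /=.
have := (ltn_ord a, ltn_ord b, ltn_ord k) => -[[? ?] ?].
by case: (leqP a k) => ?; case: (leqP a b) => ?; lia.
Qed.

Lemma btw_rot a b c : btw a b c = btw b c a.
Proof. by rewrite !btwE; lia. Qed.

Lemma btw_distinct a b c : btw a b c -> [/\ a != b, b != c & a != c].
Proof. by rewrite btwE -!val_eqE /= => h; split; lia. Qed.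

Lemma btw_opp a b c : a != b -> b != c -> a != c -> btw a c b = ~~ btw a b c.
Proof. by rewrite !btwE -!val_eqE /=; lia. Qed.

Lemma btw_cat a b c k : btw a b c -> k != b -> btw a k c = btw a k b || btw b k c.
Proof. by rewrite !btwE -!val_eqE /=; lia. Qed.

Lemma btw_cat_disj a b c k : btw a b c -> btw a k b -> btw b k c = false.
Proof. by rewrite !btwE; lia. Qed.

Lemma btwxx a k : btw a k a = false.
Proof. by rewrite btwE; lia. Qed.
Lemma btwxl a b : btw a a b = false.
Proof. by rewrite btwE; lia. Qed.
Lemma btwxr a b : btw a b b = false.
Proof. by rewrite btwE; lia. Qed.

Lemma arc_cat a b c k : btw a b c -> arc a c k = arc a b k || arc b c k.
Proof. by rewrite !arcE !btwE -!val_eqE /=; lia. Qed.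

Lemma arc_cat_disj a b c k : btw a b c -> arc a b k -> arc b c k = false.
Proof. by rewrite !arcE !btwE -!val_eqE /=; lia. Qed.

Lemma arcC a b k : a != b -> arc b a k = ~~ arc a b k.
Proof. by rewrite !arcE !btwE -!val_eqE /=; lia. Qed.

Lemma val_ordS a : ordS a = (if a.+1 == n then 0 else a.+1)%N :> nat.
Proof.
rewrite /=; case: eqP => [->|e]; first by rewrite modnn.
by rewrite modn_small // ltn_neqAle (ltn_ord a) andbT; apply/eqP.
Qed.

Lemma cyc_dist0 a b : (cyc_dist a b == 0)%N = (a == b).
Proof. by rewrite cyc_distE -val_eqE /=; have an := ltn_ord a; case: (leqP a b); lia. Qed.

Lemma cyc_distxx a : cyc_dist a a = 0%N.
Proof. by apply/eqP; rewrite cyc_dist0. Qed.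

Lemma cyc_distS a b d : cyc_dist a b = d.+1 -> cyc_dist (ordS a) b = d.
Proof.
rewrite !cyc_distE val_ordS; have := (ltn_ord a, ltn_ord b) => -[? ?].
by case: eqP => ?; case: (leqP a b) => ?; case: leqP => ?; lia.
Qed.

Lemma arc_ordS a b k : a != b -> arc a b k = (k == a) || arc (ordS a) b k.
Proof.
move: (ordS a) (val_ordS a) => a' /= a'E; rewrite !arcE !btwE -!val_eqE /=; have := (ltn_ord a, ltn_ord b, ltn_ord k) => -[[? ?] ?].
by move: a'E; case: eqP => ? ?; lia.
Qed.

Lemma arc_ordSl a b : arc (ordS a) b a = false.
Proof.
move: (ordS a) (val_ordS a) => a' /= a'E; rewrite !arcE !btwE -!val_eqE /=; have := (ltn_ord a, ltn_ord b) => -[? ?].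
by move: a'E; case: eqP => ? ?; lia.
Qed.

Lemma arcxx a k : arc a a k = false.
Proof. by rewrite arcE eqxx. Qed.

Lemma btw_ordS a k : btw a k (ordS a) = false.
Proof.
move: (ordS a) (val_ordS a) => a' /= a'E; rewrite !btwE; have := (ltn_ord a, ltn_ord k) => -[? ?].
by move: a'E; case: eqP => ? ?; lia.
Qed.

Lemma btw_ordS_l a k : a != k -> ordS a != k -> btw a (ordS a) k.
Proof.
move: (ordS a) (val_ordS a) => a' /= a'E; rewrite !btwE -!val_eqE /=; have := (ltn_ord a, ltn_ord k) => -[? ?].
by move: a'E; case: eqP => ? ?; lia.
Qed.

Lemma btw_ordS_pred a k : btw (ordS a) a k = false.
Proof.
move: (ordS a) (val_ordS a) => a' /= a'E; rewrite !btwE; have := (ltn_ord a, ltn_ord k) => -[? ?].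
by move: a'E; case: eqP => ? ?; lia.
Qed.

Lemma btw_ordS_r a k : k != a -> k != ordS a -> btw k a (ordS a).
Proof. by move=> ka kS; rewrite btw_rot btw_ordS_l // eq_sym. Qed.

Lemma btw_ordS_mid a k l : k != a -> k != ordS a -> l != ordS a -> btw k (ordS a) l = btw k a l.
Proof.
move: (ordS a) (val_ordS a) => a' /= a'E; rewrite !btwE -!val_eqE /=.
have := (ltn_ord a, ltn_ord k, ltn_ord l) => -[[? ?] ?].
by move: a'E; case: eqP => ? ?; lia.
Qed.

Lemma ordS_period2 a k : ordS (ordS a) = a -> (k == a) || (k == ordS a).
Proof.
move: (ordS (ordS a)) (val_ordS (ordS a)) => a'' e'' aa; move: (ordS a) (val_ordS a) e'' => a' e' e''.
rewrite -!val_eqE /=; have := (ltn_ord a, ltn_ord k) => -[? ?].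
by move: e'' e'; rewrite aa; do 2!case: eqP => ?; lia.
Qed.

Lemma arc_ordS_btw a b k : a != b -> arc (ordS a) b k -> btw a k b.
Proof.
move=> ab kb; have : arc a b k by rewrite arc_ordS // kb orbT.
by rewrite arcE ab => /orP[/eqP ka|//]; move: kb; rewrite ka arc_ordSl.
Qed.

Lemma cyc_dist_cat a b c : btw a b c -> cyc_dist a c = (cyc_dist a b + cyc_dist b c)%N.
Proof.
rewrite btwE !cyc_distE; have := (ltn_ord a, ltn_ord b, ltn_ord c) => -[[? ?] ?].
by case: (leqP a b) => ?; case: (leqP a c) => ?; case: (leqP b c) => ?; lia.
Qed.

Lemma cyc_distC a b : a != b -> (cyc_dist a b + cyc_dist b a)%N = n.
Proof.
rewrite !cyc_distE -val_eqE /=; have := (ltn_ord a, ltn_ord b) => -[? ?].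
by case: (leqP a b) => ?; case: (leqP b a) => ?; lia.
Qed.

Lemma iter_ordS a b : iter (cyc_dist a b) (@ordS n) a = b.
Proof.
have [d ad] : exists d, cyc_dist a b = d by exists (cyc_dist a b).
rewrite ad; elim: d a ad => [|d IH] a ad; first by apply/eqP; rewrite -cyc_dist0 ad.
by rewrite iterSr IH ?(cyc_distS ad).
Qed.

End CyclicOrder.

(** * Ordered products along an arc *)

Section OrderedProducts.
Variables (n : nat) (B : pzRingType).
Implicit Types (f g : 'I_n -> B) (a b c : 'I_n).

Fixpoint iter_down f a d : B :=
  if d is d'.+1 then f a * iter_down f (ordS a) d' else 1.

Fixpoint iter_up f a d : B :=
  if d is d'.+1 then iter_up f (ordS a) d' * f a else 1.

(** Elements on a vertical circle are multiplied from the bottom to the top along the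
    right side of a rectangle, and in the opposite order along the left side. *)
Definition down f a b := iter_down f a (cyc_dist a b).
Definition up f a b := iter_up f a (cyc_dist a b).

Lemma iter_downD f a d e :
  iter_down f a (d + e) = iter_down f a d * iter_down f (iter d (@ordS n) a) e.
Proof.
elim: d a => [|d IH] a /=; first by rewrite mul1r.
by rewrite IH mulrA -iterSr.
Qed.

Lemma iter_upD f a d e :
  iter_up f a (d + e) = iter_up f (iter d (@ordS n) a) e * iter_up f a d.
Proof.
elim: d a => [|d IH] a /=; first by rewrite mulr1.
by rewrite IH -mulrA -iterSr.
Qed.

Lemma down_cat f a b c : btw a b c -> down f a c = down f a b * down f b c.
Proof. by move=> abc; rewrite /down (cyc_dist_cat abc) iter_downD iter_ordS. Qed.

Lemma up_cat f a b c : btw a b c -> up f a c = up f b c * up f a b.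
Proof. by move=> abc; rewrite /up (cyc_dist_cat abc) iter_upD iter_ordS. Qed.

Lemma down_loop f a b : a != b -> down f a b * down f b a = iter_down f a n.
Proof. move=> ab; have := iter_downD f a (cyc_dist a b) (cyc_dist b a).
by rewrite cyc_distC // iter_ordS. Qed.

Lemma up_loop f a b : a != b -> up f b a * up f a b = iter_up f a n.
Proof. move=> ab; have := iter_upD f a (cyc_dist a b) (cyc_dist b a).
by rewrite cyc_distC // iter_ordS. Qed.

Lemma arc_ind (P : 'I_n -> Prop) b :
  P b -> (forall a, a != b -> P (ordS a) -> P a) -> forall a, P a.
Proof.
move=> Pb PS a; have [d ad] : exists d, cyc_dist a b = d by exists (cyc_dist a b).
elim: d a ad => [|d IH] a ad.
  by have /eqP := ad; rewrite cyc_dist0 => /eqP ->.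
by apply: PS; [rewrite -cyc_dist0 ad|apply/IH/cyc_distS].
Qed.

Lemma down_ordS f a b : a != b -> down f a b = f a * down f (ordS a) b.
Proof.
rewrite -cyc_dist0 /down; case ad: (cyc_dist a b) => [//|d] _ /=.
by rewrite (cyc_distS ad).
Qed.

Lemma up_ordS f a b : a != b -> up f a b = up f (ordS a) b * f a.
Proof.
rewrite -cyc_dist0 /up; case ad: (cyc_dist a b) => [//|d] _ /=.
by rewrite (cyc_distS ad).
Qed.

Lemma eq_iter_down f g a d : f =1 g -> iter_down f a d = iter_down g a d.
Proof. by move=> fg; elim: d a => //= d IH a; rewrite fg IH. Qed.
Lemma eq_iter_up f g a d : f =1 g -> iter_up f a d = iter_up g a d.
Proof. by move=> fg; elim: d a => //= d IH a; rewrite fg IH. Qed.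

Lemma downxx f a : down f a a = 1.
Proof. by rewrite /down cyc_distxx. Qed.
Lemma upxx f a : up f a a = 1.
Proof. by rewrite /up cyc_distxx. Qed.

Lemma comm_down f a b z : (forall k, GRing.comm z (f k)) -> GRing.comm z (down f a b).
Proof.
move=> zf; move: a; apply: (@arc_ind (fun a => GRing.comm z (down f a b)) b).
  by rewrite downxx; exact: commr1.
by move=> a ab IH; rewrite down_ordS //; exact: commrM.
Qed.

Lemma comm_up f a b z : (forall k, GRing.comm z (f k)) -> GRing.comm z (up f a b).
Proof.
move=> zf; move: a; apply: (@arc_ind (fun a => GRing.comm z (up f a b)) b).
  by rewrite upxx; exact: commr1.
by move=> a ab IH; rewrite up_ordS //; exact: commrM.
Qed.

End OrderedProducts.

Section ArcBig.
Variables (n : nat) (T : Type) (idx : T) (op : Monoid.com_law idx) (d : 'I_n -> T).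
Implicit Types a b c : 'I_n.

Lemma big_arc_ordS a b : a != b ->
  \big[op/idx]_(k | arc a b k) d k = op (d a) (\big[op/idx]_(k | arc (ordS a) b k) d k).
Proof.
move=> ab; rewrite (bigD1 a) /=; last by rewrite arc_ordS // eqxx.
congr (op _ _); apply: eq_bigl => k; rewrite arc_ordS //.
by case: eqP => [->|_]; rewrite ?arc_ordSl //= andbT.
Qed.

Lemma big_arc_cat a b c : btw a b c ->
  \big[op/idx]_(k | arc a c k) d k =
  op (\big[op/idx]_(k | arc a b k) d k) (\big[op/idx]_(k | arc b c k) d k).
Proof.
move=> abc; rewrite (bigID (arc a b)) /=; congr (op _ _); apply: eq_bigl => k.
  by rewrite (arc_cat _ abc) andb_orl andbb andbC; case: (arc a b k).
rewrite (arc_cat _ abc); case ak: (arc a b k) => /=; last by rewrite andbT.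
by rewrite (arc_cat_disj abc).
Qed.

Lemma big_arcC a b : a != b ->
  op (\big[op/idx]_(k | arc a b k) d k) (\big[op/idx]_(k | arc b a k) d k) =
  \big[op/idx]_k d k.
Proof.
move=> ab; rewrite [RHS](bigID (arc a b)) /=; congr (op _ _).
by apply: eq_bigl => k; rewrite arcC.
Qed.

(** The squares of a rectangle are charged to vertical circles: those of a column to the
    circle on its left, except that both columns next to the circle [ordS i] are charged
    to that circle. If it is inside the rectangle it takes both columns, if it is the
    left side it takes the column [ordS i], and if it is the right side the column [i]. *)
Lemma big_columns (i l r : 'I_n) : i != ordS i -> l != r ->
  op (\big[op/idx]_(m | btw l m r)
       (if m == ordS i then op (d i) (d (ordS i)) else if m == i then idx else d m))
     (op (if l == ordS i then d (ordS i) else if l == i then idx else d l)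
         (if r == ordS i then d i else idx)) =
  \big[op/idx]_(c | arc l r c) d c.
Proof.
pose m0 := ordS i; move=> im0 lr; have m0i : m0 != i by rewrite eq_sym.
rewrite -/m0.
rewrite [RHS](bigD1 l) /=; last by rewrite arcE lr eqxx.
rewrite [X in _ = op _ X](eq_bigl (fun c => btw l c r)); last first.
  by move=> c; rewrite arcE lr; case: eqVneq => [->|_]; rewrite ?btwxl ?andbT.
have ext (P : pred 'I_n) : {in P, forall m, (m != m0) && (m != i)} ->
    \big[op/idx]_(m | P m) (if m == m0 then op (d i) (d m0) else if m == i then idx else d m) =
    \big[op/idx]_(m | P m) d m.
  by move=> Pm; apply: eq_bigr => m /Pm /andP[/negPf -> /negPf ->].
case: (eqVneq l m0) lr => [->|lm0] lr.
  rewrite [r == m0]eq_sym (negPf lr) Monoid.mulm1 Monoid.mulmC ext // => m mr.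
  have [m0m _ _] := btw_distinct mr; rewrite [m == m0]eq_sym m0m /=.
  by apply: contraTneq mr => ->; rewrite -topredE /= btw_ordS_pred.
case: (eqVneq l i) lr => [->|li] lr.
  case: (eqVneq r m0) => [->|rm0].
    by rewrite !big_pred0 ?Monoid.mul1m ?Monoid.mulm1 // => m; exact: btw_ordS.
  have h : btw i m0 r by rewrite btw_ordS_l // eq_sym.
  rewrite (bigD1 m0) //= [in RHS](bigD1 m0) //= eqxx !Monoid.mulm1 Monoid.mulmA ext // => m /andP[mr ->].
  by have [? _ _] := btw_distinct mr; rewrite eq_sym.
case: (eqVneq r m0) lr => [->|rm0] lr.
  have h : btw l i m0 by exact: btw_ordS_r.
  rewrite (bigD1 i) //= [in RHS](bigD1 i) //= eqxx (negPf im0) Monoid.mul1m Monoid.mulmC -!Monoid.mulmA.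
  by congr (op _ (op _ _)); rewrite ext // => m /andP[mr ->]; have [_ -> _] := btw_distinct mr.
rewrite Monoid.mulm1 Monoid.mulmC; congr (op _ _); case h: (btw l i r).
  rewrite (bigD1 m0) /=; last by rewrite btw_ordS_mid.
  rewrite (bigD1 i) ?h //= [in RHS](bigD1 m0) /=; last by rewrite btw_ordS_mid.
  rewrite [in RHS](bigD1 i) ?h //= !eqxx (negPf im0) Monoid.mul1m ext.
    by rewrite [op (d i) _]Monoid.mulmC -Monoid.mulmA.
  by move=> m /andP[/andP[_ ->] ->].
rewrite ext // => m mr; apply/andP; split; apply: contraTneq mr => ->; rewrite -topredE /= ?h //.
by rewrite btw_ordS_mid ?h.
Qed.

End ArcBig.

Section ArcProduct.
Variables (n : nat) (A : comPzRingType) (d : 'I_n -> A).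
Implicit Types a b c : 'I_n.

Lemma prod_arc_ordS a b : a != b ->
  \prod_(k | arc a b k) d k = d a * \prod_(k | arc (ordS a) b k) d k.
Proof. exact: big_arc_ordS. Qed.

Lemma prod_arc_cat a b c : btw a b c ->
  \prod_(k | arc a c k) d k = \prod_(k | arc a b k) d k * \prod_(k | arc b c k) d k.
Proof. exact: big_arc_cat. Qed.

Lemma prod_arcC a b : a != b ->
  \prod_(k | arc a b k) d k * \prod_(k | arc b a k) d k = \prod_k d k.
Proof. exact: big_arcC. Qed.

End ArcProduct.

Section ArcSum.
Variables (n : nat) (V : nmodType) (d : 'I_n -> V).
Implicit Types a b c : 'I_n.

Lemma sum_arc_ordS a b : a != b ->
  \sum_(k | arc a b k) d k = d a + \sum_(k | arc (ordS a) b k) d k.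
Proof. exact: big_arc_ordS. Qed.

Lemma sum_columns (i l r : 'I_n) : i != ordS i -> l != r ->
  \sum_(c | arc l r c) d c =
  \sum_(m | btw l m r) (if m == ordS i then d i + d (ordS i) else if m == i then 0 else d m) +
  ((if l == ordS i then d (ordS i) else if l == i then 0 else d l) +
   (if r == ordS i then d i else 0)).
Proof. by move=> ? ?; rewrite -(@big_columns _ _ _ +%R d i l r). Qed.

End ArcSum.

(** * Sums in characteristic two *)

Section CharTwo.
Variables (V : zmodType).
Hypothesis addVV : forall v : V, v + v = 0.

Lemma sum_symmetric (I : finType) (F : I -> I -> V) :
  (forall i j, F i j = F j i) -> (forall i, F i i = 0) -> \sum_i \sum_j F i j = 0.
Proof.
move=> FC F0; elim: (index_enum I) => [|i r IH]; first by rewrite big_nil.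
rewrite big_cons big_cons F0 add0r.
under [X in _ + X]eq_bigr do rewrite big_cons.
rewrite big_split /= IH addr0 -[RHS](addVV (\sum_(j <- r) F i j)).
by congr (_ + _); apply: eq_bigr.
Qed.

Lemma sum_paired (I : finType) (P : pred I) (F G : I -> V) (h : I -> I) :
  injective h -> (forall i, P (h i) = P i) -> (forall i, P i -> F i = G (h i)) ->
  \sum_(i | P i) F i + \sum_(i | P i) G i = 0.
Proof.
move=> hI hP FG; rewrite [X in _ + X](reindex_inj hI) /= (eq_bigl _ _ hP) (eq_bigr _ FG).
exact: addVV.
Qed.

End CharTwo.

(** A second rectangle has both rows in common with the first one (whose rows are [b] and
    [t]), or exactly one, or none. *)
Lemma sum_ordered_pairs (V : nmodType) (I : finType) (b t : I) (f : I -> I -> V) : b != t ->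
  (forall i, f i i = 0) ->
  \sum_i \sum_j f i j = f b t + f t b +
    \sum_(s | (s != b) && (s != t)) (f b s + f t s + (f s b + f s t)) +
    \sum_(s | (s != b) && (s != t)) \sum_(s' | (s' != b) && (s' != t)) f s s'.
Proof.
move=> bt f0; have split2 (g : I -> V) :
    \sum_i g i = g b + (g t + \sum_(s | (s != b) && (s != t)) g s).
  by rewrite (bigD1 b) //= (bigD1 t) //= eq_sym.
under eq_bigr do rewrite split2.
rewrite split2 !f0 !add0r !big_split /= -!addrA; congr (_ + _).
by rewrite addrCA.
Qed.

(** * Rectangles with transfer elements on their vertical sides *)

(** To the row [k] of the vertical circle [m] are attached two elements of an algebra [B],
    [E true m k] for rectangles with their right side on [m] and [E false m k] for those
    with their left side on [m]; rectangles with [m] in their interior get their product,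
    the scalar [dl m k]. *)
Section TransferComplex.
Variables (n : nat) (A : comNzRingType) (B : algType A).
Variables (E : bool -> 'I_n -> 'I_n -> B) (dl : 'I_n -> 'I_n -> A).
Implicit Types (x y z : {perm 'I_n}) (b t p q s j k l r m : 'I_n).

Hypothesis E_comm : forall e e' m m' k k', m != m' -> GRing.comm (E e m k) (E e' m' k').
Hypothesis E_inv : forall e m k, E e m k * E (~~ e) m k = (dl m k)%:A.

Definition side e m b t : B :=
  if e then down (E true m) b t else up (E false m) b t.

Definition strip m b t : A := \prod_(k | arc b t k) dl m k.
Definition block l r b t : A := \prod_(m | btw l m r) strip m b t.

Definition weight l r b t : B :=
  block l r b t *: (side false l b t * side true r b t).

Lemma side_comm e e' m m' b t b' t' : m != m' ->
  side e m b t * side e' m' b' t' = side e' m' b' t' * side e m b t.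
Proof.
move=> mm'; have EE f f' k k' : GRing.comm (E f m k) (E f' m' k') by exact: E_comm.
rewrite -/(GRing.comm _ _) /side.
by case: e; case: e'; (apply: comm_down || apply: comm_up) => k; apply: commr_sym;
  (apply: comm_down || apply: comm_up) => k'; apply: commr_sym.
Qed.

Lemma side_inv e m b t : side e m b t * side (~~ e) m b t = (strip m b t)%:A.
Proof.
rewrite /strip; move: b; apply: (@arc_ind _ (fun b =>
  side e m b t * side (~~ e) m b t = (\prod_(k | arc b t k) dl m k)%:A) t).
  rewrite big_pred0; last by move=> k; rewrite arcxx.
  by rewrite /side; case: e; rewrite /= downxx upxx mul1r scale1r.
move=> b bt IH; rewrite prod_arc_ordS //; move: IH.
rewrite /side; case: e => /= IH.
  rewrite (down_ordS _ bt) (up_ordS _ bt) mulrA -(mulrA _ _ (up _ _ _)) IH.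
  by rewrite -scalerAr mulr1 -scalerAl (E_inv true) scalerA mulrC.
rewrite (down_ordS _ bt) (up_ordS _ bt) -mulrA (mulrA (E false m b)).
by rewrite (E_inv false) -scalerAl mul1r -scalerAr IH scalerA.
Qed.

Lemma strip_cat m b t p : btw b t p -> strip m b p = strip m b t * strip m t p.
Proof. exact: prod_arc_cat. Qed.

Lemma block_rows l r b t p : btw b t p -> block l r b p = block l r b t * block l r t p.
Proof.
by move=> btp; rewrite -big_split; apply: eq_bigr => m _; exact: strip_cat.
Qed.

Lemma block_cols l r m b t : btw l m r ->
  block l r b t = block l m b t * strip m b t * block m r b t.
Proof.
move=> lmr; have [lm mr lr] := btw_distinct lmr.
rewrite /block (bigD1 m) //= mulrAC [LHS]mulrC; congr (_ * _).
rewrite (bigID (fun k => btw l k m)) /=; congr (_ * _); apply: eq_bigl => k.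
  case: (eqVneq k m) => [->|km]; first by rewrite btwxr !andbF.
  by rewrite (btw_cat lmr km) andbT andb_orl andbb andbC; case: (btw l k m).
case: (eqVneq k m) => [->|km]; first by rewrite btwxl !andbF.
rewrite (btw_cat lmr km) andbT; case h: (btw l k m) => /=; last by rewrite andbT.
by rewrite (btw_cat_disj lmr h).
Qed.

Lemma side_true_cat m b t p : btw b t p -> side true m b p = side true m b t * side true m t p.
Proof. exact: down_cat. Qed.
Lemma side_false_cat m b t p : btw b t p -> side false m b p = side false m t p * side false m b t.
Proof. exact: up_cat. Qed.

Lemma weightM l r b t l' r' b' t' : weight l r b t * weight l' r' b' t' =
  (block l r b t * block l' r' b' t') *:
    (1 * side false l b t * side true r b t * side false l' b' t' * side true r' b' t').
Proof. by rewrite /weight -scalerAl -scalerAr scalerA mul1r !mulrA. Qed.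

Lemma mulr_sideV e m b t u :
  u * side e m b t * side (~~ e) m b t = strip m b t *: u.
Proof. by rewrite -(mulrA u) side_inv -scalerAr mulr1. Qed.

Lemma side_swap m m' (mm' : m != m') e e' b t b' t' u :
  u * side e m b t * side e' m' b' t' = u * side e' m' b' t' * side e m b t.
Proof. by rewrite -!mulrA (side_comm e e' b t b' t' mm'). Qed.

(** An L-shaped region is cut into two rectangles by prolonging either of the sides at its
    reflex corner. The weights agree: where the cut is vertical, the two elements on its
    sides combine to the scalar which the other cut has inside a rectangle. The four
    lemmas are the four positions of the reflex corner. *)
Lemma weight_Lshape1 (P Q S p q s : 'I_n) : btw P Q S -> btw p q s ->
  weight P S q s * weight P Q p q = weight P Q p s * weight Q S q s.
Proof.
move=> c r; have [PQ QS PS] := btw_distinct c.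
rewrite !weightM (side_true_cat Q r) (side_false_cat P r) !mulrA.
rewrite !(side_swap PQ, side_swap PS, side_swap QS).
rewrite (mulr_sideV true) -!scalerAl scalerA (block_cols _ _ c) (block_rows _ _ r).
by congr (_ *: _); ring.
Qed.

Lemma weight_Lshape2 (P Q S p q s : 'I_n) : btw P Q S -> btw p q s ->
  weight Q S p s * weight P Q p q = weight P S p q * weight Q S q s.
Proof.
move=> c r; have [PQ QS PS] := btw_distinct c.
rewrite !weightM (side_true_cat S r) (side_false_cat Q r) !mulrA.
rewrite !(side_swap PQ, side_swap PS, side_swap QS).
rewrite (mulr_sideV false) -!scalerAl scalerA (block_cols _ _ c) (block_rows _ _ r).
by congr (_ *: _); ring.
Qed.

Lemma weight_Lshape3 (P Q S p q s : 'I_n) : btw P S Q -> btw p q s ->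
  weight P S q s * weight P Q p q = weight S Q p q * weight P S p s.
Proof.
move=> c r; have [PS SQ PQ] := btw_distinct c.
rewrite !weightM (side_true_cat S r) (side_false_cat P r) !mulrA.
rewrite !(side_swap PQ, side_swap PS, side_swap SQ).
rewrite (mulr_sideV false) -!scalerAl scalerA (block_cols _ _ c) (block_rows _ _ r).
by congr (_ *: _); ring.
Qed.

Lemma weight_Lshape4 (P Q S p q s : 'I_n) : btw P S Q -> btw p q s ->
  weight S Q s p * weight P Q p q = weight P S p q * weight S Q s q.
Proof.
move=> c r; have [PS SQ PQ] := btw_distinct c.
have {}r : btw s p q by rewrite btw_rot.
rewrite !weightM (side_true_cat Q r) (side_false_cat S r) !mulrA.
rewrite !(side_swap PQ, side_swap PS, side_swap SQ).
rewrite (mulr_sideV true) -!scalerAl scalerA (block_cols _ _ c) (block_rows _ _ r).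
by congr (_ *: _); ring.
Qed.

(** A rectangle leaving the state [x] is determined by its bottom row [b] and its top row
    [t]: its vertical sides are on the circles [x b] and [x t]. *)
Definition hits x b t j := btw (x b) (x j) (x t) && btw b j t.
Definition empty_rect x b t := (b != t) && [forall j, ~~ hits x b t j].
Definition move x b t : {perm 'I_n} := (tperm b t * x)%g.

Lemma moveL x b t : move x b t b = x t.
Proof. by rewrite permM tpermL. Qed.
Lemma moveR x b t : move x b t t = x b.
Proof. by rewrite permM tpermR. Qed.
Lemma moveD x b t j : j != b -> j != t -> move x b t j = x j.
Proof. by move=> jb jt; rewrite permM tpermD // eq_sym. Qed.

Lemma empty_rect2 x y b t b' t' : empty_rect x b t && empty_rect y b' t' =
  [&& b != t, b' != t' & [forall j, ~~ (hits x b t j || hits y b' t' j)]].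
Proof.
rewrite /empty_rect; case: (b != t) => //=; case: (b' != t') => //=; last by rewrite andbF.
apply/andP/forallP => [[/forallP h /forallP h'] j|h]; first by rewrite negb_or h h'.
by split; apply/forallP => j; have := h j; rewrite negb_or => /andP[].
Qed.

Definition path_weight x z b t b' t' : B :=
  let y := move x b t in
  if [&& empty_rect x b t && empty_rect y b' t' & z == move y b' t']
  then weight (y b') (y t') b' t' * weight (x b) (x t) b t else 0.

Lemma path_weight0 x z b t b' t' j :
  hits x b t j || hits (move x b t) b' t' j -> path_weight x z b t b' t' = 0.
Proof.
move=> h; rewrite /path_weight empty_rect2; case: ifP => // /andP[/and3P[_ _ /forallP/(_ j)]].
by rewrite h.
Qed.

Lemma moveE x b t j : move x b t j = x (if j == b then t else if j == t then b else j).
Proof. by rewrite permM permE. Qed.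

Lemma move_move x p q s : p != q -> q != s -> p != s ->
  [/\ move (move x p q) q s = move (move x q s) p s,
      move (move x p q) p s = move (move x q s) p q,
      move (move x p q) q s = move (move x p s) p q &
      move (move x p q) s p = move (move x s q) p q].
Proof.
move=> pq qs ps; have [qp sq sp] : [/\ q != p, s != q & s != p] by rewrite ![_ == p]eq_sym [s == q]eq_sym.
have e := (eqxx, negPf pq, negPf qs, negPf ps, negPf qp, negPf sq, negPf sp).
have D (y y' : {perm 'I_n}) : y p = y' p -> y q = y' q -> y s = y' s ->
    (forall j, j != p -> j != q -> j != s -> y j = y' j) -> y = y'.
  move=> yp yq ys yj; apply/permP => j.
  case: (eqVneq j p) => [->//|jp]; case: (eqVneq j q) => [->//|jq].
  by case: (eqVneq j s) => [->//|js]; exact: yj.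
by split; apply: D => [|||j jp jq js]; rewrite !moveE ?(negPf jp, negPf jq, negPf js) ?e //;
  do 3?[rewrite ?e /=].
Qed.

Lemma btw_full (a b c : 'I_n) : btw a b c ->
  (btw a b c * btw b c a * btw c a b) *
  (btw a c b = false) * (btw b a c = false) * (btw c b a = false) : Type.
Proof. by rewrite !btwE => h; do !split; lia. Qed.

Section Triples.
Variables (x z : {perm 'I_n}) (p q s : 'I_n).
Hypotheses (pq : p != q) (qs : q != s) (ps : p != s).
Let qp : q != p. Proof. by rewrite eq_sym. Qed.
Let sq : s != q. Proof. by rewrite eq_sym. Qed.
Let sp : s != p. Proof. by rewrite eq_sym. Qed.
Let XX j k : j != k -> x j != x k. Proof. by rewrite (inj_eq perm_inj). Qed.

Let C a b c : a != b -> b != c -> a != c -> btw a b c = false -> btw a c b.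
Proof. by move=> ab bc ac h; rewrite btw_opp // h. Qed.

Let triple_case (f g : 'I_n -> bool) : f p = g p -> f q = g q -> f s = g s ->
  (forall j, j != p -> j != q -> j != s -> f j = g j) ->
  [forall j, ~~ f j] = [forall j, ~~ g j].
Proof.
move=> fp fq fs fg; apply: eq_forallb => j; congr (~~ _).
case: (eqVneq j p) => [->//|jp]; case: (eqVneq j q) => [->//|jq].
by case: (eqVneq j s) => [->//|js]; exact: fg.
Qed.

(** Two rectangles which share exactly one row move the points in three rows [p], [q],
    [s]; there are four families of such paths, according to the shared row and to its
    place in both rectangles. The other cut of the L-shaped region belongs to another
    family, with the rows rotated if the points are in the same cyclic order as their
    rows ([path_weight_id1], [path_weight_id2]), and with two rows exchanged if they are
    in the opposite order ([path_weight_refl1], [path_weight_refl2]). *)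
Lemma path_weight_id1 : btw p q s = btw (x p) (x q) (x s) ->
  path_weight x z p q q s = path_weight x z q s p s.
Proof.
case r: (btw p q s) => /esym c; last first.
  have psq := btw_full (C pq qs ps r); have PSQ := btw_full (C (XX pq) (XX qs) (XX ps) c).
  rewrite (@path_weight0 _ _ _ _ _ _ s) ?(@path_weight0 _ _ _ _ _ _ p) //.
    by rewrite /hits PSQ psq.
  by rewrite /hits PSQ psq.
have [zE _ _ _] := move_move x pq qs ps.
rewrite /path_weight !empty_rect2 ?pq ?qs ?ps ?sq ?sp ?qp zE /= !(moveL, moveR) !(@moveD x) //.
rewrite (weight_Lshape1 c r).
do 2?congr (if _ && _ then _ else _).
apply: triple_case => [|||j jp jq js]; rewrite /hits !(moveL, moveR, btwxl, btwxr, btwxx) ?(@moveD x) //.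
all: rewrite ?(moveL, moveR, btwxl, btwxr, btwxx, andbF, btw_full c, btw_full r) //=.
rewrite (btw_cat c) ?XX // (btw_cat r) //.
by do ![case: (btw _ _ _)].
Qed.

Lemma path_weight_id2 : btw p q s = btw (x p) (x q) (x s) ->
  path_weight x z p q p s = path_weight x z q s p q.
Proof.
case r: (btw p q s) => /esym c; last first.
  have psq := btw_full (C pq qs ps r); have PSQ := btw_full (C (XX pq) (XX qs) (XX ps) c).
  rewrite (@path_weight0 _ _ _ _ _ _ s) ?(@path_weight0 _ _ _ _ _ _ p) //.
    by rewrite /hits PSQ psq.
  by rewrite /hits PSQ psq.
have [_ zE _ _] := move_move x pq qs ps.
rewrite /path_weight !empty_rect2 ?pq ?qs ?ps ?sq ?sp ?qp zE /= !(moveL, moveR) !(@moveD x) //.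
rewrite (weight_Lshape2 c r).
do 2?congr (if _ && _ then _ else _).
apply: triple_case => [|||j jp jq js]; rewrite /hits !(moveL, moveR, btwxl, btwxr, btwxx) ?(@moveD x) //.
all: rewrite ?(moveL, moveR, btwxl, btwxr, btwxx, andbF, btw_full c, btw_full r) //=.
rewrite (btw_cat c) ?XX // (btw_cat r) //.
by do ![case: (btw _ _ _)].
Qed.

Lemma path_weight_refl1 : btw p q s = ~~ btw (x p) (x q) (x s) ->
  path_weight x z p q q s = path_weight x z p s p q.
Proof.
case r: (btw p q s) => /esym c; last first.
  have psq := btw_full (C pq qs ps r); have PQS := btw_full (negbFE c).
  rewrite (@path_weight0 _ _ _ _ _ _ p) ?(@path_weight0 _ _ _ _ _ _ s) //.
    by rewrite /hits !(moveL, moveR) ?(@moveD x) // PQS psq orbT.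
  by rewrite /hits !(moveL, moveR) ?(@moveD x) // PQS psq orbT.
have [_ _ zE _] := move_move x pq qs ps.
have {}c : btw (x p) (x s) (x q) by rewrite btw_opp ?XX.
rewrite /path_weight !empty_rect2 ?pq ?qs ?ps ?sq ?sp ?qp zE /= !(moveL, moveR) !(@moveD x) //.
rewrite (weight_Lshape3 c r).
do 2?congr (if _ && _ then _ else _).
apply: triple_case => [|||j jp jq js]; rewrite /hits !(moveL, moveR, btwxl, btwxr, btwxx) ?(@moveD x) //.
all: rewrite ?(moveL, moveR, btwxl, btwxr, btwxx, andbF, btw_full c, btw_full r) //=.
rewrite (btw_cat c) ?XX // (btw_cat r) //.
by do ![case: (btw _ _ _)].
Qed.

Lemma path_weight_refl2 : btw p q s = ~~ btw (x p) (x q) (x s) ->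
  path_weight x z p q s p = path_weight x z s q p q.
Proof.
case r: (btw p q s) => /esym c; last first.
  have psq := btw_full (C pq qs ps r); have PQS := btw_full (negbFE c).
  rewrite (@path_weight0 _ _ _ _ _ _ q) ?(@path_weight0 _ _ _ _ _ _ s) //.
    by rewrite /hits !(moveL, moveR) ?(@moveD x) // PQS psq orbT.
  by rewrite /hits !(moveL, moveR) ?(@moveD x) // PQS psq orbT.
have [_ _ _ zE] := move_move x pq qs ps.
have {}c : btw (x p) (x s) (x q) by rewrite btw_opp ?XX.
rewrite /path_weight !empty_rect2 ?pq ?qs ?ps ?sq ?sp ?qp zE /= !(moveL, moveR) !(@moveD x) //.
rewrite (weight_Lshape4 c r).
do 2?congr (if _ && _ then _ else _).
apply: triple_case => [|||j jp jq js]; rewrite /hits !(moveL, moveR, btwxl, btwxr, btwxx) ?(@moveD x) //.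
all: rewrite ?(moveL, moveR, btwxl, btwxr, btwxx, andbF, btw_full c, btw_full r) //=.
have r' : btw s p q by rewrite btw_rot.
rewrite (btw_cat c) ?XX // (btw_cat r') //.
by do ![case: (btw _ _ _)].
Qed.

End Triples.

(** Two chords of a circle cross or not; accordingly the ends of one are separated by the
    other. *)
Lemma chords_cross (a b c d : 'I_n) : a != c -> a != d -> b != c -> b != d -> a != b -> c != d ->
  [|| [&& btw a c b, ~~ btw a d b, ~~ btw c a d & btw c b d],
      [&& ~~ btw a c b, btw a d b, btw c a d & ~~ btw c b d] |
      (btw a c b == btw a d b) && (btw c a d == btw c b d)].
Proof. by rewrite !btwE -!val_eqE /=; lia. Qed.

Lemma path_weight_disjoint x z b t b' t' : b != b' -> b != t' -> t != b' -> t != t' ->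
  path_weight x z b t b' t' = path_weight x z b' t' b t.
Proof.
move=> bb' bt' tb' tt'.
case: (eqVneq b t) => [->|bt].
  by rewrite /path_weight !empty_rect2 eqxx /= andbF.
case: (eqVneq b' t') => [->|b't'].
  by rewrite /path_weight !empty_rect2 eqxx /= andbF.
have [b'b t'b b't t't] : [/\ b' != b, t' != b, b' != t & t' != t].
  by split; rewrite eq_sym.
have [tb t'b'] : t != b /\ t' != b' by split; rewrite eq_sym.
have XX j k : j != k -> x j != x k by rewrite (inj_eq perm_inj).
have four (f g : 'I_n -> bool) : [|| f b, f t, f b' | f t'] = [|| g b, g t, g b' | g t'] ->
    (forall j, j != b -> j != t -> j != b' -> j != t' -> f j = g j) ->
    [forall j, ~~ f j] = [forall j, ~~ g j].
  move=> fg4 fg; rewrite -[LHS]negbK -[RHS]negbK !negb_forall; congr (~~ _).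
  apply/existsP/existsP => -[j]; rewrite negbK.
    case: (boolP [|| f b, f t, f b' | f t']) => [|nf fj].
      by rewrite fg4 => /or4P[] h _; eexists; rewrite negbK; exact: h.
    exists j; rewrite negbK -fg //; apply: contraNneq nf => <-; rewrite fj ?orbT //.
  case: (boolP [|| g b, g t, g b' | g t']) => [|ng gj].
    by rewrite -fg4 => /or4P[] h _; eexists; rewrite negbK; exact: h.
  exists j; rewrite negbK fg //; apply: contraNneq ng => <-; rewrite gj ?orbT //.
rewrite /path_weight !empty_rect2 bt b't' /= !(@moveD x b t) // !(@moveD x b' t') //.
have -> : move (move x b t) b' t' = move (move x b' t') b t.
  have e := (eqxx, negPf b'b, negPf t'b, negPf b't, negPf t't, negPf bb', negPf tb',
    negPf bt', negPf tt', negPf bt, negPf b't', negPf tb, negPf t'b').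
  apply/permP => j; rewrite !moveE.
  case: (eqVneq j b) => [->|jb]; first by do 3?[rewrite ?e /=].
  case: (eqVneq j t) => [->|jt]; first by do 3?[rewrite ?e /=].
  case: (eqVneq j b') => [_|jb']; first by do 3?[rewrite ?e /=].
  case: (eqVneq j t') => [_|jt']; first by do 3?[rewrite ?e /=].
  by rewrite (negPf jb) (negPf jt).
have -> : weight (x b') (x t') b' t' * weight (x b) (x t) b t =
    weight (x b) (x t) b t * weight (x b') (x t') b' t'.
  rewrite !weightM mulrC; congr (_ *: _).
  by rewrite !(side_swap (XX _ _ bb'), side_swap (XX _ _ bt'), side_swap (XX _ _ tb'), side_swap (XX _ _ tt')).
congr (if _ && _ then _ else _); apply: four => [|j jb jt jb' jt']; last first.
  by rewrite /hits !moveD // orbC.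
rewrite /hits !(moveL, moveR, btwxl, btwxr, andbF, orbF, orFb) !moveD //.
have := chords_cross (XX _ _ bb') (XX _ _ bt') (XX _ _ tb') (XX _ _ tt') (XX _ _ bt) (XX _ _ b't').
have := chords_cross bb' bt' tb' tt' bt b't'.
by do ![case: (btw _ _ _)].
Qed.

(** Two rectangles with the same two rows and complementary columns fill an annulus which
    contains the whole row [b]. *)
Lemma weight_row_annulus l r b t : (forall k, \prod_m dl m k = 0) -> b != t -> l != r ->
  weight r l b t * weight l r b t = 0.
Proof.
move=> rows0 bt lr; have rl : r != l by rewrite eq_sym.
rewrite weightM !(side_swap lr) (mulr_sideV false) -!scalerAl (mulr_sideV true) !scalerA.
suff -> : block r l b t * block l r b t * strip r b t * strip l b t = 0 by rewrite scale0r.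
have <- : \prod_m strip m b t = 0.
  rewrite /strip exchange_big (bigD1 b) /=; last by rewrite arcE bt eqxx.
  by rewrite rows0 mul0r.
rewrite (bigD1 l) //= (bigD1 r) //= mulrC; congr (_ * _); rewrite mulrC; congr (_ * _).
rewrite [RHS](bigID (fun m => btw r m l)) /=; congr (_ * _); apply: eq_bigl => m.
  case: (eqVneq m l) => [->|ml]; first by rewrite btwxr.
  by case: (eqVneq m r) => [->|mr]; rewrite ?btwxl.
case: (eqVneq m l) => [->|ml]; first by rewrite btwxl.
case: (eqVneq m r) => [->|mr]; rewrite ?btwxr //=.
by rewrite -btw_opp // 1?eq_sym // 2!btw_rot.
Qed.

(** Two rectangles with the same two columns fill an annulus: each circle in its
    interior contributes all of its scalars, and the two sides are closed up to loops. *)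
Lemma weight_column_annulus l r b t : b != t -> l != r ->
  weight l r t b * weight l r b t = (\prod_(m | btw l m r) \prod_k dl m k) *:
    (side false l t b * side false l b t * (side true r t b * side true r b t)).
Proof.
move=> bt lr; have rl : r != l by rewrite eq_sym.
rewrite weightM !(side_swap rl) mul1r !mulrA; congr (_ *: _).
by rewrite -big_split; apply: eq_bigr => m _ /=; rewrite mulrC; exact: prod_arcC.
Qed.

Definition kernel x y : B :=
  \sum_b \sum_(t | empty_rect x b t && (y == move x b t)) weight (x b) (x t) b t.

Hypothesis A2 : 1 + 1 = 0 :> A.

Let addBB (v : B) : v + v = 0.
Proof. by rewrite -[v]scale1r -scalerDl A2 scale0r. Qed.

Lemma path_weightxx1 x z b b' t' : path_weight x z b b b' t' = 0.
Proof. by rewrite /path_weight !empty_rect2 eqxx. Qed.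

Lemma path_weightxx2 x z b t b' : path_weight x z b t b' b' = 0.
Proof. by rewrite /path_weight !empty_rect2 eqxx andbF. Qed.

Lemma kernel_mul x z :
  \sum_y kernel y z * kernel x y = \sum_b \sum_t \sum_b' \sum_t' path_weight x z b t b' t'.
Proof.
rewrite /kernel; under eq_bigr do rewrite mulr_sumr.
rewrite exchange_big; apply: eq_bigr => b _ /=.
under eq_bigr do rewrite mulr_sumr big_mkcond /=.
rewrite exchange_big; apply: eq_bigr => t _ /=.
rewrite (bigD1 (move x b t)) //= eqxx andbT [X in _ + X]big1 ?addr0; last first.
  by move=> y /negPf ->; rewrite andbF.
case: ifP => bt; last first.
  by rewrite big1 // => b' _; rewrite big1 // => t' _; rewrite /path_weight bt.
rewrite mulr_suml; apply: eq_bigr => b' _; rewrite mulr_suml big_mkcond; apply: eq_bigr => t' _.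
by rewrite /path_weight bt.
Qed.

(** The terms are cancelled in pairs. The triples [(p, q, s)] of rows are divided by [ty],
    which says whether the points of [x] are in the same cyclic order as their rows; on
    each part one of the relabelings [rot], [flip], [flop] matches two of the four
    families of paths. *)
Lemma path_weight_sum_triples x z :
  \sum_(u : 'I_n * 'I_n * 'I_n | [&& u.1.1 != u.1.2, u.2 != u.1.1 & u.2 != u.1.2])
    (path_weight x z u.1.1 u.1.2 u.1.1 u.2 + path_weight x z u.1.1 u.1.2 u.1.2 u.2 +
     (path_weight x z u.1.1 u.1.2 u.2 u.1.1 + path_weight x z u.1.1 u.1.2 u.2 u.1.2)) = 0.
Proof.
pose ty (u : 'I_n * 'I_n * 'I_n) :=
  btw u.1.1 u.1.2 u.2 == btw (x u.1.1) (x u.1.2) (x u.2).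
have XX j k : j != k -> x j != x k by rewrite (inj_eq perm_inj).
pose rot (u : 'I_n * 'I_n * 'I_n) := (u.1.2, u.2, u.1.1).
pose flip (u : 'I_n * 'I_n * 'I_n) := (u.1.1, u.2, u.1.2).
pose flop (u : 'I_n * 'I_n * 'I_n) := (u.2, u.1.2, u.1.1).
have rotI : injective rot by case=> [[a b] c] [[a' b'] c'] [-> -> ->].
have flipI : injective flip by case=> [[a b] c] [[a' b'] c'] [-> -> ->].
have flopI : injective flop by case=> [[a b] c] [[a' b'] c'] [-> -> ->].
pose D (u : 'I_n * 'I_n * 'I_n) := [&& u.1.1 != u.1.2, u.2 != u.1.1 & u.2 != u.1.2].
have Drot u : D (rot u) = D u.
  case: u => [[p q] s]; rewrite /D /rot /= [q == s]eq_sym [p == s]eq_sym.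
  by case: (p != q); case: (s != p); case: (s != q).
have Dflip u : D (flip u) = D u.
  case: u => [[p q] s]; rewrite /D /flip /= [q == s]eq_sym [p == s]eq_sym [q == p]eq_sym.
  by case: (p != q); case: (s != p); case: (s != q).
have Dflop u : D (flop u) = D u.
  case: u => [[p q] s]; rewrite /D /flop /= [p == s]eq_sym.
  by case: (p != q); case: (s != p); case: (s != q).
have tyrot u : ty (rot u) = ty u.
  by case: u => [[p q] s]; rewrite /ty /rot /= [btw p q s]btw_rot [btw (x p) _ _]btw_rot.
have tyflip u : D u -> ty (flip u) = ty u.
  case: u => [[p q] s] /and3P[/= pq sp sq]; have [qs ps] : q != s /\ p != s by split; rewrite eq_sym.
  by rewrite /ty /flip /= btw_opp // (btw_opp (XX _ _ pq)) ?XX //; case: btw; case: btw.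
have tyflop u : D u -> ty (flop u) = ty u.
  move=> Du; rewrite -[RHS]tyrot -[RHS]tyrot -[RHS]tyflip ?Drot //.
pose F1 (u : 'I_n * 'I_n * 'I_n) := path_weight x z u.1.1 u.1.2 u.1.2 u.2.
pose F2 (u : 'I_n * 'I_n * 'I_n) := path_weight x z u.1.1 u.1.2 u.2 u.1.1.
pose F3 (u : 'I_n * 'I_n * 'I_n) := path_weight x z u.1.1 u.1.2 u.1.1 u.2.
pose F4 (u : 'I_n * 'I_n * 'I_n) := path_weight x z u.1.1 u.1.2 u.2 u.1.2.
have Dt u : D u -> [/\ u.1.1 != u.1.2, u.1.2 != u.2 & u.1.1 != u.2].
  by case/and3P=> -> ? ?; rewrite ![_ == u.2]eq_sym.
have refl u : D u -> ~~ ty u -> btw u.1.1 u.1.2 u.2 = ~~ btw (x u.1.1) (x u.1.2) (x u.2).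
  by rewrite /ty => _; case: btw; case: btw.
have id32 : \sum_(u | D u && ty u) F3 u + \sum_(u | D u && ty u) F2 u = 0.
  apply: (sum_paired addBB rotI) => [u|]; first by rewrite Drot tyrot.
  by case=> [[p q] s] /= /andP[/Dt[pq qs ps] /eqP]; exact: path_weight_id2.
have id14 : \sum_(u | D u && ty u) F1 u + \sum_(u | D u && ty u) F4 u = 0.
  apply: (sum_paired addBB rotI) => [u|]; first by rewrite Drot tyrot.
  by case=> [[p q] s] /= /andP[/Dt[pq qs ps] /eqP]; exact: path_weight_id1.
have re13 : \sum_(u | D u && ~~ ty u) F1 u + \sum_(u | D u && ~~ ty u) F3 u = 0.
  apply: (sum_paired addBB flipI) => [u|].
    by rewrite Dflip; case Du: (D u) => //=; rewrite tyflip.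
  by case=> [[p q] s] /andP[Du /(refl _ Du)]; have [pq qs ps] := Dt _ Du; exact: path_weight_refl1.
have re24 : \sum_(u | D u && ~~ ty u) F2 u + \sum_(u | D u && ~~ ty u) F4 u = 0.
  apply: (sum_paired addBB flopI) => [u|].
    by rewrite Dflop; case Du: (D u) => //=; rewrite tyflop.
  by case=> [[p q] s] /andP[Du /(refl _ Du)]; have [pq qs ps] := Dt _ Du; exact: path_weight_refl2.
rewrite (eq_bigl D) // (eq_bigr (fun u => F3 u + F1 u + (F2 u + F4 u))) //.
clearbody D F1 F2 F3 F4 ty.
rewrite (bigID ty) !big_split /= [X in X + _]addrACA id32 id14 addr0 add0r [X in X + _]addrC re13 add0r.
exact: re24.
Qed.

(** The pairs without a common row cancel by exchanging the two rectangles, those with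
    one common row by the two cuts of an L-shaped region, and the row annuli vanish;
    what remains are the annuli between two vertical circles. *)
Theorem kernel_square x z : (forall k, \prod_m dl m k = 0) ->
  \sum_y kernel y z * kernel x y = \sum_b \sum_t path_weight x z b t t b.
Proof.
move=> rows0; rewrite kernel_mul.
pose tri b t s := path_weight x z b t b s + path_weight x z b t t s +
  (path_weight x z b t s b + path_weight x z b t s t).
pose dis b t b' t' := if [&& b' != b, b' != t, t' != b & t' != t]
  then path_weight x z b t b' t' else 0.
transitivity (\sum_b \sum_t (path_weight x z b t t b +
    \sum_(s | (b != t) && ((s != b) && (s != t))) tri b t s + \sum_b' \sum_t' dis b t b' t')).
  apply: eq_bigr => b _; apply: eq_bigr => t _; case: (eqVneq b t) => [<-|bt].
    rewrite !big1 ?addr0 ?path_weightxx1 // => b' _; rewrite big1 // => t' _.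
      by rewrite /dis path_weightxx1 if_same.
    exact: path_weightxx1.
  rewrite (sum_ordered_pairs bt); last by move=> i; exact: path_weightxx2.
  have -> : path_weight x z b t b t = 0.
    rewrite /path_weight; case: ifP => // _; rewrite !(moveL, moveR).
    by rewrite weight_row_annulus ?(inj_eq perm_inj).
  rewrite add0r /=; congr (_ + _).
  rewrite big_mkcond /=; apply: eq_bigr => s _; rewrite big_mkcond /=.
  case: ifP => [/andP[sb st]|h]; last first.
    by rewrite big1 // => t' _; rewrite /dis andbA h.
  by rewrite big_mkcond; apply: eq_bigr => t' _; rewrite /dis sb st.
have tri0 : \sum_b \sum_t \sum_(s | (b != t) && ((s != b) && (s != t))) tri b t s = 0.
  rewrite pair_bigA pair_big_dep /= -[RHS](path_weight_sum_triples x z).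
  by apply: eq_bigl => u.
have dis0 : \sum_b \sum_t \sum_b' \sum_t' dis b t b' t' = 0.
  rewrite pair_bigA /=; under eq_bigr do rewrite pair_bigA.
  apply: (sum_symmetric addBB) => [[b t] [b' t']|[b t]]; last by rewrite /dis eqxx.
  rewrite /dis /= [b == b']eq_sym [t == t']eq_sym [b == t']eq_sym [t == b']eq_sym.
  case: (eqVneq b' b) => // b'b; case: (eqVneq b' t) => //= b't; rewrite ?andbF //.
  case: (eqVneq t' b) => // t'b; case: (eqVneq t' t) => //= t't.
  by apply: path_weight_disjoint; rewrite // eq_sym.
under eq_bigr do rewrite !big_split /=.
by rewrite !big_split /= tri0 dis0 !addr0.
Qed.

End TransferComplex.

(** * Two by two matrices in characteristic two *)

Section TwoByTwo.
Variable A : comNzRingType.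
Implicit Types (M N : 'M[A]_2) (a b c d : A).

Definition mat2 a b c d : 'M[A]_2 :=
  \matrix_(i, j) if i == 0 then if j == 0 then a else b else if j == 0 then c else d.

Lemma mat2P M N : M 0 0 = N 0 0 -> M 0 1 = N 0 1 -> M 1 0 = N 1 0 -> M 1 1 = N 1 1 -> M = N.
Proof.
move=> e00 e01 e10 e11; apply/matrixP.
have two (i : 'I_2) : i = 0 \/ i = 1.
  by case: i => -[|[|//]] h; [left|right]; apply: val_inj.
by move=> i j; case: (two i) => ->; case: (two j) => ->.
Qed.

Lemma mul2E M N i j : (M * N) i j = M i 0 * N 0 j + M i 1 * N 1 j.
Proof.
rewrite mxE big_ord_recl big_ord1; congr (_ + M i _ * N _ j); exact: val_inj.
Qed.

Lemma mat2E a b c d : (mat2 a b c d 0 0 = a) * (mat2 a b c d 0 1 = b) *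
  (mat2 a b c d 1 0 = c) * (mat2 a b c d 1 1 = d).
Proof. by do !split; rewrite mxE. Qed.

Lemma one2E : ((1 : 'M[A]_2) 0 0 = 1) * ((1 : 'M[A]_2) 0 1 = 0) *
  ((1 : 'M[A]_2) 1 0 = 0) * ((1 : 'M[A]_2) 1 1 = 1).
Proof. by do !split; rewrite mxE. Qed.

Lemma mat2M a b c d a' b' c' d' : mat2 a b c d * mat2 a' b' c' d' =
  mat2 (a * a' + b * c') (a * b' + b * d') (c * a' + d * c') (c * b' + d * d').
Proof. by apply: mat2P; rewrite mul2E !mat2E. Qed.

Lemma scale2E a M i j : (a *: M) i j = a * M i j.
Proof. by rewrite mxE. Qed.

(** The adjugate matrix, without signs as the characteristic is two. *)
Definition adj2 M := mat2 (M 1 1) (M 0 1) (M 1 0) (M 0 0).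

Lemma adj2M M N : adj2 (M * N) = adj2 N * adj2 M.
Proof. by apply: mat2P; rewrite !(mul2E, mat2E); ring. Qed.

Hypothesis A2 : 1 + 1 = 0 :> A.

Lemma addAA a : a + a = 0.
Proof. by rewrite -[a]mulr1 -mulrDr A2 mulr0. Qed.

Lemma add_adj2 M : M + adj2 M = (M 0 0 + M 1 1)%:A.
Proof.
apply: mat2P; rewrite scale2E one2E ?mulr0 ?mulr1 [LHS]mxE mat2E ?addAA //.
exact: addrC.
Qed.

Lemma mul_adj2 M : M * adj2 M = (M 0 0 * M 1 1 + M 0 1 * M 1 0)%:A /\
  adj2 M * M = (M 0 0 * M 1 1 + M 0 1 * M 1 0)%:A.
Proof.
have ab0 (a b : A) : a * b + b * a = 0 by rewrite mulrC addAA.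
by split; apply: mat2P; rewrite !(mul2E, mat2E, scale2E, one2E) ?mulr1 ?mulr0 ?ab0 //; ring.
Qed.

Lemma tr2M M N : (M * N) 0 0 + (M * N) 1 1 = (N * M) 0 0 + (N * M) 1 1.
Proof. by rewrite !mul2E; ring. Qed.

End TwoByTwo.

(** * The two commuted columns *)

(** In this section [v] gives the weights of the squares, [i] and [m0 = ordS i] are the
    commuted columns, and [m0] is also the circle between them. With the circle of the
    first grid in place, [m0] has the column [i] on its left and the column [m0] on its
    right; with that of the second grid it is the reverse. The two circles meet in the
    rows [a] and [q], so that the marks of the column [i] are on the arc from [a] to [q],
    and those of the column [m0] on the arc from [q] to [a]. *)
Section Commute.
Variables (n : nat) (F : comNzRingType) (v : cell n -> F) (i a q : 'I_n).
Let m0 := ordS i.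
Local Notation u k := (v (i, k)).
Local Notation w k := (v (m0, k)).
Hypothesis F2 : 1 + 1 = 0 :> F.
Hypothesis im0 : i != m0.
Hypothesis aq : a != q.
Hypothesis u1 : forall k, btw q k a -> u k = 1.
Hypothesis w1 : forall k, btw a k q -> w k = 1.
Hypothesis rows0 : forall k, \prod_c v (c, k) = 0.
Hypothesis cols0 : forall c, \prod_k v (c, k) = 0.

Let m0i : m0 != i. Proof. by rewrite eq_sym. Qed.
Let qa : q != a. Proof. by rewrite eq_sym. Qed.

Let A : comNzRingType := {poly F}.
Let A2 : 1 + 1 = 0 :> A. Proof. by rewrite -polyCD F2. Qed.

(** The index 0 stands for the circle of the first grid and 1 for that of the second. The
    side of a region on the circle [m0] passes from 0 to 1 in the row [q], and from 1 to
    0 in the row [a], where it picks up the variable. *)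
Definition crossing k : 'M[A]_2 :=
  mat2 (u k)%:P (if k == a then 'X else 0) (if k == q then 1 else 0) (w k)%:P.

(** On the circles other than [m0] the elements are scalars, which charge each column to
    the left side; the column [i] is already charged to [m0]. *)
Definition transfer (e : bool) (m k : 'I_n) : 'M[A]_2 :=
  if m == m0 then if e then crossing k else adj2 (crossing k)
  else if e || (m == i) then 1 else (v (m, k))%:P%:A.

Definition crossed m k : A :=
  if m == m0 then (u k * w k)%:P else if m == i then 1 else (v (m, k))%:P.

Lemma crossing_det k : crossing k 0 0 * crossing k 1 1 + crossing k 0 1 * crossing k 1 0 =
  (u k * w k)%:P.
Proof.
rewrite !mat2E polyCM; case: (eqVneq k a) => [->|_]; last by rewrite mul0r addr0.
by rewrite (negPf aq) mulr0 addr0.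
Qed.

Lemma transfer_comm e e' m m' k k' : m != m' ->
  GRing.comm (transfer e m k) (transfer e' m' k').
Proof.
have sc e1 m1 k1 X : m1 != m0 -> GRing.comm (transfer e1 m1 k1) X.
  move=> h; rewrite /transfer (negPf h); case: ifP => _; first exact/commr_sym/commr1.
  by rewrite /GRing.comm -scalerAl -scalerAr mul1r mulr1.
move=> mm'; case: (eqVneq m m0) => [mE|/sc]; last exact.
by apply/commr_sym/sc; rewrite eq_sym -mE.
Qed.

Lemma transfer_inv e m k : transfer e m k * transfer (~~ e) m k = (crossed m k)%:A.
Proof.
rewrite /transfer /crossed; case: ifP => _; last first.
  by case: e; case: (m == i); rewrite /= ?mul1r ?mulr1 ?scale1r.
by have [h h'] := mul_adj2 A2 (crossing k); case: e; rewrite /= (h, h') crossing_det.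
Qed.

Lemma crossed_rows k : \prod_m crossed m k = 0.
Proof.
rewrite (bigD1 m0) //= (bigD1 i) //= /crossed eqxx (negPf im0) eqxx mul1r.
rewrite (eq_bigr (fun m => (v (m, k))%:P)) => [|m /andP[/negPf -> /negPf ->]] //.
have := rows0 k; rewrite (bigD1 m0) //= (bigD1 i) //= mulrCA mulrA => e.
by rewrite -rmorph_prod -polyCM e polyC0.
Qed.

Local Notation K := (kernel transfer crossed).
Local Notation W := (weight transfer crossed).

Lemma up_scalar (f : 'I_n -> 'M[A]_2) (g : 'I_n -> A) b t : (forall k, f k = (g k)%:A) ->
  up f b t = (\prod_(k | arc b t k) g k)%:A.
Proof.
move=> fg; move: b; apply: (@arc_ind _ (fun b =>
  up f b t = (\prod_(k | arc b t k) g k)%:A) t).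
  by rewrite upxx big_pred0 ?scale1r // => k; rewrite arcxx.
by move=> b bt IH; rewrite up_ordS // prod_arc_ordS // IH fg -scalerAr mulr1 scalerA.
Qed.

Lemma down_one (f : 'I_n -> 'M[A]_2) b t : (forall k, f k = 1) -> down f b t = 1.
Proof.
move=> f1; move: b; apply: (@arc_ind _ (fun b => down f b t = 1) t) => [|b bt IH].
  exact: downxx.
by rewrite down_ordS // IH f1 mul1r.
Qed.

Lemma iter_up_adj (f : 'I_n -> 'M[A]_2) h d :
  iter_up (fun k => adj2 (f k)) h d = adj2 (iter_down f h d).
Proof.
elim: d h => [|d IH] h /=; last by rewrite IH adj2M.
by apply: mat2P; rewrite mat2E !one2E.
Qed.

Lemma down_diagonal b t : (forall k, arc b t k -> (k != a) && (k != q)) ->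
  down crossing b t = mat2 (\prod_(k | arc b t k) (u k)%:P) 0 0 (\prod_(k | arc b t k) (w k)%:P).
Proof.
move: b; apply: (@arc_ind _ (fun b => (forall k, arc b t k -> (k != a) && (k != q)) ->
  down crossing b t = mat2 (\prod_(k | arc b t k) (u k)%:P) 0 0 (\prod_(k | arc b t k) (w k)%:P)) t).
  move=> _; rewrite downxx !big_pred0 => [|k|k]; rewrite ?arcxx //.
  by apply: mat2P; rewrite one2E mat2E.
move=> b bt IH h; have /andP[ba bq] : (b != a) && (b != q) by apply: h; rewrite arcE bt eqxx.
rewrite down_ordS // !(prod_arc_ordS _ bt) IH => [|k kt]; last first.
  by apply: h; rewrite arc_ordS // kt orbT.
by rewrite /crossing (negPf ba) (negPf bq) mat2M !mul0r !mulr0 !addr0 add0r.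
Qed.

Lemma down_half (b t : 'I_n) : (b == a) && (t == q) || (b == q) && (t == a) ->
  down crossing b t = crossing b *
    mat2 (\prod_(k | arc (ordS b) t k) u k)%:P 0 0 (\prod_(k | arc (ordS b) t k) w k)%:P.
Proof.
move=> bt; have {}bt' : b != t by case/orP: bt => /andP[/eqP -> /eqP ->].
rewrite down_ordS // down_diagonal ?rmorph_prod // => k /(arc_ordS_btw bt') /btw_distinct[bk kt _].
by case/orP: bt => /andP[/eqP bE /eqP tE]; rewrite -bE -tE [k == b]eq_sym bk kt.
Qed.

(** The trace is a sum over closed paths along the two circles. The two paths without a
    change of circle, and hence those weighted by a whole column, vanish since each
    column has an X. The one that changes at both intersection points only runs along
    arcs without marks, and contributes 1 times the variable. *)
Lemma trace_loop h : (iter_down crossing h n) 0 0 + (iter_down crossing h n) 1 1 = 'X.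
Proof.
have rot h' : h' != h -> iter_down crossing h n 0 0 + iter_down crossing h n 1 1 =
    iter_down crossing h' n 0 0 + iter_down crossing h' n 1 1.
  by move=> hh'; rewrite -(down_loop crossing hh') tr2M down_loop // eq_sym.
have -> : iter_down crossing h n 0 0 + iter_down crossing h n 1 1 =
    iter_down crossing q n 0 0 + iter_down crossing q n 1 1.
  by case: (eqVneq q h) => [->|/rot].
rewrite -(down_loop crossing qa) !down_half ?eqxx ?orbT // /crossing !eqxx (negPf aq) (negPf qa).
have -> : \prod_(k | arc (ordS q) a k) u k = 1.
  by rewrite big1 // => k /(arc_ordS_btw qa) /u1.
have -> : \prod_(k | arc (ordS a) q k) w k = 1.
  by rewrite big1 // => k /(arc_ordS_btw aq) /w1.
rewrite !mat2M !mat2E !mul0r !mulr0 !addr0 ?add0r ?mul1r ?mulr1 -!polyCM.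
have -> : u q * (u a * \prod_(k | arc (ordS a) q k) u k) = 0.
  rewrite -(cols0 i) -(prod_arcC _ qa) (prod_arc_ordS _ qa) (prod_arc_ordS _ aq).
  by rewrite [X in _ = _ * X * _]big1 ?mulr1 // => k /(arc_ordS_btw qa) /u1.
have -> : w q * \prod_(k | arc (ordS q) a k) w k * w a = 0.
  rewrite -(cols0 m0) -(prod_arcC _ qa) (prod_arc_ordS _ qa) (prod_arc_ordS _ aq) mulrA.
  by rewrite [X in _ = _ * X]big1 ?mulr1 // => k /(arc_ordS_btw aq) /w1.
by rewrite mul0r polyC0 !addr0 add0r.
Qed.

Let Sm0 : ordS m0 != m0.
Proof.
apply: contraNneq m0i => e.
by have := ordS_period2 i (etrans (congr1 (@ordS n) e) e); rewrite e orbb eq_sym.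
Qed.

(** A column annulus contains an X, hence does not count, unless it lies between the
    circle [m0] and one of its neighbours: there the loop along [m0] takes the place of
    the product over the column. *)
Lemma annulus_weight l r b t : b != t -> l != r -> W l r t b * W l r b t =
  (if (l == m0) && (r == ordS m0) then iter_up (fun k => adj2 (crossing k)) b n else 0) +
  (if (l == i) && (r == m0) then iter_down crossing t n else 0).
Proof.
move=> bt lr; have tb : t != b by rewrite eq_sym.
rewrite (weight_column_annulus _ transfer_comm) // /side.
have right1 m c d : m != m0 -> down (transfer true m) c d = 1.
  by move=> mm0; apply: down_one => k; rewrite /transfer (negPf mm0).
case: (eqVneq l m0) lr => [->|lm0] lr.
  rewrite (negPf m0i) /= addr0 !(@right1 r) 1?eq_sym // !mulr1 up_loop //.
  case: (eqVneq r (ordS m0)) => [->|rS].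
    rewrite big_pred0 ?scale1r => [|m]; last exact: btw_ordS.
    by apply: eq_iter_up => k; rewrite /transfer eqxx.
  rewrite (bigD1 (ordS m0)) /=; last by rewrite btw_ordS_l // eq_sym.
  have Si : ordS m0 != i.
    apply: contraNneq rS => e; have := ordS_period2 r e.
    by rewrite e [r == ordS i]eq_sym (negPf lr) orbF.
  rewrite /crossed (negPf Sm0) (negPf Si) -rmorph_prod cols0 rmorph0 mul0r scale0r //.
rewrite add0r; case: (eqVneq l i) lr => [->|li] lr; last first.
  rewrite -[_ * up _ _ _](_ : 0 = _) ?mul0r ?scaler0 //.
  rewrite !(@up_scalar _ (fun k => (v (l, k))%:P)) => [|k|k]; rewrite /transfer ?(negPf lm0, negPf li) //.
  by rewrite -scalerAl mul1r scalerA mulrC prod_arcC // -rmorph_prod cols0 rmorph0 scale0r.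
have up1 c d : up (transfer false i) c d = 1.
  rewrite (@up_scalar _ (fun=> 1)) => [|k]; rewrite ?big1_eq ?scale1r //.
  by rewrite /transfer (negPf im0) eqxx.
rewrite !up1 !mul1r; case: (eqVneq r m0) => [->|rm0] /=.
  rewrite big_pred0 ?scale1r => [|m]; last exact: btw_ordS.
  by rewrite down_loop //; apply: eq_iter_down => k; rewrite /transfer eqxx.
rewrite (bigD1 m0) /=; last by rewrite btw_ordS_l // eq_sym.
rewrite [X in X * _](_ : _ = 0) ?mul0r ?scale0r // /crossed eqxx -rmorph_prod big_split /=.
by rewrite cols0 mul0r rmorph0.
Qed.

(** The two annuli next to the circle [m0] contribute the product of its matrices and the
    adjugate of this product, whose sum is the trace. *)
Lemma kernel_square_crossing x z :
  \sum_y K y z * K x y = if z == x then 'X%:A else 0.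
Proof.
rewrite (kernel_square transfer_comm transfer_inv A2 x z crossed_rows).
have XX j k : (x j == x k) = (j == k) by rewrite (inj_eq perm_inj).
have zE b t : move (move x b t) t b = x.
  by rewrite /move mulgA [tperm t b]tpermC tperm2 mul1g.
case: ifP => [/eqP ->|zx]; last first.
  rewrite big1 // => b _; rewrite big1 // => t _.
  by rewrite /path_weight zE zx andbF.
pose h := (x^-1)%g m0; pose t1 := (x^-1)%g (ordS m0); pose b2 := (x^-1)%g i.
have atE b c : (x b == c) = (b == (x^-1)%g c) by rewrite -{1}[c](permKV x) XX.
pose U := iter_up (fun k => adj2 (crossing k)) h n; pose D := iter_down crossing h n.
have term b t : path_weight transfer crossed x x b t t b =
    (if (b == h) && (t == t1) then U else 0) + (if (b == b2) && (t == h) then D else 0).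
  have [<-|bt] := eqVneq b t.
    rewrite /path_weight !empty_rect2 eqxx /=.
    case: (eqVneq b h) => [->|_] /=; last by rewrite andbF add0r.
    by rewrite /h /t1 /b2 !(inj_eq perm_inj) [m0 == _]eq_sym (negPf Sm0) (negPf m0i) add0r.
  have lr : x b != x t by rewrite XX.
  rewrite /path_weight !empty_rect2 bt eq_sym bt zE eqxx andbT !(moveL, moveR) annulus_weight //=.
  rewrite !atE -/h -/t1 -/b2.
  have -> : (if (b == h) && (t == t1) then iter_up (fun k => adj2 (crossing k)) b n else 0) =
      (if (b == h) && (t == t1) then U else 0) by case: eqVneq => [->|].
  have -> : (if (b == b2) && (t == h) then iter_down crossing t n else 0) =
      (if (b == b2) && (t == h) then D else 0) by case: (eqVneq t h) => [->|]; rewrite ?andbF.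
  case: (boolP [forall j, _]) => [//|].
  rewrite negb_forall => /existsP[j]; rewrite negbK /hits !(moveL, moveR).
  move=> hit; have xS : x t != ordS (x b).
    by apply/eqP => e; move: hit; rewrite e !btw_ordS.
  rewrite !ifF ?addr0 //; apply/negbTE; apply: contra xS => /andP[/eqP -> /eqP ->].
    by rewrite /b2 /h !permKV.
  by rewrite /t1 /h !permKV.
under eq_bigr do under eq_bigr do rewrite term.
have delta (b0 t0 : 'I_n) (Z : 'M[A]_2) :
    \sum_b \sum_t (if (b == b0) && (t == t0) then Z else 0) = Z.
  rewrite (bigD1 b0) //= (bigD1 t0) //= !eqxx /= !big1 ?addr0 // => [b /negPf ->|t /negPf ->] //.
  by rewrite big1.
under eq_bigr do rewrite big_split /=.
by rewrite big_split /= !delta /U iter_up_adj addrC add_adj2 // trace_loop.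
Qed.

(** At the value 0 of the variable only the crossing in the row [q] is left, so the
    matrices are lower triangular, with diagonal entries [x] and [y]. *)
Definition lower (M : 'M[A]_2) (x y : F) := [/\ (M 0 0)`_0 = x, (M 0 1)`_0 = 0 & (M 1 1)`_0 = y].

Lemma lower1 : lower 1 1 1.
Proof. by split; rewrite one2E ?coef0 ?coefC. Qed.

Lemma lowerM M N x y x' y' : lower M x y -> lower N x' y' -> lower (M * N) (x * x') (y * y').
Proof.
move=> [h1 h2 h3] [h4 h5 h6]; split; rewrite mul2E coefD !coef0M ?h1 ?h2 ?h3 ?h4 ?h5 ?h6.
- by rewrite mul0r addr0.
- by rewrite mulr0 mul0r addr0.
- by rewrite mulr0 add0r.
Qed.

Lemma lowerZ (p : A) M x y : lower M x y -> lower (p *: M) (p`_0 * x) (p`_0 * y).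
Proof. by move=> [h1 h2 h3]; split; rewrite scale2E coef0M ?h1 ?h2 ?h3 ?mulr0. Qed.

Lemma lower_down f (g h : 'I_n -> F) b t : (forall k, lower (f k) (g k) (h k)) ->
  lower (down f b t) (\prod_(k | arc b t k) g k) (\prod_(k | arc b t k) h k).
Proof.
move=> fgh; move: b; apply: (@arc_ind _ (fun b =>
  lower (down f b t) (\prod_(k | arc b t k) g k) (\prod_(k | arc b t k) h k)) t) => [|b bt IH].
  rewrite downxx !big_pred0; [exact: lower1|by move=> k; rewrite arcxx|by move=> k; rewrite arcxx].
by rewrite down_ordS // !(prod_arc_ordS _ bt); exact: lowerM.
Qed.

Lemma lower_up f (g h : 'I_n -> F) b t : (forall k, lower (f k) (g k) (h k)) ->
  lower (up f b t) (\prod_(k | arc b t k) g k) (\prod_(k | arc b t k) h k).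
Proof.
move=> fgh; move: b; apply: (@arc_ind _ (fun b =>
  lower (up f b t) (\prod_(k | arc b t k) g k) (\prod_(k | arc b t k) h k)) t) => [|b bt IH].
  rewrite upxx !big_pred0; [exact: lower1|by move=> k; rewrite arcxx|by move=> k; rewrite arcxx].
by rewrite up_ordS // !(prod_arc_ordS _ bt) mulrC [X in lower _ _ X]mulrC; exact: lowerM.
Qed.

Definition swapped (c : cell n) : cell n := (tperm i m0 c.1, c.2).

Definition area (f : cell n -> F) l r b t : F :=
  \prod_(c | arc l r c) \prod_(k | arc b t k) f (c, k).

(** The diagonal entries count the squares of a rectangle in the first and in the second
    grid. *)
Lemma lower_weight l r b t : l != r ->
  lower (W l r b t) (area v l r b t) (area (v \o swapped) l r b t).
Proof.
move=> lr; pose V c := \prod_(k | arc b t k) v (c, k).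
have blk : (block crossed l r b t)`_0 =
    \prod_(m | btw l m r) (if m == m0 then V i * V m0 else if m == i then 1 else V m).
  rewrite /block /strip -[LHS]/(coefp 0 _) rmorph_prod; apply: eq_bigr => m _.
  rewrite rmorph_prod /V -big_split /crossed /=; case: eqP => _.
    by apply: eq_bigr => k _; rewrite coefC.
  by case: eqP => _; [rewrite big1 // => k _; rewrite coefC|apply: eq_bigr => k _; rewrite coefC].
have sf : lower (side transfer false l b t)
    (if l == m0 then V m0 else if l == i then 1 else V l)
    (if l == m0 then V i else if l == i then 1 else V l).
  rewrite /side /V /transfer; case: (eqVneq l m0) => [_|lm0].
    apply: lower_up => k; rewrite /crossing; split; rewrite !mat2E ?coefC //.
    by case: ifP; rewrite ?coefX ?coef0.
  case: (eqVneq l i) => [_|li].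
    have := @lower_up (fun=> 1) (fun=> 1) (fun=> 1) b t (fun=> lower1).
    by rewrite !big1_eq.
  by apply: lower_up => k; split; rewrite scale2E one2E ?mulr1 ?mulr0 ?coefC ?coef0.
have st : lower (side transfer true r b t) (if r == m0 then V i else 1) (if r == m0 then V m0 else 1).
  rewrite /side /V /transfer; case: (eqVneq r m0) => [_|rm0].
    apply: lower_down => k; rewrite /crossing; split; rewrite !mat2E ?coefC //.
    by case: ifP; rewrite ?coefX ?coef0.
  have := @lower_down (fun=> 1) (fun=> 1) (fun=> 1) b t (fun=> lower1).
  by rewrite !big1_eq.
have := lowerZ (block crossed l r b t) (lowerM sf st); rewrite blk (@big_columns n F 1 *%R V i l r im0 lr).
rewrite /area -/(V _) /swapped /=.
have := @big_columns n F 1 *%R (fun c => V (tperm i m0 c)) i l r im0 lr; rewrite !tpermL !tpermR => <-.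
congr (lower _ _ (_ * (_ * _))); last first.
  by case: eqVneq => // ?; case: eqVneq => // ?; rewrite tpermD // eq_sym.
apply: eq_bigr => m _; case: eqVneq => [_|mm0]; first by rewrite mulrC.
by case: eqVneq => // mi; rewrite tpermD // eq_sym.
Qed.

(** * The chain maps and the homotopies *)

Definition convolution (K L : {perm 'I_n} -> {perm 'I_n} -> F) x z := \sum_y K y z * L x y.

Definition area_kernel (f : cell n -> F) (x y : {perm 'I_n}) : F :=
  \sum_b \sum_(t | empty_rect x b t && (y == move x b t)) area f (x b) (x t) b t.

Definition entry r s d (x y : {perm 'I_n}) : F := (K x y r s)`_d.

Lemma kernel_lower x y : lower (K x y) (area_kernel v x y) (area_kernel (v \o swapped) x y).
Proof.
have low0 : lower 0 0 0 by split; rewrite mxE coef0.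
have lowD M N x1 y1 x2 y2 : lower M x1 y1 -> lower N x2 y2 -> lower (M + N) (x1 + x2) (y1 + y2).
  by move=> [h1 h2 h3] [h4 h5 h6]; split; rewrite mxE coefD ?h1 ?h2 ?h3 ?h4 ?h5 ?h6 ?addr0.
rewrite /kernel /area_kernel.
elim/big_ind3: _ => // [*|b _]; first exact: lowD.
elim/big_ind3: _ => // [*|t /andP[/andP[bt _] _]]; first exact: lowD.
by apply: lower_weight; rewrite (inj_eq perm_inj).
Qed.

(** The coefficient of degree [d] in the equation saying that the square of the kernel
    is the variable. *)
Lemma entry_square r s d x z :
  \sum_y \sum_(e < d.+1)
    (entry r 0 e y z * entry 0 s (d - e) x y + entry r 1 e y z * entry 1 s (d - e) x y) =
  (if z == x then (r == s)%:R * (d == 1%N)%:R else 0).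
Proof.
have := congr1 (fun M : 'M[A]_2 => (M r s)`_d) (kernel_square_crossing x z).
rewrite summxE coef_sum => e; rewrite (eq_bigr (fun y => ((K y z * K x y) r s)`_d)) => [|y _].
  rewrite e; case: ifP => _; last by rewrite mxE coef0.
  rewrite scale2E [_ r s]mxE; case: eqP => _; last by rewrite mulr0 coef0 mul0r.
  by rewrite mulr1 coefX mul1r.
by rewrite mul2E coefD !coefM -big_split.
Qed.

Lemma entry01_0 x y : entry 0 1 0 x y = 0.
Proof. by have [] := kernel_lower x y. Qed.

Lemma entry00_0 : entry 0 0 0 =2 area_kernel v.
Proof. by move=> x y; have [] := kernel_lower x y. Qed.

Lemma entry11_0 : entry 1 1 0 =2 area_kernel (v \o swapped).
Proof. by move=> x y; have [] := kernel_lower x y. Qed.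

Let addFF (c : F) : c + c = 0. Proof. by rewrite -[c]mulr1 -mulrDr F2 mulr0. Qed.

Lemma phi_chain x z : convolution (entry 1 0 0) (area_kernel v) x z =
  convolution (area_kernel (v \o swapped)) (entry 1 0 0) x z.
Proof.
have := entry_square 1 0 0 x z; rewrite mulr0 if_same.
under eq_bigr do rewrite big_ord1 entry00_0 entry11_0.
rewrite big_split /= => e; rewrite -[LHS]addr0 -[X in _ + X](addFF (convolution (area_kernel (v \o swapped)) (entry 1 0 0) x z)).
by rewrite addrA [X in X + _]e add0r.
Qed.

Lemma psi_chain x z : convolution (entry 0 1 1) (area_kernel (v \o swapped)) x z =
  convolution (area_kernel v) (entry 0 1 1) x z.
Proof.
have := entry_square 0 1 1 x z; rewrite mul0r if_same.
under eq_bigr do rewrite big_ord_recl big_ord1 /= !entry01_0 !mulr0 !mul0r addr0 add0r entry00_0 entry11_0.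
rewrite big_split /= => e; rewrite -[LHS]addr0 -[X in _ + X](addFF (convolution (area_kernel v) (entry 0 1 1) x z)).
by rewrite addrA [X in X + _]addrC [X in X + _]e add0r.
Qed.

Lemma phi_psi x z : convolution (entry 0 1 1) (entry 1 0 0) x z = (z == x)%:R +
  convolution (entry 0 0 1) (area_kernel v) x z + convolution (area_kernel v) (entry 0 0 1) x z.
Proof.
have := entry_square 0 0 1 x z; rewrite !mul1r.
under eq_bigr do rewrite big_ord_recl big_ord1 /= !entry01_0 !mul0r addr0 !entry00_0.
rewrite !big_split /= => e; have -> : (z == x)%:R = convolution (area_kernel v) (entry 0 0 1) x z +
    (convolution (entry 0 0 1) (area_kernel v) x z + convolution (entry 0 1 1) (entry 1 0 0) x z).
  by case: (z == x) e => e; exact: esym e.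
move: (convolution (area_kernel v) _ x z) (convolution _ (area_kernel v) x z) => P Q.
by rewrite [Q + _]addrC addrA -(addrA _ Q Q) addFF addr0 addrAC addFF add0r.
Qed.

Lemma psi_phi x z : convolution (entry 1 0 0) (entry 0 1 1) x z = (z == x)%:R +
  convolution (entry 1 1 1) (area_kernel (v \o swapped)) x z +
  convolution (area_kernel (v \o swapped)) (entry 1 1 1) x z.
Proof.
have := entry_square 1 1 1 x z; rewrite !mul1r.
under eq_bigr do rewrite big_ord_recl big_ord1 /= !entry01_0 !mulr0 add0r !entry11_0.
rewrite !big_split /= => e; have -> : (z == x)%:R = convolution (entry 1 0 0) (entry 0 1 1) x z +
    convolution (area_kernel (v \o swapped)) (entry 1 1 1) x z +
    convolution (entry 1 1 1) (area_kernel (v \o swapped)) x z.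
  by case: (z == x) e => e; exact: esym e.
move: (convolution (area_kernel _) _ x z) (convolution _ (area_kernel _) x z) => P Q.
by rewrite -(addrA _ Q Q) addFF addr0 -addrA addFF addr0.
Qed.

(** * Homogeneity of the chain map *)

Section Homogeneity.
Variables (V : zmodType) (hom : V -> F -> Prop) (kd : cell n -> V) (jump : 'I_n -> V).
Hypotheses (hom0 : forall d, hom d 0) (hom1 : hom 0 1).
Hypothesis homM : forall d e x y, hom d x -> hom e y -> hom (d + e) (x * y).
Hypothesis homD : forall d x y, hom d x -> hom d y -> hom d (x + y).
Hypothesis hom_v : forall c, hom (kd c) (v c).
Hypothesis jumpS : forall k, jump k + kd (i, k) = jump (ordS k) + kd (m0, k).

Let kd_area l r b t := \sum_(c | arc l r c) \sum_(k | arc b t k) kd (c, k).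
Let C0 := jump q + kd (i, q).

Lemma hom_prod (I : finType) (P : pred I) (d : I -> V) (f : I -> F) :
  (forall j, P j -> hom (d j) (f j)) -> hom (\sum_(j | P j) d j) (\prod_(j | P j) f j).
Proof.
by move=> df; elim/big_ind2: _ => // *; exact: homM.
Qed.

Lemma jump_arc b t : jump b + \sum_(k | arc b t k) kd (i, k) =
  jump t + \sum_(k | arc b t k) kd (m0, k).
Proof.
move: b; apply: (@arc_ind _ (fun b => jump b + \sum_(k | arc b t k) kd (i, k) =
  jump t + \sum_(k | arc b t k) kd (m0, k)) t) => [|b bt IH].
  by rewrite !big_pred0 // => k; rewrite arcxx.
by rewrite !(sum_arc_ordS _ bt) addrA jumpS addrAC IH addrAC addrA.
Qed.

(** A side which passes from the first to the second circle does so in the row [q]; by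
    [jumpS] its degree does not depend on the row [b] where it starts. *)
Lemma hom_down b t :
  hom (\sum_(k | arc b t k) kd (i, k) + jump b - C0) ((down crossing b t) 1 0)`_0.
Proof.
move: b; apply: (@arc_ind _ (fun b =>
  hom (\sum_(k | arc b t k) kd (i, k) + jump b - C0) ((down crossing b t) 1 0)`_0) t) => [|b bt IH].
  by rewrite downxx one2E coef0; exact: hom0.
rewrite down_ordS // mul2E coefD !coef0M sum_arc_ordS // !mat2E.
have [low _ _] : lower (down crossing (ordS b) t) (\prod_(k | arc (ordS b) t k) u k)
    (\prod_(k | arc (ordS b) t k) w k).
  apply: lower_down => k; rewrite /crossing; split; rewrite !mat2E ?coefC //.
  by case: ifP; rewrite ?coefX ?coef0.
apply: homD.
  rewrite low; case: eqP => [->|_]; last by rewrite coef0 mul0r.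
  rewrite coefC mul1r /C0 [jump q + _]addrC opprD addrA addrAC addrK addrC addKr.
  by apply: hom_prod => k _; exact: hom_v.
rewrite coefC /= (_ : _ - C0 = kd (m0, b) + (\sum_(k | arc (ordS b) t k) kd (i, k) + jump (ordS b) - C0)).
  by apply: homM.
rewrite !addrA; congr (_ - _).
by rewrite [LHS]addrAC [kd (i, b) + _]addrC jumpS [jump _ + _]addrC [LHS]addrAC.
Qed.

Lemma hom_up b t : hom (\sum_(k | arc b t k) kd (m0, k) + jump t - C0)
  ((up (fun k => adj2 (crossing k)) b t) 1 0)`_0.
Proof.
rewrite [_ + jump t]addrC -jump_arc [jump b + _]addrC.
move: b; apply: (@arc_ind _ (fun b => hom (\sum_(k | arc b t k) kd (i, k) + jump b - C0)
  ((up (fun k => adj2 (crossing k)) b t) 1 0)`_0) t) => [|b bt IH].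
  by rewrite upxx one2E coef0; exact: hom0.
rewrite up_ordS // mul2E coefD !coef0M sum_arc_ordS // !mat2E.
have [_ _ low] : lower (up (fun k => adj2 (crossing k)) (ordS b) t)
    (\prod_(k | arc (ordS b) t k) w k) (\prod_(k | arc (ordS b) t k) u k).
  apply: lower_up => k; rewrite /crossing; split; rewrite !mat2E ?coefC //.
  by case: ifP; rewrite ?coefX ?coef0.
apply: homD; last first.
  rewrite low; case: eqP => [->|_]; last by rewrite coef0 mulr0.
  rewrite coefC mulr1 /C0 [jump q + _]addrC opprD addrA addrAC addrK addrC addKr.
  by apply: hom_prod => k _; exact: hom_v.
rewrite mulrC coefC /= (_ : _ - C0 = kd (m0, b) + (\sum_(k | arc (ordS b) t k) kd (i, k) + jump (ordS b) - C0)).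
  by apply: homM.
rewrite !addrA; congr (_ - _).
by rewrite [LHS]addrAC [kd (i, b) + _]addrC jumpS [jump _ + _]addrC [LHS]addrAC.
Qed.

Lemma hom_block l r b t : hom (\sum_(m | btw l m r)
    (if m == m0 then \sum_(k | arc b t k) kd (i, k) + \sum_(k | arc b t k) kd (m0, k)
     else if m == i then 0 else \sum_(k | arc b t k) kd (m, k)))
  (block crossed l r b t)`_0.
Proof.
rewrite /block /strip -[X in hom _ X]/(coefp 0 _) rmorph_prod; apply: hom_prod => m _.
rewrite rmorph_prod /crossed; case: eqP => _ /=.
  rewrite (eq_bigr (fun k => u k * w k)) => [|k _]; last by rewrite coefC.
  by rewrite -big_split; apply: hom_prod => k _; apply: homM.
case: eqP => _; first by rewrite big1 // => k _; rewrite coefC.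
by apply: hom_prod => k _; rewrite coefC.
Qed.

(** The degree of a pentagon is that of the rectangle with the same rows, corrected by the
    jump at the row of the new point on the circle [m0]. *)
Lemma hom_weight (x : {perm 'I_n}) b t : b != t ->
  hom (kd_area (x b) (x t) b t + jump (((move x b t)^-1)%g m0) - C0)
      ((W (x b) (x t) b t) 1 0)`_0.
Proof.
move=> bt; have lr : x b != x t by rewrite (inj_eq perm_inj).
pose D c := \sum_(k | arc b t k) kd (c, k).
have areaE : kd_area (x b) (x t) b t = _ := sum_columns D im0 lr.
have homD' c : hom (D c) (\prod_(k | arc b t k) v (c, k)) by apply: hom_prod.
have side0 m : m != m0 -> down (transfer true m) b t = 1.
  by move=> mm0; apply: down_one => k; rewrite /transfer (negPf mm0).
have sideP m : m != m0 -> up (transfer false m) b t =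
    (if m == i then 1 else \prod_(k | arc b t k) v (m, k))%:P%:A.
  move=> mm0; rewrite (@up_scalar _ (fun k => if m == i then 1 else (v (m, k))%:P)) => [|k].
    by case: (m == i); rewrite ?big1_eq // rmorph_prod.
  by rewrite /transfer (negPf mm0) /=; case: (m == i); rewrite ?scale1r.
rewrite areaE scale2E coef0M -!addrA; apply: homM; first exact: hom_block.
rewrite /side; case: (eqVneq (x b) m0) => [xb|xb].
  have xt : x t != m0 by rewrite -xb eq_sym.
  rewrite (negPf xt) add0r (side0 _ xt) mulr1 xb /D.
  have -> : ((move x b t)^-1)%g m0 = t by rewrite -xb -(moveR x b t) permK.
  have -> : up (transfer false m0) b t = up (fun k => adj2 (crossing k)) b t.
    by apply: eq_iter_up => k; rewrite /transfer eqxx.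
  rewrite addrA; exact: hom_up.
rewrite sideP // -scalerAl mul1r scale2E coef0M coefC /=.
have hl : hom (if x b == i then 0 else D (x b)) (if x b == i then 1 else \prod_(k | arc b t k) v (x b, k)).
  by case: ifP.
apply: homM => //; case: (eqVneq (x t) m0) => [xt|xt]; last by rewrite side0 // one2E coef0.
have -> : ((move x b t)^-1)%g m0 = b by rewrite -xt -(moveL x b t) permK.
have -> : down (transfer true (x t)) b t = down crossing b t.
  by apply: eq_iter_down => k; rewrite /transfer xt eqxx.
rewrite addrA; exact: hom_down.
Qed.

End Homogeneity.

(** * Gradings *)

Definition area_degree (V : zmodType) (kd : cell n -> V) l r b t :=
  \sum_(c | arc l r c) \sum_(k | arc b t k) kd (c, k).

Lemma arc_thin (l c : 'I_n) : l != ordS l -> arc l (ordS l) c = (c == l).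
Proof. by move=> lS; rewrite arcE lS btw_ordS orbF. Qed.

Lemma area_degree_thin (V : zmodType) (kd : cell n -> V) b t :
  area_degree kd i m0 b t = \sum_(k | arc b t k) kd (i, k).
Proof. by rewrite /area_degree (big_pred1 i) // => c; exact: arc_thin. Qed.

Section Gradings.
Variables (V : zmodType) (kd : cell n -> V).
Variables (G G' : {perm 'I_n} -> V) (e : {perm 'I_n} -> 'I_n -> 'I_n -> V) (c0 : V).
Hypothesis grad : forall (x : {perm 'I_n}) b t, b != t ->
  area_degree kd (x b) (x t) b t = G (move x b t) - G x + e x b t.
Hypothesis grad' : forall (x : {perm 'I_n}) b t, b != t ->
  area_degree (kd \o swapped) (x b) (x t) b t = G' (move x b t) - G' x + e x b t.
Hypothesis e0 : forall (x : {perm 'I_n}) b t, empty_rect x b t -> e x b t = c0.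

Let gap (x : {perm 'I_n}) := G' x - G x.

Lemma gap_move (x : {perm 'I_n}) b t : b != t -> gap (move x b t) + area_degree kd (x b) (x t) b t =
  gap x + area_degree (kd \o swapped) (x b) (x t) b t.
Proof.
move=> bt; rewrite grad // grad' // !addrA; congr (_ + _); rewrite /gap subrK.
by rewrite [RHS]addrAC [G' x - _]addrC addrK addrC.
Qed.

Lemma area_degree_swapped l r b t : l != m0 -> r != m0 ->
  area_degree (kd \o swapped) l r b t = area_degree kd l r b t.
Proof.
move=> lm0 rm0; rewrite /area_degree (reindex_inj (@perm_inj _ (tperm i m0))) /=.
have arcS : arc l r m0 = arc l r i.
  rewrite !arcE [m0 == l]eq_sym (negPf lm0) /= [i == l]eq_sym; case: eqVneq => //= lr.
  case: (eqVneq l i) lr => [->|li] lr; last by rewrite btw_ordS_mid.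
  by rewrite btw_ordS_l // eq_sym.
apply: eq_big => [c|c _]; last by apply: eq_bigr => k _; rewrite /swapped /= tpermK.
by case: tpermP => [->|->|].
Qed.

(** A rectangle without a side on the circle [m0] has the same squares in both grids, and
    such rectangles connect the states with the same point on [m0]. *)
Lemma gap_const (x z : {perm 'I_n}) : (x^-1 m0)%g = (z^-1 m0)%g -> gap x = gap z.
Proof.
(* [x] is brought to [z] by putting one more point at its place at a time. *)
have [d] := ubnP #|[set j | x j != z j]%SET|; elim: d x => // d IH x dP xz.
have [/eqP|/finset.set0Pn[j]] := boolP ([set j | x j != z j]%SET == finset.set0).
  move=> h; congr gap; apply/permP => j; apply/eqP; have := finset.in_set0 j.
  by rewrite -h inE; case: eqP.
rewrite inE => xj; pose t := (x^-1)%g (z j).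
have xt : x t = z j by rewrite permKV.
have jt : j != t by apply: contraNneq xj => jt; rewrite {1}jt xt.
have zm (k : 'I_n) : x k = m0 -> z k = m0.
  by move=> xk; have := congr1 z xz; rewrite permKV -xk permK.
have xjm : x j != m0 by apply: contraNneq xj => h; rewrite (zm _ h) h.
have xtm : x t != m0.
  apply: contraNneq jt => h; apply/eqP/(@perm_inj _ z); rewrite (zm _ h) -h; exact: esym.
have gE : gap (move x j t) = gap x.
  by have := gap_move x jt; rewrite area_degree_swapped // => /addIr.
rewrite -gE; apply: IH.
  rewrite ltnS in dP; apply: leq_trans dP; apply: proper_card; apply/properP; split.
    apply/fintype.subsetP => k; rewrite !inE moveE; case: (eqVneq k j) => [->|kj]; first by rewrite xt eqxx.
    case: (eqVneq k t) => [->|kt] // _; rewrite xt (inj_eq perm_inj) //.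
  by exists j; rewrite inE // moveL xt eqxx.
rewrite -xz; apply: (canLR (permK _)).
by rewrite moveD ?permKV //; [apply: contraNneq xjm|apply: contraNneq xtm] => <-; rewrite permKV.
Qed.

(** The difference of the two gradings of a state whose point on the circle between
    the commuted columns is in the row [k]. *)
Definition jump k := gap (tperm k m0).

Lemma jumpE (x : {perm 'I_n}) : jump ((x^-1)%g m0) = gap x.
Proof.
by apply: gap_const; apply: (canLR (permK _)); rewrite tpermL.
Qed.

(** Compare, in the two grids, the rectangle of height and width one with the corner
    [(i, k)]: in the second grid it contains the square of the column [m0]. *)
Lemma jumpS k : jump k + kd (i, k) = jump (ordS k) + kd (m0, k).
Proof.
have kS : k != ordS k.
  apply: contraNneq im0 => e1; have kk j : j = k.
    by apply/eqP; have := ordS_period2 j (etrans (congr1 (@ordS n) (esym e1)) (esym e1)); rewrite -e1 orbb.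
  by rewrite [i]kk [m0]kk.
pose s := tperm k i (ordS k); pose x : {perm 'I_n} := (tperm k i * tperm s m0)%g.
have si : s != i by rewrite /s -{2}(tpermL k i) (inj_eq perm_inj) eq_sym.
have xk : x k = i by rewrite permM tpermL tpermD // eq_sym.
have xS : x (ordS k) = m0 by rewrite permM -/s tpermL.
have := gap_move x kS; rewrite xk xS !area_degree_thin !(big_pred1 k); last first.
- by move=> c; exact: arc_thin.
- by move=> c; exact: arc_thin.
rewrite /= /swapped /= tpermL -!jumpE.
have -> : ((move x k (ordS k))^-1)%g m0 = k by apply: (canLR (permK _)); rewrite moveL.
by have -> : (x^-1)%g m0 = ordS k by rewrite -xS permK.
Qed.

(** The pentagons turn in the row [q], where the matrix has the entry 1 in the place of
    the weight of the square [(i, q)]. *)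
Definition shift := jump q + kd (i, q) - c0.

Section HomogeneousEntries.
Variable hom : V -> F -> Prop.
Hypotheses (hom0 : forall d, hom d 0) (hom1 : hom 0 1).
Hypothesis homM : forall d d' x y, hom d x -> hom d' y -> hom (d + d') (x * y).
Hypothesis homD : forall d x y, hom d x -> hom d y -> hom d (x + y).
Hypothesis hom_v : forall c, hom (kd c) (v c).

Lemma hom_entry x y : hom (G' y - G x - shift) (entry 1 0 0 x y).
Proof.
rewrite /entry /kernel summxE coef_sum; elim/big_ind: _ => // [*|b _]; first exact: homD.
rewrite summxE coef_sum; elim/big_ind: _ => // [*|t /andP[emp /eqP ->]]; first exact: homD.
have /andP[bt _] := emp.
have := hom_weight hom0 hom1 homM homD hom_v jumpS x bt.
rewrite -/(area_degree _ _ _ _ _) grad // e0 // jumpE /shift; move: (jump q + _) => Z.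
suff -> : G (move x b t) - G x + c0 + gap (move x b t) - Z = G' (move x b t) - G x - (Z - c0) by [].
rewrite opprB !addrA; congr (_ - _); rewrite addrAC -(addrA (G _)).
by rewrite [G _ + _]addrC addrK addrC addrA.
Qed.

End HomogeneousEntries.
End Gradings.

(** For the Maslov grading [kd] counts each O twice. The state of the O's of the second
    grid is reached from that of the first one by a rectangle of width one, which is
    empty; this determines the jump, hence the shift, once the gradings agree on these two
    states. *)
Lemma shift_O (V : zmodType) (d : V) (o : {perm 'I_n}) (G G' : {perm 'I_n} -> V)
    (e : {perm 'I_n} -> 'I_n -> 'I_n -> V) (kd := fun c : cell n => if o c.2 == c.1 then d + d else 0) :
  (forall (x : {perm 'I_n}) b t, b != t ->
    area_degree kd (x b) (x t) b t = G (move x b t) - G x + e x b t) ->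
  (forall (x : {perm 'I_n}) b t, b != t ->
    area_degree (kd \o swapped) (x b) (x t) b t = G' (move x b t) - G' x + e x b t) ->
  (forall (x : {perm 'I_n}) b t, empty_rect x b t -> e x b t = d) ->
  (forall k, o k = i -> ~~ btw q k a) -> (forall k, o k = m0 -> ~~ btw a k q) ->
  G' (o * tperm i m0)%g = G o -> shift kd G G' d = 0.
Proof.
move=> grad grad' e0 oi om0 norm.
pose h1 := (o^-1)%g i; pose h2 := (o^-1)%g m0.
have h12 : h1 != h2 by rewrite (inj_eq perm_inj).
have o1 : o h1 = i by rewrite permKV.
have o2 : o h2 = m0 by rewrite permKV.
have oE : move o h1 h2 = (o * tperm i m0)%g.
  apply/permP => k; rewrite moveE permM; case: (eqVneq k h1) => [->|k1]; first by rewrite o1 o2 tpermL.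
  case: (eqVneq k h2) => [->|k2]; first by rewrite o1 o2 tpermR.
  by rewrite tpermD // eq_sym -?o1 -?o2 (inj_eq perm_inj).
have kdi k : kd (i, k) = if k == h1 then d + d else 0.
  by rewrite /kd /= -o1 (inj_eq perm_inj).
have kdm0 k : kd (m0, k) = if k == h2 then d + d else 0.
  by rewrite /kd /= -o2 (inj_eq perm_inj).
have sumE h b t : \sum_(k | arc b t k) (if k == h then d + d else 0) = if arc b t h then d + d else 0.
  case: ifP => h'; last by rewrite big1 // => k kt; case: eqVneq kt => // ->; rewrite h'.
  by rewrite (bigD1 h) //= eqxx big1 ?addr0 // => k /andP[_ /negPf ->].
have emp : empty_rect o h1 h2.
  by rewrite /empty_rect h12; apply/forallP => k; rewrite /hits o1 o2 btw_ordS.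
have jh2 : jump G G' h2 = d.
  have := grad' o h1 h2 h12; rewrite o1 o2 area_degree_thin oE norm e0 //.
  under eq_bigr do rewrite /= /swapped /= tpermL kdm0.
  rewrite sumE (arcE h1) btwxr [h2 == _]eq_sym (negPf h12) /= => /esym/eqP.
  by rewrite /h2 (jumpE grad grad') addrC addr_eq0 opprB => /eqP <-.
have jq : jump G G' q + kd (i, q) = d.
  have := jump_arc (jumpS grad grad') q h2; rewrite jh2.
  under eq_bigr do rewrite kdi; under [in RHS]eq_bigr do rewrite kdm0.
  rewrite !sumE.
  have -> : arc q h2 h1 = (q == h1).
    move: (oi _ o1) (om0 _ o2) h12 aq; rewrite !arcE !btwE -!val_eqE /=; lia.
  have -> : arc q h2 h2 = false by rewrite arcE btwxr orbF eq_sym andNb.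
  by rewrite kdi => ->; rewrite addr0.
by rewrite /shift jq subrr.
Qed.

End Commute.

(** * The grid complex as an operator with a kernel *)

Section Operators.
Variable n : nat.
Implicit Types (K L : state n -> state n -> Uring n) (c d : Cminus n).

Definition operator K c : Cminus n := [ffun y => \sum_x c x * K x y].

Lemma operator_comp K L c : operator K (operator L c) = operator (convolution K L) c.
Proof.
apply/ffunP => z; rewrite !ffunE.
under eq_bigr do rewrite ffunE mulr_suml; rewrite exchange_big; apply: eq_bigr => x _.
by rewrite mulr_sumr; apply: eq_bigr => y _; rewrite -mulrA [L _ _ * _]mulrC.
Qed.

Lemma eq_operator K L c : K =2 L -> operator K c = operator L c.
Proof.
by move=> KL; apply/ffunP => z; rewrite !ffunE; apply: eq_bigr => x _; rewrite KL.
Qed.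

Lemma operator_add K L c :
  operator (fun x y => K x y + L x y) c = operator K c + operator L c.
Proof.
by apply/ffunP => z; rewrite !ffunE -big_split; apply: eq_bigr => x _; rewrite mulrDr.
Qed.

Lemma operator_id c : operator (fun x y => (y == x)%:R) c = c.
Proof.
apply/ffunP => z; rewrite ffunE (bigD1 z) //= eqxx mulr1 big1 ?addr0 // => x xz.
by rewrite eq_sym (negPf xz) mulr0.
Qed.

Lemma operator_linear K p c d : operator K (Uscale p c + d) = Uscale p (operator K c) + operator K d.
Proof.
apply/ffunP => z; rewrite !ffunE mulr_sumr -big_split; apply: eq_bigr => x _.
by rewrite !ffunE mulrDl mulrA.
Qed.

Lemma operatorB K c d : operator K (c - d) = operator K c - operator K d.
Proof.
apply/ffunP => z; rewrite !ffunE -sumrB; apply: eq_bigr => x _.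
by rewrite !ffunE mulrBl.
Qed.

End Operators.

Section GridKernel.
Variables (n : nat) (g : grid n).

(** The product of these weights over the squares of a rectangle is its monomial, or zero
    if the rectangle contains an X. *)
Definition mark_weight (c : cell n) : Uring n :=
  if c \in gX g then 0 else \prod_(k | gO g k == c) Uvar k.

Lemma sum_Rect0 (V : nmodType) (f : rectangle n -> V) (x y : state n) :
  \sum_(r in Rect0 x y) f r =
  \sum_b \sum_(t | empty_rect x b t && (y == move x b t)) f (x b, x t, (b, t)).
Proof.
rewrite pair_big_dep /=.
rewrite (reindex_onto (fun p : 'I_n * 'I_n => (x p.1, x p.2, p)) (fun r => r.2)) /=; last first.
  move=> [[l r] [b t]]; rewrite !inE /= => /andP[/and5P[_ _ /eqP /= xl /eqP /= xr _] _].
  by rewrite /rbot /rtop /= in xl xr; rewrite xl xr.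
apply: eq_big => [[b t]|[b t] _] //=; rewrite eqxx andbT !inE /rleft /rright /rbot /rtop /= !eqxx /=.
rewrite (inj_eq perm_inj) /empty_rect -!andbA; case: (eqVneq b t) => //= bt.
rewrite [RHS]andbC !andbA; congr (_ && _); rewrite -andbA; apply/idP/eqP => [/and3P[/eqP yb /eqP yt /forallP h]|->].
  apply/permP => j; have := h j; rewrite moveE.
  case: (eqVneq j b) => [->|jb] //=; case: (eqVneq j t) => [->|jt] //= /eqP //.
rewrite moveL moveR !eqxx /=; apply/forallP => j; apply/implyP => /andP[jb jt].
by rewrite moveD.
Qed.

Lemma area_mark_weight l r b t : l != r -> b != t ->
  area mark_weight l r b t =
  if [forall p in gX g, ~~ in_rect (l, r, (b, t)) p]
  then \prod_(k < n) Uvar k ^+ in_rect (l, r, (b, t)) (gO g k) else 0.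
Proof.
move=> lr bt; rewrite /area pair_big_dep /=.
have inr (p : cell n) : in_rect (l, r, (b, t)) p = arc l r p.1 && arc b t p.2 by [].
case: ifP => [/forall_inP noX|/negbT]; last first.
  rewrite negb_forall => /existsP[p]; rewrite negb_imply negbK inr => /andP[pX pr].
  by rewrite (bigD1 p) //= /mark_weight -surjective_pairing pX mul0r.
transitivity (\prod_(p : cell n | in_rect (l, r, (b, t)) p) \prod_(k | gO g k == p) Uvar k).
  apply: eq_big => [p|[c k] pr]; first by rewrite inr.
  rewrite /mark_weight /=; case: ifP => // /noX; rewrite inr /=.
  by case/andP: pr => /= -> ->.
rewrite (exchange_big_dep predT) //=; apply: eq_bigr => k _.
case: (boolP (in_rect _ _)) => h.
  by rewrite (big_pred1 (gO g k)) ?expr1 // => p; rewrite /= [gO g k == p]eq_sym; case: eqVneq => [->|_]; rewrite ?h ?andbF.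
by rewrite big_pred0 ?expr0 // => p; apply: contraNF h => /andP[h /eqP ->].
Qed.

Lemma differentialE : differential g =1 operator (area_kernel mark_weight).
Proof.
move=> c; apply/ffunP => y; rewrite !ffunE; apply: eq_bigr => x _; congr (_ * _).
rewrite big_mkcondr /= sum_Rect0; apply: eq_bigr => b _; apply: eq_bigr => t /andP[/andP[bt _] _].
by rewrite area_mark_weight // (inj_eq perm_inj).
Qed.

End GridKernel.

(** * Graded operators *)

Section Degrees.
Variables (n : nat) (V : zmodType) (dU : 'I_n -> V).

Definition degree (m : multinom n) : V := \sum_(k < n) dU k *+ m k.

Definition pure (d : V) (p : Uring n) : Prop := forall m, m \in msupp p -> degree m = d.

Lemma degreeD m m' : degree (mnm_add m m') = degree m + degree m'.
Proof. by rewrite /degree -big_split; apply: eq_bigr => k _; rewrite mnmDE mulrnDr. Qed.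

Lemma pure0 d : pure d 0.
Proof. by move=> m; rewrite msupp0. Qed.

Lemma pure1 : pure 0 1.
Proof.
by move=> m; rewrite msupp1 inE => /eqP ->; rewrite /degree big1 // => k _; rewrite mnm0E.
Qed.

Lemma pureM d d' p p' : pure d p -> pure d' p' -> pure (d + d') (p * p').
Proof.
move=> dp dp' m /msuppM_le /allpairsP[[m1 m2] /= [h1 h2 ->]].
by rewrite degreeD (dp _ h1) (dp' _ h2).
Qed.

Lemma pureD d p p' : pure d p -> pure d p' -> pure d (p + p').
Proof. by move=> dp dp' m /msuppD_le; rewrite mem_cat => /orP[/dp|/dp']. Qed.

Lemma pureU k : pure (dU k) (Uvar k).
Proof.
move=> m; rewrite msuppX inE => /eqP ->; rewrite /degree (bigD1 k) //= mnm1E eqxx.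
by rewrite big1 ?addr0 // => j jk; rewrite mnm1E eq_sym (negPf jk).
Qed.

Lemma pure_mark_weight (g : grid n) (kd : cell n -> V) :
  (forall c, c \notin gX g -> kd c = \sum_(k | gO g k == c) dU k) ->
  forall c, pure (kd c) (mark_weight g c).
Proof.
move=> kdE c; rewrite /mark_weight; case: ifP => [_|/negbT /kdE ->]; first exact: pure0.
apply: (@hom_prod _ _ pure pure1 pureM) => k _; exact: pureU.
Qed.

(** [f] maps a chain of degree [d] to one of degree [d + s], where the degree of the
    monomial U^m x is [G x - degree m]. *)
Definition graded_map (G G' : state n -> V) (f : Cminus n -> Cminus n) (s : V) : Prop :=
  forall (c : Cminus n) d, (forall x m, m \in msupp (c x) -> G x - degree m = d) ->
    forall x m, m \in msupp (f c x) -> G' x - degree m = d + s.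

Lemma operator_graded (G G' : state n -> V) K s :
  (forall x y, pure (G' y - G x - s) (K x y)) -> graded_map G G' (operator K) s.
Proof.
move=> pK c d cd y m; rewrite ffunE.
suff h : pure (G' y - d - s) (\sum_x c x * K x y).
  by move=> /h ->; rewrite !opprB addrC -!addrA addNr addr0 addrC.
elim/big_ind: _ => [|p p'|x _]; [exact: pure0|exact: pureD|].
have -> : G' y - d - s = (G x - d) + (G' y - G x - s).
  by rewrite addrA [X in _ = X - s]addrC addrA subrK.
by apply: pureM => [m' h|]; [rewrite -(cd _ _ h) opprB addrCA subrr addr0|exact: pK].
Qed.

End Degrees.

(** * Commuting two columns *)

Lemma addUU n (p : Uring n) : p + p = 0.
Proof.
have c2 : (1 + 1 : 'F_2) = 0 by apply/val_inj.
have e : 1 + 1 = 0 :> Uring n by rewrite -mpolyC1 -mpolyCD c2 mpolyC0.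
by rewrite -[p]mul1r -mulrDl e mul0r.
Qed.

Section ColumnCommutation.
Variables (n : nat) (g g' : grid n) (i a q : 'I_n).
Hypotheses (iS : i != ordS i) (aq : a != q) (sat : saturated g).
Hypothesis left_marks : forall k, btw q k a -> (i, k) \notin marks g.
Hypothesis right_marks : forall k, btw a k q -> (ordS i, k) \notin marks g.
Hypothesis gX' : gX g' = [set swapped i c | c in gX g]%SET.
Hypothesis gO' : gO g' =1 swapped i \o gO g.

Let U2 : 1 + 1 = 0 :> Uring n := addUU 1.

Lemma swappedK : involutive (@swapped n i).
Proof. by case=> c k; rewrite /swapped /= tpermK. Qed.

Lemma mark_weight_swapped : mark_weight g' =1 mark_weight g \o swapped i.
Proof.
move=> c; rewrite /comp /mark_weight gX' -{1}[c]swappedK mem_imset; last exact: inv_inj swappedK.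
by case: ifP => // _; apply: eq_bigl => k; rewrite gO' /= -{1}[c]swappedK (inv_eq swappedK) swappedK.
Qed.

Let unmarked c : c \notin marks g -> mark_weight g c = 1.
Proof.
rewrite inE negb_or /mark_weight => /andP[/negPf -> cO]; rewrite big1 // => k /eqP kc.
by move: cO; rewrite -kc imset_f.
Qed.

Let u1 k : btw q k a -> mark_weight g (i, k) = 1.
Proof. by move=> h; exact/unmarked/left_marks. Qed.
Let w1 k : btw a k q -> mark_weight g (ordS i, k) = 1.
Proof. by move=> h; exact/unmarked/right_marks. Qed.

Let rows0 k : \prod_c mark_weight g (c, k) = 0.
Proof.
have [_ /(_ k)[[c k'] cX /= kE]] := sat; subst k'.
by rewrite (bigD1 c) //= /mark_weight cX mul0r.
Qed.

Let cols0 c : \prod_k mark_weight g (c, k) = 0.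
Proof.
have [/(_ c)[[c' k] cX /= kE] _] := sat; subst c'.
by rewrite (bigD1 k) //= /mark_weight cX mul0r.
Qed.

Local Notation ent := (entry (mark_weight g) i a q).

Definition column_map : Cminus n -> Cminus n := operator (ent 1 0 0).

Let diff' : differential g' =1 operator (area_kernel (mark_weight g \o swapped i)).
Proof.
move=> c; rewrite differentialE; apply: eq_operator => x y; rewrite /area_kernel.
apply: eq_bigr => b _; apply: eq_bigr => t _; rewrite /area.
by apply: eq_bigr => l _; apply: eq_bigr => k _; rewrite mark_weight_swapped.
Qed.

Lemma column_map_chain : chain_map g g' column_map.
Proof.
move=> c; rewrite /column_map diff' differentialE !operator_comp.
by apply: eq_operator => x z; exact: phi_chain.
Qed.

Lemma column_map_quasi_isomorphism : quasi_isomorphism g g' column_map.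
Proof.
pose Psi := operator (ent 0 1 1); pose H := operator (ent 0 0 1); pose H' := operator (ent 1 1 1).
have psi_ch c : Psi (differential g' c) = differential g (Psi c).
  rewrite /Psi diff' differentialE !operator_comp.
  by apply: eq_operator => x z; exact: psi_chain.
have psi_phiE c : Psi (column_map c) = c + H (differential g c) + differential g (H c).
  rewrite /Psi /column_map /H !differentialE !operator_comp -[X in X + _ + _]operator_id -!operator_add.
  by apply: eq_operator => x z; exact: phi_psi.
have phi_psiE c : column_map (Psi c) = c + H' (differential g' c) + differential g' (H' c).
  rewrite /Psi /column_map /H' !diff' !operator_comp -[X in X + _ + _]operator_id -!operator_add.
  by apply: eq_operator => x z; exact: psi_phi.
have op0 K : operator K 0 = 0 :> Cminus n by rewrite -[X in operator K X](subrr 0) operatorB subrr.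
split; first exact: column_map_chain.
split=> [c dc [b db]|c' dc'].
  exists (Psi b - H c); rewrite differentialE operatorB -!differentialE -psi_ch db psi_phiE dc.
  by rewrite /H op0 addr0 addrK.
exists (Psi c'); first by rewrite -psi_ch dc' /Psi op0.
exists (- H' c'); rewrite phi_psiE dc' /H' op0 addr0 opprD addrA subrr add0r.
by rewrite -[X in differential g' X]add0r diff' operatorB op0 add0r -diff'.
Qed.

End ColumnCommutation.

(** * Quadrant counts *)

Lemma sum_cells (V : nmodType) n (f : cell n -> V) :
  \sum_c f c = \sum_l \sum_k f (l, k).
Proof. by rewrite pair_bigA; apply: eq_bigr => -[]. Qed.

Section Quadrants.
Variable n : nat.
Implicit Types (x y z o : {perm 'I_n}) (c : cell n).

Definition lower_left x c : nat := \sum_(j < n) ((x j <= c.1) && (j <= c.2))%N.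
Definition upper_right x c : nat := \sum_(j < n) ((c.1 < x j) && (c.2 < j))%N.

Lemma card_below (m : 'I_n) : (\sum_(j < n) (j <= m) = m.+1)%N.
Proof.
transitivity (\sum_(j < n | (j < m.+1)%N) 1)%N.
  by rewrite [RHS]big_mkcond; apply: eq_bigr => j _; rewrite ltnS; case: (_ <= _)%N.
by rewrite -(big_ord_widen n (fun=> 1%N)) // sum1_card card_ord.
Qed.

(** As a permutation has one point in each row and column, the counts of points in two
    opposite quadrants differ by a function of the column plus a function of the row. *)
Lemma quadrants_balance x c :
  (lower_left x c)%:Z - (upper_right x c)%:Z = (c.1.+1)%:Z + ((c.2.+1)%:Z - n%:Z).
Proof.
have xE : (\sum_(j < n) (x j <= c.1) = c.1.+1)%N.
  by rewrite -(card_below c.1) [RHS](reindex_inj (@perm_inj _ x)).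
have nE : n%:Z = \sum_(j < n) 1 by rewrite sumr_const card_ord -mulr_natr mul1r natz.
rewrite nE -xE -(card_below c.2) /lower_left /upper_right.
rewrite !(big_morph _ PoszD (erefl 0%:Z)) -!sumrB -big_split; apply: eq_bigr => j _ /=.
by case: (leqP (x j) c.1) => _; case: (leqP j c.2).
Qed.

Section ZeroSums.
Variables (V : zmodType) (kd : cell n -> V).
Hypothesis rows0 : forall k, \sum_(l < n) kd (l, k) = 0.
Hypothesis cols0 : forall l, \sum_k kd (l, k) = 0.

(** If [kd] has zero sums over rows and columns, its sum over a rectangle of the torus is
    a combination of sums over quadrants at the four corners, wherever the torus is cut;
    hence it is the change of a function of states. *)
Definition potential x : V := \sum_c kd c *+ lower_left x c.

Lemma sum_arc (f : 'I_n -> V) b t : \sum_k f k = 0 ->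
  \sum_(k | arc b t k) f k = \sum_(k < n | (b <= k)%N) f k - \sum_(k < n | (t <= k)%N) f k.
Proof.
move=> f0; case: (leqP b t) => bt.
  rewrite [X in _ = X - _](bigID (fun k : 'I_n => (t <= k)%N)) /=.
  rewrite [X in _ = X + _ - _](eq_bigl (fun k : 'I_n => (t <= k)%N)); last by move=> k /=; lia.
  rewrite addrAC subrr add0r; apply: eq_bigl => k.
  by rewrite arcE btwE -!val_eqE /=; lia.
have -> : - \sum_(k < n | (t <= k)%N) f k = \sum_(k < n | ~~ (t <= k)%N) f k.
  move: f0; rewrite (bigID (fun k : 'I_n => (t <= k)%N)) /= => /eqP.
  by rewrite addr_eq0 => /eqP ->; rewrite opprK.
rewrite (bigID (fun k : 'I_n => (b <= k)%N)) /=; congr (_ + _); apply: eq_bigl => k.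
  by rewrite arcE btwE -!val_eqE /=; lia.
by rewrite arcE btwE -!val_eqE /=; lia.
Qed.

Let corner l k := \sum_(c < n | (l <= c)%N) \sum_(k' < n | (k <= k')%N) kd (c, k').

Lemma area_corners l r b t :
  area_degree kd l r b t = corner l b - corner l t - (corner r b - corner r t).
Proof.
have tail0 (m : 'I_n) : \sum_l \sum_(k < n | (m <= k)%N) kd (l, k) = 0.
  by rewrite exchange_big big1.
rewrite /area_degree; under eq_bigr do rewrite sum_arc //.
by rewrite sum_arc ?sumrB // !tail0 subrr.
Qed.

Lemma potential_corners x : potential x = \sum_j corner (x j) j.
Proof.
rewrite /potential /lower_left; under eq_bigr do rewrite -sumrMnr.
rewrite exchange_big; apply: eq_bigr => j _.
rewrite /corner pair_big_dep /= [RHS]big_mkcond /=; apply: eq_bigr => -[l k] _ /=.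
by case: (_ && _).
Qed.

Lemma potential_move x b t : b != t ->
  area_degree kd (x b) (x t) b t = potential x - potential (move x b t).
Proof.
move=> bt; rewrite area_corners !potential_corners -[RHS]sumrB [RHS](bigD1 b) //=.
rewrite [X in _ = _ + X](bigD1 t) 1?eq_sym //= [X in _ = _ + (_ + X)]big1; last first.
  by move=> j /andP[jb jt]; rewrite moveD // subrr.
rewrite addr0 moveL moveR opprB; move: (corner _ b) (corner _ t) (corner _ b) (corner _ t) => p s u v.
by rewrite [LHS]addrACA [RHS]addrACA; congr (_ + _); exact: addrC.
Qed.

(** The doubled Alexander grading counts both quadrants, which give the same by
    [quadrants_balance]. *)
Lemma potential_upper_right x : potential x = \sum_c kd c *+ upper_right x c.
Proof.
apply/eqP; rewrite -subr_eq0 -sumrB; apply/eqP.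
have e c : kd c *+ lower_left x c - kd c *+ upper_right x c =
    kd c *~ (c.1.+1)%:Z + kd c *~ ((c.2.+1)%:Z - n%:Z).
  by rewrite -mulrzDr -(quadrants_balance x) mulrzBr.
under eq_bigr do rewrite e; rewrite big_split /=.
rewrite !sum_cells /= big1 => [|l _]; last by rewrite -mulrz_suml cols0 mul0rz.
rewrite add0r exchange_big /=.
by rewrite big1 // => k _; rewrite -mulrz_suml rows0 mul0rz.
Qed.

End ZeroSums.

(** The O's are at half-integral points: seen from the lower left corners of their squares,
    lying to the lower left of an O is a weak inequality, and to the upper right a
    strict one. *)
Definition weak_pairs z x : nat := \sum_(j < n) \sum_(k < n) ((x j <= z k) && (j <= k))%N.
Definition strict_pairs x z : nat := \sum_(j < n) \sum_(k < n) ((z k < x j) && (k < j))%N.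

Definition at_state (V : nmodType) (d : V) z c : V := if z c.2 == c.1 then d else 0.

End Quadrants.

Section StatePairs.
Variable n : nat.
Implicit Types (x y z o : {perm 'I_n}).

Lemma potential_at_state z x : potential (at_state (1 : rat) z) x = (weak_pairs z x)%:R.
Proof.
rewrite /potential (_ : \sum_c _ = \sum_(k < n) (lower_left x (z k, k))%:R); last first.
  rewrite sum_cells exchange_big.
  apply: eq_bigr => k _; rewrite (bigD1 (z k)) //= /at_state /= eqxx big1 ?addr0 // => l lz.
  by rewrite eq_sym (negPf lz) mul0rn.
by rewrite -natr_sum /lower_left exchange_big.
Qed.

Lemma upper_at_state z x :
  \sum_c at_state (1 : rat) z c *+ upper_right x c = (strict_pairs x z)%:R.
Proof.
rewrite (_ : \sum_c _ = \sum_(k < n) (upper_right x (z k, k))%:R); last first.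
  rewrite sum_cells exchange_big.
  apply: eq_bigr => k _; rewrite (bigD1 (z k)) //= /at_state /= eqxx big1 ?addr0 // => l lz.
  by rewrite eq_sym (negPf lz) mul0rn.
by rewrite -natr_sum /upper_right exchange_big.
Qed.

Lemma at_state_row (V : nmodType) (d : V) z k : \sum_(l < n) at_state d z (l, k) = d.
Proof.
rewrite (bigD1 (z k)) //= /at_state /= eqxx big1 ?addr0 // => l lz.
by rewrite eq_sym (negPf lz).
Qed.

Lemma at_state_column (V : nmodType) (d : V) z l : \sum_k at_state d z (l, k) = d.
Proof.
rewrite (bigD1 ((z^-1)%g l)) //= /at_state /= permKV eqxx big1 ?addr0 // => k kz.
by case: (z k =P l) kz => // <-; rewrite permK eqxx.
Qed.

(** A pair exchanged by the transposition is counted twice in all, a fixed point once. *)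
Lemma sum_involution x b t :
  (\sum_(j < n) ((x j <= x (tperm b t j)) + (j < tperm b t j)) = n)%N.
Proof.
pose s := tperm b t; apply/eqP; rewrite -(eqn_pmul2l (isT : 0 < 2)%N) mul2n -addnn.
rewrite {1}(reindex_inj (@perm_inj _ s)) /= -/s -big_split /=.
rewrite (eq_bigr (fun=> 2)%N) => [|j _]; first by rewrite sum_nat_const card_ord mulnC.
rewrite tpermK -/s; case: (eqVneq j (s j)) => [<-|js]; first by rewrite leqnn ltnn.
have xjs : x j != x (s j) by rewrite (inj_eq perm_inj).
by move: js xjs; rewrite -!val_eqE /= !neq_ltn; case: ltngtP => // _ _; case: ltngtP.
Qed.

(** The weak pairs which are not strict are those in the same row or column. *)
Lemma weak_pairs_move x b t :
  weak_pairs (move x b t) x = (strict_pairs (move x b t) x + n)%N.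
Proof.
rewrite -[X in (_ + X)%N](sum_involution x b t) /strict_pairs exchange_big -big_split /=.
apply: eq_bigr => j _; pose s := tperm b t.
have -> : ((j < s j) = \sum_(k < n) ((j < k) && (x j == move x b t k)) :> nat)%N.
  rewrite (bigD1 (s j)) //= permM tpermK eqxx andbT big1 ?addn0 // => k ks.
  rewrite permM (inj_eq perm_inj); case: eqP => [jk|]; last by rewrite andbF.
  by move: ks; rewrite jk /s tpermK eqxx.
have -> : (x j <= x (s j) = \sum_(k < n) ((j == k) && (x j <= move x b t k)) :> nat)%N.
  rewrite (bigD1 j) //= eqxx permM big1 ?addn0 // => k kj.
  by rewrite eq_sym (negPf kj).
rewrite -!big_split /=; apply: eq_bigr => k _; rewrite -!val_eqE /= andbC.
by case: (ltngtP j k) => _ /=; case: (ltngtP (x j) (move x b t k)).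
Qed.

Lemma weak_pairsxx x : weak_pairs x x = (strict_pairs x x + n)%N.
Proof.
case: (posnP n) => [n0|n0]; last first.
  have := weak_pairs_move x (Ordinal n0) (Ordinal n0).
  by rewrite /move tperm1 mul1g.
by rewrite /weak_pairs /strict_pairs !big1 ?n0 // => j _; have := ltn_ord j; lia.
Qed.

(** The part of the change of the Maslov grading which is not due to the O's. It is one
    for an empty rectangle: among the points of both states, only the lower left corner
    belongs to its half-open area. *)
Definition state_area x b t : rat :=
  area_degree (at_state 1 x) (x b) (x t) b t +
  area_degree (at_state 1 (move x b t)) (x b) (x t) b t.

Lemma state_area_empty x b t : empty_rect x b t -> state_area x b t = 1.
Proof.
move=> /andP[bt /forallP emp]; rewrite /state_area.
have XX j k : (x j == x k) = (j == k) by rewrite (inj_eq perm_inj).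
have inner z l r k : \sum_(c | arc l r c) at_state (1 : rat) z (c, k) = (arc l r (z k))%:R.
  case h: (arc l r (z k)).
    rewrite (bigD1 (z k)) //= /at_state eqxx big1 ?addr0 // => c /andP[_ /negPf cz].
    by rewrite /= eq_sym cz.
  by rewrite big1 // => c ch; rewrite /at_state /=; case: eqP => // zc; rewrite zc ch in h.
have colE z : area_degree (at_state (1 : rat) z) (x b) (x t) b t =
    \sum_(k | arc b t k) (arc (x b) (x t) (z k))%:R.
  by rewrite /area_degree exchange_big; apply: eq_bigr => k _; exact: inner.
have kb k : arc b t k -> k != b -> btw b k t by rewrite arcE bt => /orP[/eqP ->|//]; rewrite eqxx.
rewrite !colE (bigD1 b) /=; last by rewrite arcE bt eqxx.
rewrite arcE XX bt eqxx big1 => [|k /andP[kt kneb]]; last first.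
  have := emp k; rewrite /hits (kb _ kt kneb) andbT arcE XX bt XX (negPf kneb) => /negPf -> //.
rewrite big1 ?addr0 // => k kt; case: (eqVneq k b) => [->|kneb].
  by rewrite moveL arcE XX bt eq_sym XX (negPf bt) btwxr.
have bkt := kb _ kt kneb; have [_ knet _] := btw_distinct bkt.
have := emp k; rewrite /hits bkt andbT moveD // arcE XX bt XX (negPf kneb) => /negPf -> //.
Qed.

End StatePairs.

(** * The Maslov and Alexander gradings *)

Section Maslov.
Variables (n : nat).
Implicit Types (x y o : {perm 'I_n}).

(** The Maslov grading of [x] in a grid whose O's form the state [o]. *)
Definition maslov_of o x : rat :=
  (strict_pairs x x)%:R - (weak_pairs o x)%:R - (strict_pairs x o)%:R + (strict_pairs o o)%:R + 1.

Lemma area_degreeB (V : zmodType) (k k' : cell n -> V) l r b t :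
  area_degree (fun c => k c - k' c) l r b t = area_degree k l r b t - area_degree k' l r b t.
Proof. by rewrite /area_degree; under eq_bigr do rewrite sumrB; rewrite sumrB. Qed.

(** The sums over rows and columns of the difference of two states vanish, so that the
    area counts change with the potential, computed in either of the two quadrants. *)
Lemma area_at_state o z x b t : b != t ->
  area_degree (at_state (1 : rat) o) (x b) (x t) b t - area_degree (at_state 1 z) (x b) (x t) b t =
    (weak_pairs o x)%:R - (weak_pairs z x)%:R
    - ((weak_pairs o (move x b t))%:R - (weak_pairs z (move x b t))%:R) /\
  area_degree (at_state (1 : rat) o) (x b) (x t) b t - area_degree (at_state 1 z) (x b) (x t) b t =
    (strict_pairs x o)%:R - (strict_pairs x z)%:R
    - ((strict_pairs (move x b t) o)%:R - (strict_pairs (move x b t) z)%:R).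
Proof.
move=> bt; rewrite -area_degreeB.
have rows k : \sum_(l < n) (at_state (1 : rat) o (l, k) - at_state 1 z (l, k)) = 0.
  by rewrite sumrB !at_state_row subrr.
have cols l : \sum_k (at_state (1 : rat) o (l, k) - at_state 1 z (l, k)) = 0.
  by rewrite sumrB !at_state_column subrr.
rewrite (potential_move rows cols _ bt); split.
  have pE y : potential (fun c => at_state (1 : rat) o c - at_state 1 z c) y =
      (weak_pairs o y)%:R - (weak_pairs z y)%:R.
    by rewrite -!potential_at_state -sumrB; apply: eq_bigr => c _; rewrite mulrnBl.
  by rewrite !pE.
have pE y : potential (fun c => at_state (1 : rat) o c - at_state 1 z c) y =
    (strict_pairs y o)%:R - (strict_pairs y z)%:R.
  rewrite (potential_upper_right rows cols) -!upper_at_state -sumrB.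
  by apply: eq_bigr => c _; rewrite mulrnBl.
by rewrite !pE.
Qed.

Lemma maslov_of_move o x b t : b != t ->
  area_degree (at_state (1 + 1 : rat) o) (x b) (x t) b t =
  maslov_of o (move x b t) - maslov_of o x + state_area x b t.
Proof.
move=> bt; have -> : area_degree (at_state (1 + 1 : rat) o) (x b) (x t) b t =
    area_degree (at_state (1 : rat) o) (x b) (x t) b t *+ 2.
  rewrite /area_degree -!sumrMnl; apply: eq_bigr => c _; rewrite -sumrMnl.
  by apply: eq_bigr => k _; rewrite /at_state; case: eqP; rewrite ?mul0rn.
(* The two quadrants are compared with different states, which cancels the mixed terms. *)
have [h1 _] := area_at_state o (move x b t) x bt.
have [_ h2] := area_at_state o x x bt.
rewrite /maslov_of /state_area; move: h1 h2.
rewrite (weak_pairs_move x b t) (weak_pairsxx (move x b t)) !natrD.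
move: (area_degree _ _ _ _ _) (area_degree _ _ _ _ _) (area_degree _ _ _ _ _) => A1 A2 A3.
by rewrite mulr2n; lra.
Qed.

Lemma maslov_of_self o : maslov_of o o = 1 - n%:R.
Proof. by rewrite /maslov_of weak_pairsxx natrD; ring. Qed.

End Maslov.

(** The O's form a state, through the lower left corners of their squares. *)
Definition O_state n (g : grid n) (o : {perm 'I_n}) := forall j, exists k, gO g k = (o j, j).

Section OState.
Variables (n : nat) (g : grid n) (o : {perm 'I_n}).
Hypothesis go : O_state g o.

Lemma O_rows_bij : bijective (fun k => (gO g k).2).
Proof.
have [f fP] : exists f : 'I_n -> 'I_n, forall j, gO g (f j) = (o j, j).
  have ex j : exists k, gO g k == (o j, j) by have [k kE] := go j; exists k; apply/eqP.
  by exists (fun j => xchoose (ex j)) => j; apply/eqP; exact: (xchooseP (ex j)).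
have fI : injective f by move=> j j' /(congr1 (gO g)); rewrite !fP => -[].
have [h fh hf] := injF_bij fI; exists f => k; last by rewrite fP.
by rewrite -{1}[k]hf fP hf.
Qed.

Lemma O_stateE k : gO g k = (o (gO g k).2, (gO g k).2).
Proof.
have [k' e] := go (gO g k).2; rewrite -e; congr (gO g _).
by apply: (bij_inj O_rows_bij); rewrite e.
Qed.

Lemma sum_O (V : nmodType) (f : cell n -> V) : \sum_k f (gO g k) = \sum_j f (o j, j).
Proof.
rewrite [RHS](reindex _ (onW_bij _ O_rows_bij)); apply: eq_bigr => k _.
by rewrite {1}O_stateE.
Qed.

Lemma sum_O_nat (f : cell n -> nat) : (\sum_k f (gO g k) = \sum_j f (o j, j))%N.
Proof. exact: (sum_O (f : cell n -> nat)). Qed.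

Lemma sum_O_cell (V : nmodType) (d : V) c : \sum_(k | gO g k == c) d = at_state d o c.
Proof.
rewrite big_mkcond (sum_O (fun c' => if c' == c then d else 0)) (bigD1 c.2) //= big1 ?addr0.
  by rewrite /at_state; case: c => l k /=; rewrite xpair_eqE eqxx andbT.
by case: c => l k j jk; rewrite xpair_eqE (negPf jk) andbF.
Qed.

Lemma Icount_states (x z : state n) :
  Icount (state_points x) (state_points z) = strict_pairs z x.
Proof.
rewrite /Icount /state_points /strict_pairs [RHS]exchange_big big_map big_enum /=.
apply: eq_bigr => j _; rewrite big_map big_enum; apply: eq_bigr => k _ /=.
by rewrite !ltn_double.
Qed.

Lemma double_ltnS a c : (a.*2 < c.*2.+1)%N = (a <= c)%N.
Proof. by rewrite ltnS leq_double. Qed.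

Lemma doubleS_ltn a c : (a.*2.+1 < c.*2)%N = (a < c)%N.
Proof. by rewrite -!mul2n; lia. Qed.

Lemma Icount_state_O (x : state n) : Icount (state_points x) (O_points g) = weak_pairs o x.
Proof.
rewrite /Icount /state_points /O_points /weak_pairs big_map big_enum /=; apply: eq_bigr => j _.
rewrite big_map big_enum /= (sum_O_nat (fun c => ((x j).*2 < (cell_point c).1) && (j.*2 < (cell_point c).2))%N).
by apply: eq_bigr => k _; rewrite /= !double_ltnS.
Qed.

Lemma Icount_O_state (x : state n) : Icount (O_points g) (state_points x) = strict_pairs x o.
Proof.
rewrite /Icount /state_points /O_points /strict_pairs exchange_big big_map big_enum /=.
apply: eq_bigr => j _; rewrite big_map big_enum /=.
rewrite (sum_O_nat (fun c => ((cell_point c).1 < (x j).*2) && ((cell_point c).2 < j.*2))%N).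
by apply: eq_bigr => k _; rewrite /= !doubleS_ltn.
Qed.

Lemma Icount_OO : Icount (O_points g) (O_points g) = strict_pairs o o.
Proof.
rewrite /Icount /O_points /strict_pairs exchange_big big_map big_enum /=.
rewrite (sum_O_nat (fun c' => \sum_(i <- [seq cell_point (gO g k) | k <- enum 'I_n])
  ((i.1 < (cell_point c').1) && (i.2 < (cell_point c').2))))%N.
apply: eq_bigr => j _; rewrite big_map big_enum /=.
rewrite (sum_O_nat (fun c => ((cell_point c).1 < (o j).*2.+1) && ((cell_point c).2 < j.*2.+1))%N).
by apply: eq_bigr => k _; rewrite /= !ltnS !ltn_double.
Qed.

Lemma maslovE x : maslov g x = maslov_of o x.
Proof.
rewrite /maslov /maslov_of /J /J2 Icount_states Icount_state_O Icount_O_state Icount_OO !natrD.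
by field.
Qed.

End OState.

Section Alexander.
Variables (n : nat) (g : grid n) (o : {perm 'I_n}) (H : zmodType) (w : cell n -> H).
Hypothesis go : O_state g o.
Hypothesis row_weight : forall k, \sum_(p in gX g | p.2 == (gO g k).2) w p = O_weight g w k.

(** The change of the Alexander grading is the sum of these weights over a rectangle. *)
Definition alexander_degree (c : cell n) : H :=
  \sum_(k | gO g k == c) O_weight g w k - (if c \in gX g then w c else 0).

Lemma alexander_rows0 j : \sum_(l < n) alexander_degree (l, j) = 0.
Proof.
have [k kE] := go j; rewrite sumrB.
have <- : O_weight g w k = \sum_(l < n) (if (l, j) \in gX g then w (l, j) else 0).
  rewrite -row_weight kE big_mkcond sum_cells exchange_big (bigD1 j) //= [X in _ + X]big1 ?addr0.
    by apply: eq_bigr => l _; rewrite eqxx andbT.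
  by move=> j' /negPf jj; rewrite big1 // => l _; rewrite jj andbF.
rewrite (exchange_big_dep predT) //= (bigD1 k) //= (big_pred1 (o j)) => [|l]; last first.
  by rewrite kE xpair_eqE eqxx andbT eq_sym.
rewrite [X in _ + X - _]big1 ?addr0 ?subrr // => k' kk; rewrite big_pred0 // => l.
apply: contraNF kk => /eqP e; apply/eqP/(bij_inj (O_rows_bij go)).
by rewrite e kE.
Qed.

Lemma alexander_columns0 l : \sum_j alexander_degree (l, j) = 0.
Proof.
pose j := (o^-1)%g l; have [k kE] := go j; have {}kE : gO g k = (l, j) by rewrite kE permKV.
rewrite sumrB.
have <- : O_weight g w k = \sum_j (if (l, j) \in gX g then w (l, j) else 0).
  rewrite /O_weight kE big_mkcond sum_cells (bigD1 l) //= [X in _ + X]big1 ?addr0.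
    by apply: eq_bigr => j' _; rewrite eqxx andbT.
  by move=> l' /negPf ll; rewrite big1 // => j' _; rewrite ll andbF.
rewrite (exchange_big_dep predT) //= (bigD1 k) //= (big_pred1 j) => [|j']; last first.
  by rewrite kE xpair_eqE eqxx eq_sym.
rewrite [X in _ + X - _]big1 ?addr0 ?subrr // => k' kk; rewrite big_pred0 // => j'.
apply: contraNF kk => /eqP e; apply/eqP/(bij_inj (O_rows_bij go)).
by have := O_stateE go k'; rewrite /= e kE /= => -[lE]; rewrite /j {1}lE permK.
Qed.

Lemma alexander2E (x : state n) : alexander2 g w x = - potential alexander_degree x *+ 2.
Proof.
have J2E c : J2 (state_points x) [:: cell_point c] = (lower_left x c + upper_right x c)%N.
  rewrite /J2 /Icount /state_points /lower_left /upper_right big_map big_enum /= big_seq1 big_map big_enum /=.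
  by congr (_ + _)%N; apply: eq_bigr => j _; rewrite ?big_seq1 /= ?double_ltnS ?doubleS_ltn.
rewrite mulr2n {2}(potential_upper_right alexander_rows0 alexander_columns0) -opprD -big_split /=.
rewrite -[RHS]sumrN /alexander2.
under [RHS]eq_bigr do rewrite -mulrnDr -J2E mulrnBl opprB.
rewrite sumrB; congr (_ - _).
  by rewrite big_mkcond; apply: eq_bigr => c _; case: ifP; rewrite ?mul0rn.
under [RHS]eq_bigr do rewrite -sumrMnl.
rewrite (exchange_big_dep predT) //=; apply: eq_bigr => k _.
by rewrite (big_pred1 (gO g k)) // => c; rewrite eq_sym.
Qed.

Lemma alexander_move (x : state n) b t : b != t ->
  area_degree alexander_degree (x b) (x t) b t =
  - potential alexander_degree (move x b t) - - potential alexander_degree x + 0.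
Proof.
move=> bt; rewrite (potential_move alexander_rows0 alexander_columns0 _ bt).
by rewrite opprK addr0 addrC.
Qed.

End Alexander.

(** * Equivalences compatible with all gradings *)

Section GradedEquivalence.
Variable n : nat.
Implicit Types (g : grid n) (x y o : state n).

(** [G] changes by the sum of [kd] over the rectangle, up to a term [e] which will be the
    same for both grids. *)
Definition grading_of (V : zmodType) (kd : cell n -> V) (e : state n -> 'I_n -> 'I_n -> V)
    (G : state n -> V) : Prop :=
  forall x b t, b != t -> area_degree kd (x b) (x t) b t = G (move x b t) - G x + e x b t.

Definition constant_on_empty (V : zmodType) (e : state n -> 'I_n -> 'I_n -> V) (c0 : V) : Prop :=
  forall x b t, empty_rect x b t -> e x b t = c0.

(** One kernel [K] has to serve all the gradings. The second property gives the Alexander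
    grading: any grading is shifted by some constant [a]. The third property
    gives the Maslov grading: it is not shifted at all, if it is normalized on the states of the O's. *)
Definition graded_equivalence g g' (s : cell n -> cell n) : Prop :=
  exists K : state n -> state n -> Uring n,
  [/\ quasi_isomorphism g g' (operator K),
      forall (V : zmodType) (dU : 'I_n -> V) kd G G' e c0,
        (forall c, c \notin gX g -> kd c = \sum_(k | gO g k == c) dU k) ->
        grading_of kd e G -> grading_of (kd \o s) e G' -> constant_on_empty e c0 ->
        exists a, forall x y, pure dU (G' y - G x - a) (K x y) &
      forall (V : zmodType) (d : V) o o' G G' e,
        O_state g o -> O_state g' o' ->
        grading_of (at_state (d + d) o) e G -> grading_of (at_state (d + d) o \o s) e G' ->
        constant_on_empty e d -> G' o' = G o ->
        forall x y, pure (fun=> d + d) (G' y - G x) (K x y)].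

Lemma column_equivalence g g' (i a q : 'I_n) :
  i != ordS i -> a != q -> saturated g ->
  (forall k, btw q k a -> (i, k) \notin marks g) ->
  (forall k, btw a k q -> (ordS i, k) \notin marks g) ->
  gX g' = [set swapped i c | c in gX g]%SET -> gO g' =1 swapped i \o gO g ->
  graded_equivalence g g' (swapped i).
Proof.
move=> iS aq sat lm rm gX' gO'; exists (entry (mark_weight g) i a q 1 0 0); split.
- exact: (column_map_quasi_isomorphism iS aq sat lm rm gX' gO').
- move=> V dU kd G G' e c0 kdE grad grad' e0; exists (shift i q kd G G' c0) => x y.
  exact: (hom_entry _ _ iS grad grad' e0 (@pure0 _ _ _) (@pure1 _ _ _) (@pureM _ _ _)
    (@pureD _ _ _) (pure_mark_weight kdE)).
move=> V d o o' G G' e go go' grad grad' e0 norm x y.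
have mark j : (o j, j) \in marks g.
  by have [k <-] := go j; rewrite inE; apply/orP; right; exact: imset_f.
have o'E : o' = (o * tperm i (ordS i))%g.
  apply/permP => j; rewrite permM; have [k] := go' j; rewrite gO' /= => kE.
  have := O_stateE go k; move: kE; rewrite /swapped; case: (gO g k) => l j' [/= <- ->].
  by case=> ->.
have s0 : shift i q (at_state (d + d) o) G G' d = 0.
  apply: (shift_O iS aq grad grad' e0); rewrite -?o'E // => k ok; apply/negP => h.
    by have := mark k; rewrite ok (negPf (lm _ h)).
  by have := mark k; rewrite ok (negPf (rm _ h)).
have kdE c : c \notin gX g -> at_state (d + d) o c = \sum_(k | gO g k == c) (d + d).
  by move=> _; rewrite (sum_O_cell go).
have := hom_entry a q iS grad grad' e0 (@pure0 _ _ (fun=> d + d)) (@pure1 _ _ _) (@pureM _ _ _)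
    (@pureD _ _ _) (pure_mark_weight kdE) x y.
by rewrite s0 subr0.
Qed.

(** ** Exchanging rows and columns *)

(** The exchange of rows and columns sends a state to its inverse permutation, and a
    rectangle with the rows [b], [t] to the one with the rows [x b], [x t]. *)
Definition flip_cell (c : cell n) : cell n := (c.2, c.1).
Definition flip_grid g : grid n :=
  Grid [set flip_cell c | c in gX g]%SET (flip_cell \o gO g) (gV g).

Lemma flip_cellK : involutive flip_cell.
Proof. by case. Qed.

Lemma move_flip x b t : (move x b t)^-1%g = move (x^-1)%g (x b) (x t).
Proof.
rewrite /move invgM tpermV; apply/permP => j; rewrite !permM.
apply: (@perm_inj _ x); rewrite permKV.
by case: (tpermP (x b) (x t) j) => [->|->|jb jt]; rewrite ?permK ?tpermL ?tpermR //;
  rewrite tpermD ?permKV //; [apply: contra_not_neq jb => ->|apply: contra_not_neq jt => ->]; rewrite permKV.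
Qed.

Lemma empty_flip x b t : empty_rect (x^-1)%g (x b) (x t) = empty_rect x b t.
Proof.
rewrite /empty_rect (inj_eq perm_inj); congr (_ && _).
apply/forallP/forallP => h j; [have := h (x j)|have := h ((x^-1)%g j)];
  by rewrite /hits !permK ?permKV andbC.
Qed.

Lemma mark_weight_flip g c : mark_weight (flip_grid g) c = mark_weight g (flip_cell c).
Proof.
rewrite /mark_weight /= -{1}[c]flip_cellK mem_imset; last exact: inv_inj flip_cellK.
by case: ifP => // _; apply: eq_bigl => k /=; rewrite -{1}[c]flip_cellK (inv_eq flip_cellK) flip_cellK.
Qed.

Lemma area_kernel_flip g x y :
  area_kernel (mark_weight (flip_grid g)) (x^-1)%g (y^-1)%g = area_kernel (mark_weight g) x y.
Proof.
rewrite /area_kernel (reindex_inj (@perm_inj _ x)); apply: eq_bigr => b _ /=.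
rewrite (reindex_inj (@perm_inj _ x)) /=; apply: eq_big => [t|t _].
  by rewrite empty_flip -move_flip (inj_eq invg_inj).
rewrite !permK /area exchange_big; apply: eq_bigr => c _; apply: eq_bigr => k _.
exact: mark_weight_flip.
Qed.

Definition flip_chain (c : Cminus n) : Cminus n := [ffun x : {perm 'I_n} => c (x^-1)%g].

Lemma flip_chainK : involutive flip_chain.
Proof. by move=> c; apply/ffunP => x; rewrite !ffunE invgK. Qed.

Lemma inv_perm_inj : injective (fun x : {perm 'I_n} => (x^-1)%g).
Proof. exact: invg_inj. Qed.

Lemma operator_flip (K : state n -> state n -> Uring n) c :
  operator (fun x y : {perm 'I_n} => K (x^-1)%g (y^-1)%g) c = flip_chain (operator K (flip_chain c)).
Proof.
apply/ffunP => y; rewrite !ffunE [RHS](reindex_inj inv_perm_inj); apply: eq_bigr => x _.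
by rewrite ffunE invgK.
Qed.

Lemma differential_flip g c :
  differential (flip_grid g) (flip_chain c) = flip_chain (differential g c).
Proof.
rewrite !differentialE; apply: (can_inj flip_chainK); rewrite flip_chainK -operator_flip.
by apply: eq_operator => x y; exact: area_kernel_flip.
Qed.

Lemma flip_chainB c d : flip_chain (c - d) = flip_chain c - flip_chain d.
Proof. by apply/ffunP => x; rewrite !ffunE. Qed.

Lemma flip_chain0 : flip_chain 0 = 0.
Proof. by apply/ffunP => x; rewrite !ffunE. Qed.

Lemma differential_unflip g c :
  differential g (flip_chain c) = flip_chain (differential (flip_grid g) c).
Proof. by rewrite -{2}[c]flip_chainK differential_flip flip_chainK. Qed.

Lemma quasi_isomorphism_flip g g' f :
  quasi_isomorphism (flip_grid g) (flip_grid g') f ->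
  quasi_isomorphism g g' (fun c => flip_chain (f (flip_chain c))).
Proof.
move=> [ch [inj surj]]; split=> [c|].
  by rewrite -differential_flip ch -differential_unflip.
split=> [c dc [b db]|c' dc'].
  have fc : differential (flip_grid g) (flip_chain c) = 0 by rewrite differential_flip dc flip_chain0.
  have fb : differential (flip_grid g') (flip_chain b) = f (flip_chain c).
    by rewrite differential_flip db flip_chainK.
  have [b' b'E] := inj _ fc (ex_intro _ _ fb).
  by exists (flip_chain b'); rewrite differential_unflip b'E flip_chainK.
have [|c dc [b db]] := surj (flip_chain c'); first by rewrite differential_flip dc' flip_chain0.
exists (flip_chain c); first by rewrite differential_unflip dc flip_chain0.
by exists (flip_chain b); rewrite differential_unflip db flip_chainB !flip_chainK.
Qed.

Lemma area_degree_flip (V : zmodType) (kd : cell n -> V) l r b t :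
  area_degree (kd \o flip_cell) l r b t = area_degree kd b t l r.
Proof. by rewrite /area_degree exchange_big. Qed.

Lemma grading_of_flip (V : zmodType) (kd : cell n -> V) e (G : state n -> V) :
  grading_of kd e G ->
  grading_of (kd \o flip_cell) (fun (x : {perm 'I_n}) b t => e (x^-1)%g (x b) (x t))
    (fun x : {perm 'I_n} => G (x^-1)%g).
Proof.
move=> grad x b t bt; rewrite area_degree_flip move_flip -grad ?(inj_eq perm_inj) //.
by rewrite !permK.
Qed.

Lemma constant_on_empty_flip (V : zmodType) e (c0 : V) : constant_on_empty e c0 ->
  constant_on_empty (fun (x : {perm 'I_n}) b t => e (x^-1)%g (x b) (x t)) c0.
Proof. by move=> e0 x b t emp; apply: e0; rewrite empty_flip. Qed.

Lemma O_state_flip g o : O_state g o -> O_state (flip_grid g) (o^-1)%g.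
Proof.
move=> go l; have [k kE] := go ((o^-1)%g l); exists k.
by rewrite /= kE permKV.
Qed.

Lemma graded_equivalence_flip g g' s :
  graded_equivalence (flip_grid g) (flip_grid g') (flip_cell \o s \o flip_cell) ->
  graded_equivalence g g' s.
Proof.
move=> [K [qi deg degO]]; exists (fun x y : {perm 'I_n} => K (x^-1)%g (y^-1)%g); split.
- have -> : operator (fun x y : {perm 'I_n} => K (x^-1)%g (y^-1)%g) =
      fun c => flip_chain (operator K (flip_chain c)).
    by apply: boolp.funext => c; exact: operator_flip.
  exact: quasi_isomorphism_flip.
- move=> V dU kd G G' e c0 kdE grad grad' e0.
  have flipE : (kd \o flip_cell) \o ((flip_cell \o s) \o flip_cell) = (kd \o s) \o flip_cell.
    by apply: boolp.funext => c /=; rewrite flip_cellK.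
  have kdE' c : c \notin gX (flip_grid g) ->
      (kd \o flip_cell) c = \sum_(k | gO (flip_grid g) k == c) dU k.
    move=> cX; rewrite /= kdE; last first.
      by apply: contra cX => h; rewrite /= -[c]flip_cellK; exact: imset_f.
    by apply: eq_bigl => k; rewrite -{2}[c]flip_cellK (inj_eq (inv_inj flip_cellK)).
  have grad2 := grading_of_flip grad'; rewrite -flipE in grad2.
  have [a aE] := deg _ _ _ _ _ _ _ kdE' (grading_of_flip grad) grad2 (constant_on_empty_flip e0).
  by exists a => x y; have := aE (x^-1)%g (y^-1)%g; rewrite !invgK.
move=> V d o o' G G' e go go' grad grad' e0 norm x y.
have atE : at_state (d + d) (o^-1)%g = at_state (d + d) o \o flip_cell :> (cell n -> V).
  apply: boolp.funext => c; rewrite /at_state /=.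
  by rewrite -(inj_eq (@perm_inj _ o)) permKV eq_sym.
have flipE : at_state (d + d) (o^-1)%g \o ((flip_cell \o s) \o flip_cell) =
    (at_state (d + d) o \o s) \o flip_cell :> (cell n -> V).
  by rewrite atE; apply: boolp.funext => c /=; rewrite flip_cellK.
have grad1 := grading_of_flip grad; rewrite -atE in grad1.
have grad2 := grading_of_flip grad'; rewrite -flipE in grad2.
have := degO _ d _ _ _ _ _ (O_state_flip go) (O_state_flip go') grad1 grad2 (constant_on_empty_flip e0) _
  (x^-1)%g (y^-1)%g.
by rewrite !invgK; apply.
Qed.

End GradedEquivalence.

(** * Complementary segments of the circle *)

Section Segments.
Variables (R : realType) (n : nat).
Local Notation N := (n%:R : R).
Implicit Types s l e x t : R.

Lemma circle_segment_cases s l x : 0 <= s < N -> 0 <= l < N -> circle_segment n s l x ->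
  if s <= wrap n (s + l) then s <= x <= wrap n (s + l) else (s <= x) || (x <= wrap n (s + l)).
Proof.
move=> sN lN [t /= tl <-]; move: tl; rewrite in_itv /= /wrap => tl.
by case: (ltP (s + t) N) => h1; case: (ltP (s + l) N) => h2; case: ifP => h3; lra.
Qed.

Lemma wrap_ge0 s t : 0 <= s < N -> 0 <= t < N -> 0 <= wrap n (s + t) < N.
Proof. by rewrite /wrap => sN tN; case: ltP => h; lra. Qed.

Lemma wrapI s t t' : 0 <= s < N -> 0 <= t < N -> 0 <= t' < N ->
  wrap n (s + t) = wrap n (s + t') -> t = t'.
Proof.
rewrite /wrap => sN tN t'N; case: ltP => h1; case: ltP => h2; lra.
Qed.

Lemma wrap_notin s l t : 0 <= s < N -> 0 <= l -> l < t < N ->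
  ~ circle_segment n s l (wrap n (s + t)).
Proof.
move=> sN l0 lt [t' /= t'l e]; move: t'l; rewrite in_itv /= => t'l.
have : t' = t by apply: (wrapI sN _ _ e); lra.
lra.
Qed.

(** The points after the end of the segment are infinitely many. *)
Lemma segment_not_full s l s' l' : 0 <= s < N -> 0 <= l < N ->
  (circle_segment n s l `|` [set s'] = [set p | 0 <= p < N])%classic -> False.
Proof.
move=> sN lN full.
have inS t : l < t < N -> wrap n (s + t) = s'.
  move=> lt; have : (circle_segment n s l `|` [set s'])%classic (wrap n (s + t)).
    by rewrite full /=; apply: wrap_ge0 => //; lra.
  by case=> // h; case: (wrap_notin sN _ lt h); lra.
have e : wrap n (s + (l + (N - l) / 3)) = wrap n (s + (l + (N - l) / 2)).
  by rewrite !inS //; lra.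
suff : l + (N - l) / 3 = l + (N - l) / 2 by lra.
by apply: (wrapI sN _ _ e); lra.
Qed.

(** Two segments which cover the circle and have only two end points in all: neither can be
    a point or share its start with the other, so each one starts where the other ends. *)
Lemma complementary_segments s1 l1 s2 l2 :
  0 <= s1 < N -> 0 <= l1 < N -> 0 <= s2 < N -> 0 <= l2 < N ->
  (circle_segment n s1 l1 `|` circle_segment n s2 l2 = [set p | 0 <= p < N])%classic ->
  (exists p q, p != q /\
     circle_segment_ends n s1 l1 `|` circle_segment_ends n s2 l2 = [set p; q])%classic ->
  [/\ wrap n (s1 + l1) = s2, wrap n (s2 + l2) = s1 & s1 != s2].
Proof.
move=> s1N l1N s2N l2N full [p [q [pq ends]]].
have two x : [\/ x = s1, x = wrap n (s1 + l1), x = s2 | x = wrap n (s2 + l2)] -> x = p \/ x = q.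
  move=> h; have : [set p; q]%classic x.
    by rewrite -ends; case: h => ->; [left; left|left; right|right; left|right; right].
  by case=> ->; [left|right].
have s12 : s1 != s2.
  apply/eqP => s12; subst s2; pose m := Num.max l1 l2.
  have mN : 0 <= m < N by rewrite /m; case: (leP l1 l2) => h; rewrite // l1N.
  have [m1 m2] : l1 <= m /\ l2 <= m by rewrite /m; case: (leP l1 l2) => h; split; lra.
  have : (circle_segment n s1 l1 `|` circle_segment n s1 l2)%classic (wrap n (s1 + (m + N) / 2)).
    by rewrite full /=; apply: wrap_ge0 => //; lra.
  by case=> h; [case: (@wrap_notin s1 l1 ((m + N) / 2)) => //|case: (@wrap_notin s1 l2 ((m + N) / 2)) => //]; lra.
have wrap0 s : 0 <= s < N -> wrap n (s + 0) = s by rewrite /wrap addr0 => /andP[_ ->].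
have seg0 s : 0 <= s < N -> (circle_segment n s 0 = [set s])%classic.
  move=> sN; apply/seteqP; split=> [x [t /= t0 <-]|x /= ->].
    have -> : t = 0 by move: t0; rewrite in_itv /=; lra.
    exact: wrap0.
  by exists 0; [rewrite /= in_itv /= lexx|exact: wrap0].
have moved s l : 0 <= s < N -> 0 <= l < N -> wrap n (s + l) = s -> l = 0.
  by move=> sN lN e; apply: (wrapI sN lN); [lra|rewrite wrap0].
have e1 : wrap n (s1 + l1) != s1.
  apply/eqP => /(moved _ _ s1N l1N) l0; apply: (@segment_not_full s2 l2 s1) => //.
  by rewrite -full l0 seg0 // setUC.
have e2 : wrap n (s2 + l2) != s2.
  apply/eqP => /(moved _ _ s2N l2N) l0; apply: (@segment_not_full s1 l1 s2) => //.
  by rewrite -full l0 seg0.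
have ts1 := two s1 (Or41 _ _ _ erefl); have ts2 := two s2 (Or43 _ _ _ erefl).
have te1 := two _ (Or42 _ _ _ erefl); have te2 := two _ (Or44 _ _ _ erefl).
split=> //.
  move: e1 s12; case: te1 => ->; case: ts1 => ->; case: ts2 => -> //; by rewrite ?eqxx.
move: e2 s12; case: te2 => ->; case: ts1 => ->; case: ts2 => -> //; by rewrite ?eqxx.
Qed.

End Segments.

(** [a] and [q] are the rows of the common end points. They are distinct, as otherwise all
    the marks of one of the lines would be in one square. *)
Lemma segments_rows (R : realType) n (I J : {set 'I_n}) (s1 l1 s2 l2 : R) :
  (0 <= s1 < n%:R) -> (0 <= l1 < n%:R) -> (0 <= s2 < n%:R) -> (0 <= l2 < n%:R) ->
  (1 < #|I|)%N -> (1 < #|J|)%N ->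
  (forall k : 'I_n, k \in I -> circle_segment n s1 l1 (k%:R + 2^-1)) ->
  (forall k : 'I_n, k \in J -> circle_segment n s2 l2 (k%:R + 2^-1)) ->
  (circle_segment n s1 l1 `|` circle_segment n s2 l2 = [set p | 0 <= p < n%:R])%classic ->
  (exists p q, p != q /\
     circle_segment_ends n s1 l1 `|` circle_segment_ends n s2 l2 = [set p; q])%classic ->
  exists a q : 'I_n, [/\ a != q, forall k, btw q k a -> k \notin I & forall k, btw a k q -> k \notin J].
Proof.
move=> s1N l1N s2N l2N cI cJ inI inJ full ends.
have [e1 e2 s12] := complementary_segments s1N l1N s2N l2N full ends.
have floor (s : R) : 0 <= s < n%:R -> exists a : 'I_n, a%:R <= s < a.+1%:R.
  move=> /andP[s0 sn]; have := truncn_itv s0; set m := Num.truncn s => mE.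
  have mn : (m < n)%N by rewrite -(ltr_nat R); case/andP: mE => ms _; exact: le_lt_trans sn.
  by exists (Ordinal mn).
have [a /andP[a1 a2]] := floor _ s1N; have [q /andP[q1 q2]] := floor _ s2N.
exists a, q.
have lo (s : R) (b k : 'I_n) : b%:R <= s -> s <= k%:R + 2^-1 -> (b <= k)%N.
  by move=> bs sk; rewrite -ltnS -(ltr_nat R) -natr1; lra.
have hi (s : R) (b k : 'I_n) : s < b.+1%:R -> k%:R + 2^-1 <= s -> (k <= b)%N.
  by move=> sb ks; rewrite -ltnS -(ltr_nat R); lra.
have PI k : k \in I -> if s1 <= s2 then (a <= k <= q)%N else (a <= k)%N || (k <= q)%N.
  move=> /inI /(circle_segment_cases s1N l1N); rewrite e1; case: ifP => _.
    by move=> /andP[/(lo _ _ _ a1) -> /(hi _ _ _ q2) ->].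
  by case/orP=> [/(lo _ _ _ a1) ->|/(hi _ _ _ q2) ->]; rewrite ?orbT.
have PJ k : k \in J -> if s2 <= s1 then (q <= k <= a)%N else (q <= k)%N || (k <= a)%N.
  move=> /inJ /(circle_segment_cases s2N l2N); rewrite e2; case: ifP => _.
    by move=> /andP[/(lo _ _ _ q1) -> /(hi _ _ _ a2) ->].
  by case/orP=> [/(lo _ _ _ q1) ->|/(hi _ _ _ a2) ->]; rewrite ?orbT.
have single (S : {set 'I_n}) (c : 'I_n) : (1 < #|S|)%N -> (forall k : 'I_n, k \in S -> (c <= k <= c)%N) -> False.
  move=> S1 Sc; suff : (#|S| <= #|pred1 c|)%N by rewrite card1 leqNgt S1.
  by apply/subset_leq_card/fintype.subsetP => k /Sc; rewrite !inE -val_eqE eqn_leq andbC.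
have mono (s s' : R) (b b' : 'I_n) : b%:R <= s -> s' < b'.+1%:R -> s <= s' -> (b <= b')%N.
  by move=> h1 h2 h3; rewrite -ltnS -(ltr_nat R); lra.
case: (ltgtP s1 s2) s12 => // s12 _; move: PI PJ; rewrite ?(ltW s12) ?lt_geF // => PI PJ.
  have aq := mono _ _ _ _ a1 q2 (ltW s12).
  split=> [|k h|k h]; [|apply/negP => /PI|apply/negP => /PJ]; last first.
  - by move: h aq; rewrite btwE; clear; lia.
  - by move: h aq; rewrite btwE; clear; lia.
  by apply/eqP => e; apply: (single I a cI) => k /PI; rewrite -e.
have qa := mono _ _ _ _ q1 a2 (ltW s12).
split=> [|k h|k h]; [|apply/negP => /PI|apply/negP => /PJ]; last first.
- by move: h qa; rewrite btwE; clear; lia.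
- by move: h qa; rewrite btwE; clear; lia.
by apply/eqP => e; apply: (single J a cJ) => k /PJ; rewrite -e.
Qed.

(** * Commutations as exchanges of columns *)

Section FromCommutation.
Variables (R : realType) (n : nat).

Lemma graph_grid_O_state (g : graph_grid n) : exists o, O_state g o.
Proof.
case: g => g _ _ cols rows _ _ _ /=.
have inj (f : 'I_n -> 'I_n) : (forall i, #|[set k | f k == i]%SET| = 1%N) -> injective f.
  move=> f1 k k' e; have /eqP/cards1P[j jE] := f1 (f k).
  have kj : k \in [set j]%SET by rewrite -jE inE.
  have : k' \in [set j]%SET by rewrite -jE inE e.
  by move: kj; rewrite !finset.in_set1 => /eqP -> /eqP ->.
pose c := perm (inj _ cols); pose r := perm (inj _ rows).
exists (r^-1 * c)%g => j; exists ((r^-1)%g j).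
have rj : (gO g ((r^-1)%g j)).2 = j by rewrite -[RHS](permKV r) [RHS]permE.
by rewrite permM [c _]permE [LHS]surjective_pairing rj.
Qed.

(** In a saturated grid each line has an O and an X. *)
Lemma two_marks (g : graph_grid n) o l : O_state g o -> saturated g ->
  (1 < #|[set k | (l, k) \in marks g]%SET|)%N.
Proof.
move=> go [sat _]; have [k kE] := go ((o^-1)%g l); rewrite permKV in kE.
have [[l' k'] cX /= lE] := sat l; subst l'.
have kk' : (o^-1)%g l != k'.
  apply: contraTneq cX => <-; rewrite -kE.
  by case: (g) => h _ OX _ _ _ _ _ /=.
apply: (@leq_trans #|[set (o^-1)%g l; k']%SET|); first by rewrite cards2 kk'.
apply/subset_leq_card/fintype.subsetP => j; rewrite finset.in_set2 inE => /orP[] /eqP ->.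
  by rewrite inE -kE; apply/orP; right; exact: imset_f.
by rewrite inE cX.
Qed.

Lemma two_marks_row (g : graph_grid n) o j : O_state g o -> saturated g ->
  (1 < #|[set l | (l, j) \in marks g]%SET|)%N.
Proof.
move=> go [_ sat]; have [k kE] := go j.
have [[l' k'] cX /= lE] := sat j; subst k'.
have kk' : o j != l'.
  apply: contraTneq cX => <-; rewrite -kE.
  by case: (g) => h _ OX _ _ _ _ _ /=.
apply: (@leq_trans #|[set o j; l']%SET|); first by rewrite cards2 kk'.
apply/subset_leq_card/fintype.subsetP => l; rewrite finset.in_set2 inE => /orP[] /eqP ->.
  by rewrite inE -kE; apply/orP; right; exact: imset_f.
by rewrite inE cX.
Qed.

Lemma flip_marks (g : grid n) c : (c \in marks (flip_grid g)) = (flip_cell c \in marks g).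
Proof.
rewrite !inE /= -{1}[c]flip_cellK (mem_imset _ _ (inv_inj (@flip_cellK n))); congr (_ || _).
apply/imsetP/imsetP => -[k _ e]; exists k => //; last by rewrite /= -e flip_cellK.
by rewrite e /= flip_cellK.
Qed.

Lemma commutation_equivalence (g g' : graph_grid n) (s : {perm cell n}) :
  saturated g -> commutation' R g g' s -> graded_equivalence g g' s.
Proof.
move=> sat [b [i [iS [s1 [l1 [s2 [l2 [/andP[s1N l1N] /andP[s2N l2N] inS full ends]]]]] sE [gX' gO' _]]]].
have [o go] := graph_grid_O_state g.
case: b inS sE => inS sE.
  have sE' : s = swapped i :> (cell n -> cell n).
    by apply: boolp.funext => c; rewrite sE.
  have [||a [q [aq aI aJ]]] := segments_rows s1N l1N s2N l2N
      (two_marks i go sat) (two_marks (ordS i) go sat) _ _ full ends.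
  - by move=> k; rewrite inE => /inS[+ _]; exact.
  - by move=> k; rewrite inE => /inS[_ +]; exact.
  rewrite sE'; apply: (column_equivalence iS aq sat).
  - by move=> k /aI; rewrite inE.
  - by move=> k /aJ; rewrite inE.
  - by rewrite gX' sE'.
  by move=> k; rewrite gO' /= sE'.
have sE' : @flip_cell n \o s \o @flip_cell n = swapped i :> (cell n -> cell n).
  by apply: boolp.funext => c; rewrite /= sE.
have flip_s c : flip_cell (s c) = swapped i (flip_cell c) by rewrite -sE' /= flip_cellK.
have [||a [q [aq aI aJ]]] := segments_rows s1N l1N s2N l2N
    (two_marks_row i go sat) (two_marks_row (ordS i) go sat) _ _ full ends.
- by move=> k; rewrite inE => /inS[+ _]; exact.
- by move=> k; rewrite inE => /inS[_ +]; exact.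
apply: graded_equivalence_flip; rewrite sE'; apply: (column_equivalence iS aq).
- have [satC satR] := sat; split=> l.
    by have [c cX cl] := satR l; exists (flip_cell c); [exact: imset_f|].
  by have [c cX cl] := satC l; exists (flip_cell c); [exact: imset_f|].
- by move=> k /aI; rewrite inE flip_marks.
- by move=> k /aJ; rewrite inE flip_marks.
- apply/setP => c; rewrite /= gX' -!imset_comp; apply/imsetP/imsetP => -[p pX ->]; exists p => //=;
    by rewrite ?flip_s.
by move=> k; rewrite /= gO' /= flip_s.
Qed.

End FromCommutation.

(** * Chains modulo boundaries *)

(** Chains, and not only cycles, are taken modulo boundaries: the class of a meridian is
    then the sum of the classes of the sides of a square. *)
Section ChainClasses.
Variables (R : realType) (X : topologicalType).

Definition bounds : {pred chain R X 1} := fun c => `[< exists b : chain R X 2, boundary b = c >].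

Lemma bounds_zmod_closed : zmod_closed bounds.
Proof.
split=> [|a b]; rewrite /bounds !unfold_in.
  by apply/asboolP; exists 0; rewrite raddf0.
move=> /asboolP[a' aE] /asboolP[b' bE]; apply/asboolP; exists (a' - b').
by rewrite raddfB /= aE bE.
Qed.

HB.instance Definition _ := GRing.isZmodClosed.Build (chain R X 1) bounds bounds_zmod_closed.

Definition chain_classes : zmodType := Quotient.quot bounds.

Definition chain_class (c : chain R X 1) : chain_classes := (\pi_(Quotient.quot bounds) c)%qT.

Lemma chain_class_is_zmod_morphism : zmod_morphism chain_class.
Proof. by move=> c d; rewrite /chain_class raddfB. Qed.

HB.instance Definition _ := GRing.isZmodMorphism.Build (chain R X 1) chain_classes chain_class
  chain_class_is_zmod_morphism.

Lemma chain_class_eq0 c : (chain_class c = 0) <-> exists b : chain R X 2, boundary b = c.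
Proof.
have -> : (chain_class c = 0) <-> (c \in bounds).
  rewrite -[c in c \in _]subr0 Quotient.idealrBE; split=> [e|/eqP e].
    by apply/eqP; rewrite -/(chain_class c) e /chain_class raddf0.
  by rewrite /chain_class e raddf0.
rewrite unfold_in; split=> [/asboolP //|h]; exact/asboolP.
Qed.

Lemma homology_class_inj (y z : cycle R X) :
  chain_class y = chain_class z -> homology_class y = homology_class z.
Proof.
move=> yz; apply/eqP; rewrite /homology_class -(Quotient.idealrBE (is_boundary (R:=R) (X:=X))) unfold_in; apply/asboolP.
apply/chain_class_eq0.
by rewrite [X in chain_class X](raddfB (val : cycle R X -> chain R X 1)) raddfB /= yz subrr.
Qed.

End ChainClasses.

(** * Affine simplices in the exterior *)

Section AffineSimplices.
Variables (R : realType) (n : nat) (g : grid n).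
Local Notation pts := 'rV[R]_3.

Definition combination k (v : 'I_k -> pts) (x : 'rV[R]_k) : pts := \sum_i x 0 i *: v i.

Definition avoids k (v : 'I_k.+1 -> pts) :=
  forall x, std_simplex R k x -> ~ spatial_graph g (combination v x).

Section OneSimplex.
Variables (k : nat) (v : 'I_k.+1 -> pts).
Hypothesis av : avoids v.

Lemma affine_subproof (x : std_simplex R k) :
  (Some (combination v (set_val x)) : S3 R) \in exterior R g.
Proof.
apply/mem_set => -[p gp [pE]]; apply: (av (set_valP x)).
by rewrite -pE.
Qed.

Definition affine_fun (x : std_simplex R k) : exterior R g :=
  exist _ (Some (combination v (set_val x)) : S3 R) (affine_subproof x).

Lemma affine_continuous : continuous affine_fun.
Proof.
apply: set_type_continuous.
have -> : set_val \o affine_fun = (Some : _ -> S3 R) \o (fun x => combination v (set_val x)) by [].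
move=> x; apply: continuous_comp; last exact: one_point_compactification_some_continuous.
rewrite /combination; elim: (index_enum _) => [|i r IH].
  rewrite (_ : (fun _ => _) = fun=> 0); first exact: cst_continuous.
  by apply/funext => y; rewrite big_nil.
rewrite (_ : (fun _ => _) = fun y : std_simplex R k =>
    (set_val y : 'rV[R]_k.+1) 0 i *: v i + \sum_(j <- r) (set_val y : 'rV[R]_k.+1) 0 j *: v j); last first.
  by apply/funext => y; rewrite big_cons.
apply: continuousD => //; apply: continuousZr_tmp.
apply: (@continuous_comp _ _ _ (set_val : std_simplex R k -> _) (fun M : 'rV[R]_k.+1 => M 0 i)).
  exact: set_val_continuous.
exact: coord_continuous.
Qed.

Definition affine_simplex : simplex R (exterior R g) k := mkcts affine_continuous.

End OneSimplex.

Lemma affine_simplex_eq k (v w : 'I_k.+1 -> pts) (av : avoids v) (aw : avoids w) :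
  v =1 w -> affine_simplex av = affine_simplex aw.
Proof.
move=> vw; apply/continuousEP => x; apply: val_inj; congr Some => /=.
by apply: eq_bigr => i _; rewrite vw.
Qed.

Lemma affine_facet k (v : 'I_k.+2 -> pts) (av : avoids v) (i : 'I_k.+2)
    (aw : avoids (v \o fintype.lift i)) : facet (affine_simplex av) i = affine_simplex aw.
Proof.
apply/continuousEP => x; apply: val_inj; congr Some => /=.
rewrite /combination (bigD1_ord i) //= mxE unlift_none scale0r add0r.
by apply: eq_bigr => j _; rewrite mxE liftK.
Qed.

Definition segment_ends (p q : pts) : 'I_2 -> pts := fun i => if i == 0 then p else q.

(** The default 0 is taken for segments that meet the graph. *)
Definition segment_class (p q : pts) : chain_classes R (exterior R g) :=
  if pselect (avoids (segment_ends p q)) is left h then chain_class (of_simplex (affine_simplex h)) else 0.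

Lemma segment_classE p q (h : avoids (segment_ends p q)) :
  segment_class p q = chain_class (of_simplex (affine_simplex h)).
Proof.
rewrite /segment_class; case: pselect => // h'.
by congr (chain_class (of_simplex _)); exact: affine_simplex_eq.
Qed.

Definition convex_exterior (C : pts -> Prop) :=
  (forall p, C p -> ~ spatial_graph g p) /\
  (forall p q s t, C p -> C q -> 0 <= s -> 0 <= t -> s + t = 1 -> C (s *: p + t *: q)).

Lemma segment_avoids C p q : convex_exterior C -> C p -> C q -> avoids (segment_ends p q).
Proof.
move=> [out conv] Cp Cq x [x0 x1]; apply: out; rewrite /combination big_ord_recl big_ord1 /=.
move: x1; rewrite big_ord_recl big_ord1 /= => x1; exact: conv.
Qed.

Definition triangle_ends (p q r : pts) : 'I_3 -> pts :=
  fun i => if i == 0 then p else if i == 1 then q else r.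

Lemma triangle_avoids C p q r : convex_exterior C -> C p -> C q -> C r -> avoids (triangle_ends p q r).
Proof.
move=> [out conv] Cp Cq Cr x [x0 x1]; apply: out; rewrite /combination !big_ord_recl big_ord0 /= addr0.
move: x1; rewrite !big_ord_recl big_ord0 /= addr0.
move: (x0 0) (x0 (fintype.lift 0 0)) (x0 (fintype.lift 0 (fintype.lift 0 0))).
move: (x 0 0) (x 0 (fintype.lift 0 0)) (x 0 (fintype.lift 0 (fintype.lift 0 0))) => a b c a0 b0 c0 abc.
have [bc0|bc0] := eqVneq (b + c) 0.
  have [-> ->] : b = 0 /\ c = 0 by split; lra.
  have -> : a = 1 by lra.
  by rewrite !scale0r !addr0 scale1r.
have -> : b *: q + c *: r = (b + c) *: ((b / (b + c)) *: q + (c / (b + c)) *: r).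
  by rewrite scalerDr !scalerA ![(b + c) * _]mulrC !divfK.
have bc : 0 < b + c by rewrite lt_def bc0 addr_ge0.
have Cm : C ((b / (b + c)) *: q + (c / (b + c)) *: r).
  by apply: conv => //; rewrite ?divr_ge0 ?(ltW bc) // -mulrDl divff.
by apply: conv => //; lra.
Qed.

Lemma lift_ends (p q r : pts) :
  [/\ triangle_ends p q r \o fintype.lift (0 : 'I_3) =1 segment_ends q r,
      triangle_ends p q r \o fintype.lift (1 : 'I_3) =1 segment_ends p r &
      triangle_ends p q r \o fintype.lift (ord_max : 'I_3) =1 segment_ends p q].
Proof. by split; case=> -[|[|//]] h. Qed.

Lemma avoids_ext k (v w : 'I_k.+1 -> pts) : v =1 w -> avoids v -> avoids w.
Proof.
move=> vw av x xs; have := av x xs; congr (~ spatial_graph g _).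
by apply: eq_bigr => i _; rewrite vw.
Qed.

(** The boundary of an affine triangle. *)
Lemma segment_class_cocycle C p q r : convex_exterior C -> C p -> C q -> C r ->
  segment_class p q + segment_class q r = segment_class p r.
Proof.
move=> CE Cp Cq Cr; have av := triangle_avoids CE Cp Cq Cr.
have apq := segment_avoids CE Cp Cq; have aqr := segment_avoids CE Cq Cr.
have apr := segment_avoids CE Cp Cr; have [f0 f1 f2] := lift_ends p q r.
rewrite !(segment_classE apq, segment_classE aqr, segment_classE apr).
apply/eqP; rewrite -subr_eq0 -raddfD -raddfB; apply/eqP/chain_class_eq0.
exists (of_simplex (affine_simplex av)).
rewrite /boundary /of_simplex liftU scale1r !big_ord_recl big_ord0 addr0.
have side (i : 'I_3) (v : 'I_2 -> pts) (h : avoids v) : triangle_ends p q r \o fintype.lift i =1 v ->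
    facet (affine_simplex av) i = affine_simplex h.
  move=> e; rewrite (affine_facet av (avoids_ext (fun j => esym (e j)) h)).
  exact: affine_simplex_eq.
have l1 : fintype.lift 0 0 = 1 :> 'I_3 by apply: val_inj.
have l2 : fintype.lift 0 (fintype.lift 0 0) = ord_max :> 'I_3 by apply: val_inj.
rewrite l1 l2 (side 0 _ aqr f0) (side 1 _ apr f1) (side ord_max _ apq f2).
rewrite /= expr0 expr1 sqrrN expr1n !scale1r scaleN1r.
by rewrite addrA addrAC [X in X - _]addrC.
Qed.

Lemma segment_class_loop C p : convex_exterior C -> C p -> segment_class p p = 0.
Proof.
move=> CE Cp; have := segment_class_cocycle CE Cp Cp Cp.
by move/eqP; rewrite -subr_eq0 addrK => /eqP.
Qed.

Lemma segment_class_opp C p q : convex_exterior C -> C p -> C q ->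
  segment_class q p = - segment_class p q.
Proof.
move=> CE Cp Cq; apply/eqP; rewrite -addr_eq0 addrC.
by rewrite (segment_class_cocycle CE Cp Cq Cp) (segment_class_loop CE Cp).
Qed.

(** ** Boundaries of squares *)

Definition corner (c : cell n) (d e : nat) : pts := pt (c.1 + d)%:R (c.2 + e)%:R 0.

Lemma chain_class_square (c : cell n) : chain_class (square_chain R g c) =
  segment_class (corner c 0 0) (corner c 1 0) + segment_class (corner c 1 0) (corner c 1 1) +
  segment_class (corner c 1 1) (corner c 0 1) + segment_class (corner c 0 1) (corner c 0 0).
Proof.
have sideE d e d' e' (h : d = d' \/ e = e') : chain_class (of_simplex (side_path R g c h)) =
    segment_class (corner c d e) (corner c d' e').
  have av : avoids (segment_ends (corner c d e) (corner c d' e')).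
    move=> x [_]; rewrite /combination !big_ord_recl !big_ord0 /= !addr0 => x1.
    exact: corner_segment.
  rewrite (segment_classE av); congr (chain_class (of_simplex _)).
  apply/continuousEP => x; apply: val_inj; congr Some => /=.
  rewrite /path_point /combination big_ord_recl big_ord1 /=; congr (_ *: _ + set_val x 0 _ *: _).
  exact: val_inj.
by rewrite /square_chain !raddfD /= !sideE.
Qed.

End AffineSimplices.

(** * Boxes in the exterior *)

Section Boxes.
Variables (R : realType) (n : nat) (g : grid n).
Local Notation pts := 'rV[R]_3.
Local Notation px p := (p 0 ord0 : R).
Local Notation py p := (p 0 (fintype.lift ord0 ord0) : R).
Local Notation pz p := (p 0 ord_max : R).
Local Notation N := (n%:R : R).

Lemma ptE (x y z : R) : (px (pt x y z) = x) * (py (pt x y z) = y) * (pz (pt x y z) = z).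
Proof. by rewrite /pt !mxE. Qed.

Lemma center_bounds (i : 'I_n) : 2^-1 <= center R i <= N - 2^-1.
Proof.
have : (i.+1%:R <= N :> R) by rewrite ler_nat.
have : 0 <= i%:R :> R by [].
by rewrite -natr1 /center; lra.
Qed.

Lemma height_bounds (i j : 'I_n) (t : R) : 0 <= t <= 1 -> 0 <= height i j t <= N ^+ 2.
Proof.
move=> t01; rewrite /height; have := center_bounds i; have := center_bounds j.
move: (center R i) (center R j) => x y xb yb.
have d0 : 0 <= (y - x) ^+ 2 by exact: sqr_ge0.
have dN : (y - x) ^+ 2 <= N ^+ 2 by nra.
have m0 : 0 <= Num.min t (1 - t) by rewrite le_min; lra.
have m1 : Num.min t (1 - t) <= 2^-1 by rewrite ge_min; lra.
move: ((y - x) ^+ 2) (N ^+ 2) (Num.min _ _) d0 dN m0 m1 => d M m d0 dN m0 m1.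
by apply/andP; split; nra.
Qed.

Lemma height0 (i j : 'I_n) (t : R) : height i j t = 0 ->
  (1 - t) * center R i + t * center R j = center R i \/
  (1 - t) * center R i + t * center R j = center R j.
Proof.
move=> /eqP; rewrite /height mulf_eq0 => /orP[|/eqP].
  rewrite mulf_eq0 pnatr_eq0 /= expf_eq0 /= subr_eq0 => /eqP ->.
  by left; ring.
by case/min_t1t_eq0 => ->; [left|right]; ring.
Qed.

Lemma convex_comb (a b t lo hi : R) : 0 <= t <= 1 -> lo <= a <= hi -> lo <= b <= hi ->
  lo <= (1 - t) * a + t * b <= hi.
Proof. by move=> t01 ab bb; apply/andP; split; nra. Qed.

(** The three parts of the graph, with the bounds which are used to avoid it: the row arcs
    are below the plane, the column arcs are above it, all of them are over the middle
    lines of rows and columns, and they meet the plane only at marks. *)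
Lemma spatial_graph_cases p : spatial_graph g p ->
  [\/ [/\ exists j : 'I_n, py p = center R j, - N ^+ 2 <= pz p <= 0, 2^-1 <= px p <= N - 2^-1 &
         pz p = 0 -> exists2 c, c \in marks g & px p = center R c.1 /\ py p = center R c.2],
      [/\ exists i : 'I_n, px p = center R i, 0 <= pz p <= N ^+ 2, 2^-1 <= py p <= N - 2^-1 &
         pz p = 0 -> exists2 c, c \in marks g & px p = center R c.1 /\ py p = center R c.2] |
      pz p = 0 /\ exists2 c, c \in marks g &
        (px p - center R c.1) ^+ 2 + (py p - center R c.2) ^+ 2 <= 4^-1 ^+ 2].
Proof.
have markO k : gO g k \in marks g by rewrite inE; apply/orP; right; exact: imset_f.
have markX c : c \in gX g -> c \in marks g by rewrite inE => ->.
case=> [[k [c [cX ck [t /= tI <-]]]]|[[k [c [cX ck [t /= tI <-]]]]|[k _ [x [y [xy ->]]]]]].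
- move: tI; rewrite in_itv /= => tI; apply: Or31; rewrite !ptE.
  have hb := height_bounds (gO g k).1 c.1 tI; split; [by exists (gO g k).2|by lra| |].
    by apply: convex_comb => //; exact: center_bounds.
  move=> /eqP; rewrite oppr_eq0 => /eqP /height0[] ->; [exists (gO g k)|exists c] => //.
    exact: markX.
  by rewrite ck.
- move: tI; rewrite in_itv /= => tI; apply: Or32; rewrite !ptE.
  have hb := height_bounds c.2 (gO g k).2 tI; split; [by exists (gO g k).1|by []| |].
    by apply: convex_comb => //; exact: center_bounds.
  move=> /height0[] ->; [exists c|exists (gO g k)] => //; first exact: markX.
  by rewrite ck.
by apply: Or33; rewrite !ptE; split=> //; exists (gO g k).
Qed.

Definition box (xl xh yl yh zl zh : R) (p : pts) : Prop :=
  [/\ xl <= px p <= xh, yl <= py p <= yh & zl <= pz p <= zh].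

Lemma box_convex xl xh yl yh zl zh p q s t : box xl xh yl yh zl zh p -> box xl xh yl yh zl zh q ->
  0 <= s -> 0 <= t -> s + t = 1 -> box xl xh yl yh zl zh (s *: p + t *: q).
Proof.
move=> [px1 py1 pz1] [qx qy qz] s0 t0 st; have -> : s = 1 - t by lra.
by split; rewrite !mxE; apply: convex_comb => //; lra.
Qed.

Lemma convex_box xl xh yl yh zl zh :
  (forall p, box xl xh yl yh zl zh p -> ~ spatial_graph g p) ->
  convex_exterior g (box xl xh yl yh zl zh).
Proof. by move=> out; split=> // p q s t; exact: box_convex. Qed.

Lemma center_neq (m : nat) (i : 'I_n) : m%:R <> center R i.
Proof. exact: natr_half_neq. Qed.

Lemma far_center (m : nat) (i : 'I_n) (y : R) : 
  (m%:R - center R i) ^+ 2 + y ^+ 2 <= 4^-1 ^+ 2 -> False.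
Proof.
have := @natr_half_far R m i; rewrite -/(center R i) => h1 h2.
have := sqr_ge0 y; lra.
Qed.

(** The vertical half-planes above the lines between two columns and those below the
    lines between two rows avoid the graph; at the ends of the grid the whole vertical
    planes do. *)
Lemma box_x (m : nat) (yl yh Z : R) : convex_exterior g (box m%:R m%:R yl yh 0 Z).
Proof.
apply: convex_box => p [xm _ zp]; have {xm}xm : px p = m%:R by lra.
case/spatial_graph_cases=> [[_ z0 _ h]|[[i xi] _ _ _]|[_ [c _ h]]].
- have [|c _ [xc _]] := h; first by lra.
  by apply: (@center_neq m c.1); rewrite -xm.
- by apply: (@center_neq m i); rewrite -xm.
by apply: (@far_center m c.1 (py p - center R c.2)); rewrite -xm.
Qed.

Lemma box_y (m : nat) (xl xh Z : R) : convex_exterior g (box xl xh m%:R m%:R Z 0).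
Proof.
apply: convex_box => p [_ ym zp]; have {ym}ym : py p = m%:R by lra.
case/spatial_graph_cases=> [[[j yj] _ _ _]|[_ z0 _ h]|[_ [c _ h]]].
- by apply: (@center_neq m j); rewrite -ym.
- have [|c _ [_ yc]] := h; first by lra.
  by apply: (@center_neq m c.2); rewrite -ym.
by apply: (@far_center m c.2 (px p - center R c.1)); rewrite -ym addrC.
Qed.

Lemma box_x_end (m : nat) (yl yh zl zh : R) : m = 0%N \/ m = n ->
  convex_exterior g (box m%:R m%:R yl yh zl zh).
Proof.
move=> m0n; apply: convex_box => p [xm _ zp]; have {xm}xm : px p = m%:R by lra.
case/spatial_graph_cases=> [[_ _ xb _]|[[i xi] _ _ _]|[_ [c _ h]]].
- by move: xb; rewrite xm; case: m0n => ->; lra.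
- by apply: (@center_neq m i); rewrite -xm.
by apply: (@far_center m c.1 (py p - center R c.2)); rewrite -xm.
Qed.

Lemma box_y_end (m : nat) (xl xh zl zh : R) : m = 0%N \/ m = n ->
  convex_exterior g (box xl xh m%:R m%:R zl zh).
Proof.
move=> m0n; apply: convex_box => p [_ ym zp]; have {ym}ym : py p = m%:R by lra.
case/spatial_graph_cases=> [[[j yj] _ _ _]|[_ _ yb _]|[_ [c _ h]]].
- by apply: (@center_neq m j); rewrite -ym.
- by move: yb; rewrite ym; case: m0n => ->; lra.
by apply: (@far_center m c.2 (px p - center R c.1)); rewrite -ym addrC.
Qed.

Lemma box_top (xl xh yl yh : R) : convex_exterior g (box xl xh yl yh (N ^+ 2 + 1) (N ^+ 2 + 1)).
Proof.
apply: convex_box => p [_ _ zp]; have N0 : 0 <= N ^+ 2 by exact: sqr_ge0.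
by case/spatial_graph_cases=> [[_ z _ _]|[_ z _ _]|[z _]]; lra.
Qed.

Lemma box_bottom (xl xh yl yh : R) :
  convex_exterior g (box xl xh yl yh (- (N ^+ 2 + 1)) (- (N ^+ 2 + 1))).
Proof.
apply: convex_box => p [_ _ zp]; have N0 : 0 <= N ^+ 2 by exact: sqr_ge0.
by case/spatial_graph_cases=> [[_ z _ _]|[_ z _ _]|[z _]]; lra.
Qed.

Lemma box_unmarked (c : cell n) : c \notin marks g ->
  convex_exterior g (box c.1%:R (c.1 + 1)%:R c.2%:R (c.2 + 1)%:R 0 0).
Proof.
move=> cm; apply: convex_box => p [xp yp zp].
have near (i j : 'I_n) (x : R) : i%:R <= x <= (i + 1)%:R ->
    (x - center R j) ^+ 2 <= 4^-1 ^+ 2 -> j = i.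
  move=> xi d; have [d1 d2] : x - center R j <= 4^-1 /\ - 4^-1 <= x - center R j.
    move: (x - center R j) d => u d; split; rewrite leNgt; apply/negP => h; nra.
  apply: val_inj; apply/eqP; rewrite eqn_leq; move: d1 d2 xi; rewrite /center natrD => d1 d2 xi.
  by apply/andP; split; rewrite -ltnS -(ltr_nat R) -natr1; lra.
have marked c' : c' \in marks g -> (px p - center R c'.1) ^+ 2 + (py p - center R c'.2) ^+ 2 <= 4^-1 ^+ 2 ->
    False.
  move=> c'm d; have sx := sqr_ge0 (px p - center R c'.1); have sy := sqr_ge0 (py p - center R c'.2).
  have e1 : c'.1 = c.1 by apply: (near _ _ _ xp); lra.
  have e2 : c'.2 = c.2 by apply: (near _ _ _ yp); lra.
  by move/negP: cm; apply; rewrite -(injective_projections _ _ e1 e2).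
have exact c' : c' \in marks g -> px p = center R c'.1 /\ py p = center R c'.2 -> False.
  by move=> c'm [e1 e2]; apply: (marked c' c'm); rewrite e1 e2 !subrr expr0n addr0; exact: sqr_ge0.
case/spatial_graph_cases=> [[_ _ _ h]|[_ _ _ h]|[_ [c' c'm]]]; last exact: marked.
  by have [|c' c'm e] := h; [lra|exact: (exact c')].
by have [|c' c'm e] := h; [lra|exact: (exact c')].
Qed.

End Boxes.

(** * The sum of the meridians in a line of the grid *)

Section Strips.
Variables (R : realType) (n : nat) (g : grid n).
Local Notation pts := 'rV[R]_3.
Local Notation P := (@segment_class R n g).

(** The strip between the polygonal lines [A] and [B] is cut into squares. The boundary of
    the strip is joined to the top [T] of a box by its sides: [L] and [D] above the
    two lines, and [F0] and [Fn] above the two ends. *)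
Lemma strip_null (A B : nat -> pts) (a0 an b0 bn : pts) (L D F0 Fn T : pts -> Prop)
    (E : nat -> pts -> Prop) :
  convex_exterior g L -> convex_exterior g D -> convex_exterior g F0 -> convex_exterior g Fn ->
  convex_exterior g T -> (forall j, (j <= n)%N -> convex_exterior g (E j)) ->
  (forall j, (j <= n)%N -> [/\ L (A j), D (B j), E j (A j) & E j (B j)]) ->
  L a0 /\ L an -> D b0 /\ D bn -> [/\ F0 (A 0%N), F0 (B 0%N), F0 a0 & F0 b0] ->
  [/\ Fn (A n), Fn (B n), Fn an & Fn bn] -> [/\ T a0, T an, T b0 & T bn] ->
  \sum_(j < n) (P (A j) (B j) + P (B j) (B j.+1) + P (B j.+1) (A j.+1) + P (A j.+1) (A j)) = 0.
Proof.
move=> CL CD C0 Cn CT CE AB [La0 Lan] [Db0 Dbn] [F0A F0B F0a F0b] [FnA FnB Fna Fnb] [Ta0 Tan Tb0 Tbn].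
have LA j : (j <= n)%N -> L (A j) by case/AB.
have DB j : (j <= n)%N -> D (B j) by case/AB.
have telescope m : (m <= n)%N ->
    \sum_(j < m) (P (A j) (B j) + P (B j) (B j.+1) + P (B j.+1) (A j.+1) + P (A j.+1) (A j)) =
    P (A 0%N) (B 0%N) + P (B 0%N) (B m) - P (A m) (B m) - P (A 0%N) (A m).
  elim: m => [|m IH] mn.
    rewrite big_ord0 (segment_class_loop CL (LA _ _)) // (segment_class_loop CD (DB _ _)) //.
    by rewrite addr0 subr0 subrr.
  rewrite big_ord_recr /= IH ?(ltnW mn) //.
  have [LA1 DB1 EA1 EB1] := AB _ mn; have [LA0 DB0 EA0 EB0] := AB _ (ltnW mn).
  rewrite -(segment_class_cocycle CD (DB 0%N (leq0n n)) DB0 DB1).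
  rewrite -(segment_class_cocycle CL (LA 0%N (leq0n n)) LA0 LA1).
  rewrite (segment_class_opp (CE _ mn) EA1 EB1) (segment_class_opp CL LA0 LA1).
  by rewrite opprD !addrA (ACl (3*5*1*2*6*7*4*8)%AC) /= addNr add0r.
have [LA0 DB0 _ _] := AB 0%N (leq0n n); have [LAn DBn _ _] := AB n (leqnn n).
rewrite telescope //.
have f0 : P (A 0%N) (B 0%N) + P (B 0%N) b0 = P (A 0%N) a0 + P a0 b0.
  by rewrite !(segment_class_cocycle C0).
have fn : P (A n) (B n) + P (B n) bn = P (A n) an + P an bn.
  by rewrite !(segment_class_cocycle Cn).
have d : P (B 0%N) (B n) + P (B n) bn = P (B 0%N) b0 + P b0 bn.
  by rewrite !(segment_class_cocycle CD).
have l : P (A 0%N) (A n) + P (A n) an = P (A 0%N) a0 + P a0 an.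
  by rewrite !(segment_class_cocycle CL).
have t : P a0 b0 + P b0 bn = P a0 an + P an bn.
  by rewrite !(segment_class_cocycle CT).
apply: (@addIr _ (P (A n) (B n) + P (B n) bn)); rewrite add0r [in RHS]fn.
rewrite addrA [X in X + _ = _]addrAC subrK -addrA addrC -!addrA [X in _ + X]addrC.
by rewrite -addrA d [X in _ + X]addrA f0 -[X in _ + X]addrA t [X in _ + X]addrA -l -[X in _ + X]addrA addKr.
Qed.

Local Notation N := (n%:R : R).
Local Notation square c := (chain_class (square_chain R g c)).

(** The box stands on the column, and its top is above all the column arcs. *)
Lemma column_null (i : 'I_n) : \sum_(j < n) square (i, j) = 0.
Proof.
have N0 : 0 <= N ^+ 2 by exact: sqr_ge0.
pose A (j : nat) : pts := pt i%:R j%:R 0; pose B (j : nat) : pts := pt (i + 1)%:R j%:R 0.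
pose top (m j : nat) : pts := pt m%:R j%:R (N ^+ 2 + 1).
rewrite -[RHS](@strip_null A B (top i 0%N) (top i n) (top (i + 1)%N 0%N) (top (i + 1)%N n)
  (box i%:R i%:R 0 N 0 (N ^+ 2 + 1)) (box (i + 1)%:R (i + 1)%:R 0 N 0 (N ^+ 2 + 1))
  (box i%:R (i + 1)%:R 0%:R 0%:R 0 (N ^+ 2 + 1)) (box i%:R (i + 1)%:R N N 0 (N ^+ 2 + 1))
  (box i%:R (i + 1)%:R 0 N (N ^+ 2 + 1) (N ^+ 2 + 1))
  (fun j => box i%:R (i + 1)%:R j%:R j%:R 0 0)).
- apply: eq_bigr => j _; rewrite chain_class_square /corner /A /B /= !addn0 !addn1.
  by [].
- exact: box_x.
- exact: box_x.
- by apply: box_y_end; left.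
- by apply: box_y_end; right.
- exact: box_top.
- by move=> j _; exact: box_y.
- move=> j jn; have jN : j%:R <= N by rewrite ler_nat.
  have j0 : 0 <= j%:R :> R by [].
  by rewrite /box /A /B !ptE natrD; split; split; lra.
all: rewrite /box /A /B /top !ptE ?natrD; have := ler0n R n.
all: by move=> h; split; split; lra.
Qed.

(** The box hangs below the row. The lines are exchanged to get the same orientation of
    the squares. *)
Lemma row_null (j : 'I_n) : \sum_(i < n) square (i, j) = 0.
Proof.
have N0 : 0 <= N ^+ 2 by exact: sqr_ge0.
pose A (i : nat) : pts := pt i%:R (j + 1)%:R 0; pose B (i : nat) : pts := pt i%:R j%:R 0.
pose bottom (i m : nat) : pts := pt i%:R m%:R (- (N ^+ 2 + 1)).
rewrite -[RHS](@strip_null A B (bottom 0%N (j + 1)%N) (bottom n (j + 1)%N) (bottom 0%N j) (bottom n j)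
  (box 0 N (j + 1)%:R (j + 1)%:R (- (N ^+ 2 + 1)) 0) (box 0 N j%:R j%:R (- (N ^+ 2 + 1)) 0)
  (box 0%:R 0%:R j%:R (j + 1)%:R (- (N ^+ 2 + 1)) 0) (box N N j%:R (j + 1)%:R (- (N ^+ 2 + 1)) 0)
  (box 0 N j%:R (j + 1)%:R (- (N ^+ 2 + 1)) (- (N ^+ 2 + 1)))
  (fun i => box i%:R i%:R j%:R (j + 1)%:R 0 0)).
- apply: eq_bigr => i _; rewrite chain_class_square /corner /A /B /= !addn0 !addn1.
  by rewrite -addrA [LHS]addrC [RHS]addrC -!addrA; congr (_ + _); rewrite addrC -addrA.
- exact: box_y.
- exact: box_y.
- by apply: box_x_end; left.
- by apply: box_x_end; right.
- exact: box_bottom.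
- by move=> i _; exact: box_x.
- move=> i jn; have jN : i%:R <= N by rewrite ler_nat.
  have j0 : 0 <= i%:R :> R by [].
  by rewrite /box /A /B !ptE natrD; split; split; lra.
all: rewrite /box /A /B /bottom !ptE ?natrD; have := ler0n R n.
all: by move=> h; split; split; lra.
Qed.

Lemma unmarked_null (c : cell n) : c \notin marks g -> square c = 0.
Proof.
move=> cm; have CE := box_unmarked R cm; rewrite chain_class_square.
have C d e : (d <= 1)%N -> (e <= 1)%N -> 
    box c.1%:R (c.1 + 1)%:R c.2%:R (c.2 + 1)%:R 0 0 (corner R c d e).
  move=> d1 e1; rewrite /box /corner !ptE; have := ler0n R d; have := ler0n R e.
  have : d%:R <= 1 :> R by rewrite (ler_nat R d 1).
  have : e%:R <= 1 :> R by rewrite (ler_nat R e 1).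
  by rewrite !natrD => *; split; lra.
rewrite !(segment_class_cocycle CE); try exact: C.
by rewrite (segment_class_loop CE) //; exact: C.
Qed.

End Strips.

Lemma O_cols_bij n (g : grid n) o : O_state g o -> bijective (fun k => (gO g k).1).
Proof.
move=> go; have [f fK Kf] := O_rows_bij go; exists (fun i => f ((o^-1)%g i)) => k.
  by rewrite (O_stateE go) /= permK fK.
by rewrite (O_stateE go) /= Kf permKV.
Qed.

Section RowWeight.
Variables (R : realType) (n : nat) (g : graph_grid n).
Local Notation square c := (chain_class (square_chain R g c)).

(** The homology classes of cycles are determined by their classes as chains. *)
Lemma meridian_sum (A B : {set cell n}) :
  \sum_(p in A) square p = \sum_(p in B) square p ->
  \sum_(p in A) meridian R g p = \sum_(p in B) meridian R g p.
Proof.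
pose z p := Cycle (square_chain_cycle R g p).
have meridianE C : \sum_(p in C) meridian R g p = homology_class (\sum_(p in C) z p).
  by rewrite /homology_class raddf_sum.
have squareE C : chain_class (\sum_(p in C) z p : cycle R (exterior R g)) = \sum_(p in C) square p.
  rewrite [X in chain_class X](raddf_sum (val : cycle R (exterior R g) -> chain R (exterior R g) 1)).
  by rewrite raddf_sum.
by move=> AB; rewrite !meridianE; apply: homology_class_inj; rewrite !squareE.
Qed.

(** The squares without marks do not contribute to the vanishing sums over a row and a
    column, so the X's in the row of an O, and also those in its column, add up to minus the
    class of the square of that O. *)
Lemma meridian_row_weight k :
  \sum_(p in gX g | p.2 == (gO g k).2) meridian R g p = O_weight g (meridian R g) k.
Proof.
have [o go] := graph_grid_O_state g.
have XO c : c \in gX g -> c != (o c.2, c.2).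
  have [k' kE] := go c.2; apply: contraTneq => ->; rewrite -kE.
  by case: (g) => h _ OX _ _ _ _ _ /=.
have unmarked l j : (l, j) \notin gX g -> (l, j) != (o j, j) -> square (l, j) = 0.
  move=> lX lo; apply: unmarked_null; rewrite inE (negPf lX) /=; apply/negP => /imsetP[k' _ e].
  by have := O_stateE go k'; rewrite -e /= => /eqP; exact/negP.
have sumX (P : pred (cell n)) : \sum_(p | P p && (p \in gX g)) square p =
    \sum_(p | P p) square p - \sum_(p | P p && (p.1 == o p.2)) square p.
  rewrite (bigID (fun p => p \in gX g) P) /= -addrA -[LHS]addr0; congr (_ + _).
  apply/esym/eqP; rewrite subr_eq0; apply/eqP.
  rewrite big_mkcond [RHS]big_mkcond; apply: eq_bigr => -[l j] _ /=.
  case: (P (l, j)) => //=; have [lX|lX] := boolP ((l, j) \in gX g); have [lo|lo] := eqVneq l (o j) => //=.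
    by have := XO _ lX; rewrite /= lo eqxx.
  by apply: unmarked; rewrite // xpair_eqE (negPf lo).
have meets (P : pred (cell n)) : P (gO g k) -> (forall k', P (gO g k') -> k' = k) ->
    \sum_(p | P p && (p.1 == o p.2)) square p = square (gO g k).
  move=> Pk Pk1; rewrite (big_pred1 (gO g k)) // => -[l j] /=; apply/andP/eqP => [[Pl /eqP lo]|e].
    by have [k' kE] := go j; move: Pl; rewrite lo -kE => /Pk1 ->.
  by rewrite e; split=> //; have := O_stateE go k; rewrite -e /= => -[<-].
have inX (P : pred (cell n)) : P (gO g k) -> (forall k', P (gO g k') -> k' = k) ->
    \sum_(p | P p) square p = 0 -> \sum_(p in [set p in gX g | P p]%SET) square p = - square (gO g k).
  move=> Pk Pk1 P0; have := sumX P; rewrite P0 meets // sub0r => <-.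
  by apply: eq_bigl => p; rewrite inE andbC.
have setE (P : pred (cell n)) : \sum_(p in gX g | P p) meridian R g p =
    \sum_(p in [set p in gX g | P p]%SET) meridian R g p.
  by apply: eq_bigl => p; rewrite inE.
rewrite /O_weight !setE; apply: meridian_sum; rewrite !inX //.
- by move=> k' /eqP e; have [f fK _] := O_cols_bij go; rewrite -[k']fK e fK.
- rewrite big_mkcond sum_cells (bigD1 (gO g k).1) //= [X in _ + X]big1 ?addr0.
    by rewrite eqxx column_null.
  by move=> l /negPf ll; rewrite big1 // => j _; rewrite ll.
- by move=> k' /eqP e; have [f fK _] := O_rows_bij go; rewrite -[k']fK e fK.
rewrite big_mkcond sum_cells exchange_big (bigD1 (gO g k).2) //= [X in _ + X]big1 ?addr0.
  by under eq_bigr do rewrite eqxx; rewrite row_null.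
by move=> j /negPf jj; rewrite big1 // => l _; rewrite jj.
Qed.

End RowWeight.

(** * Gradings of the commuted grid *)

Lemma swap_lines_column n b (i j : 'I_n) p q :
  ((swap_lines b i j p).1 == (swap_lines b i j q).1) = (p.1 == q.1).
Proof. by case: b; rewrite /swap_lines //= (inj_eq perm_inj). Qed.

Lemma swap_lines_row n b (i j : 'I_n) p q :
  ((swap_lines b i j p).2 == (swap_lines b i j q).2) = (p.2 == q.2).
Proof. by case: b; rewrite /swap_lines //= (inj_eq perm_inj). Qed.

Lemma swap_linesK n b (i j : 'I_n) : involutive (swap_lines b i j).
Proof. by case: b => -[c k]; rewrite /swap_lines /= tpermK. Qed.

Section Transport.
Variables (n : nat) (g g' : grid n) (s : {perm cell n}) (b : bool) (i j : 'I_n).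
Hypothesis sE : s =1 swap_lines b i j.
Hypothesis gX' : gX g' = [set s c | c in gX g]%SET.
Hypothesis gO' : gO g' =1 s \o gO g.
Variables (V : zmodType) (w : cell n -> V).
Local Notation w' := (moved_weight s w).

Let sK : involutive s.
Proof. by move=> c; rewrite !sE swap_linesK. Qed.

Lemma sum_moved_weight (P : pred (cell n)) :
  \sum_(p in gX g' | P p) w' p = \sum_(p in gX g | P (s p)) w p.
Proof.
rewrite (reindex_inj (@perm_inj _ s)); apply: eq_big => [p|p _].
  by rewrite gX' mem_imset //; exact: perm_inj.
by rewrite /moved_weight permK.
Qed.

Lemma O_weight_moved k : O_weight g' w' k = O_weight g w k.
Proof.
rewrite /O_weight (sum_moved_weight (fun p => p.1 == _)); apply: eq_bigl => p.
by rewrite gO' /= !sE swap_lines_column.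
Qed.

Lemma row_weight_moved k :
  \sum_(p in gX g' | p.2 == (gO g' k).2) w' p = \sum_(p in gX g | p.2 == (gO g k).2) w p.
Proof.
rewrite (sum_moved_weight (fun p => p.2 == _)); apply: eq_bigl => p.
by rewrite gO' /= !sE swap_lines_row.
Qed.

Lemma moved_O (U : nmodType) (f : 'I_n -> U) c :
  \sum_(k | gO g' k == c) f k = \sum_(k | gO g k == s c) f k.
Proof. by apply: eq_bigl => k; rewrite gO' /= (inv_eq sK). Qed.

Lemma alexander_degree_moved : alexander_degree g' w' =1 alexander_degree g w \o s.
Proof.
move=> c; rewrite /= /alexander_degree moved_O; congr (_ - _).
  by apply: eq_bigr => k _; exact: O_weight_moved.
rewrite gX' -{1}[c]sK (mem_imset _ _ (@perm_inj _ s)) /moved_weight.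
by rewrite -{2}[c]sK permK.
Qed.

Lemma at_state_moved (d : V) o o' : O_state g o -> O_state g' o' ->
  at_state d o' =1 at_state d o \o s.
Proof. by move=> go go' c; rewrite -(sum_O_cell go') moved_O (sum_O_cell go). Qed.

End Transport.

Lemma grading_of_ext n (V : zmodType) (k k' : cell n -> V) e G : k =1 k' ->
  grading_of k e G -> grading_of k' e G.
Proof.
move=> kk h x b t bt; rewrite -h //; apply: eq_bigr => c _.
by apply: eq_bigr => l _; rewrite kk.
Qed.

(** The Alexander grading is only given doubled. *)
Lemma pure_double n (V : zmodType) (dU : 'I_n -> V) d p :
  pure dU d p -> pure (fun k => dU k *+ 2) (d *+ 2) p.
Proof.
move=> h m /h <-; rewrite /degree -sumrMnl.
by apply: eq_bigr => k _; rewrite mulrnAC.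
Qed.

Theorem proposition5p1 (R : realType) (n : nat) (g g' : graph_grid n)
    (s : {perm cell n}) :
  saturated g -> saturated g' -> commutation' R g g' s ->
  exists (delta : H1 R (exterior R g)) (Phi : Cminus n -> Cminus n),
    [/\ vertex_linear g Phi,
        quasi_isomorphism g g' Phi &
        bigraded g g' Phi (meridian R g) (moved_weight s (meridian R g)) delta 0].
Proof.
move=> sat _ com; have [K [qi alexander maslov_deg]] := commutation_equivalence sat com.
have [b [i [_ _ sE [gX' gO' _]]]] := com.
have [o go] := graph_grid_O_state g; have [o' go'] := graph_grid_O_state g'.
set w := meridian R g; set w' := moved_weight s w.
have rows := meridian_row_weight R g.
have rows' k : \sum_(p in gX g' | p.2 == (gO g' k).2) w' p = O_weight g' w' k.
  by rewrite (O_weight_moved sE gX' gO') -rows (row_weight_moved sE gX' gO').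
(* Half of the Alexander gradings; their change is exactly a sum over the rectangle. *)
pose G x := - potential (alexander_degree g w) x.
pose G' x := - potential (alexander_degree g' w') x.
have [||||delta deltaP] := alexander _ (O_weight g w) (alexander_degree g w) G G' (fun _ _ _ => 0) 0.
- by move=> c /negPf cX; rewrite /alexander_degree cX subr0.
- by move=> x c t; exact: alexander_move.
- apply: (grading_of_ext (alexander_degree_moved sE gX' gO' w)).
  by move=> x c t; exact: alexander_move.
- by [].
have maslovP : forall x y, pure (fun=> 1 + 1) (maslov g' y - maslov g x) (K x y).
  move=> x y; rewrite (maslovE go) (maslovE go').
  apply: (maslov_deg _ 1 o o' _ _ (@state_area n)) => //.
  - by move=> z c t; exact: maslov_of_move.
  - apply: (grading_of_ext (at_state_moved sE gO' _ go go')).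
    by move=> z c t; exact: maslov_of_move.
  - exact: state_area_empty.
  by rewrite !maslov_of_self.
exists delta, (operator K); split=> //; first by move=> p c d _; exact: operator_linear.
move=> c a0 d0 hc x m mx; split.
  have := @operator_graded _ _ (fun k => O_weight g w k *+ 2) (alexander2 g w) (alexander2 g' w') K (delta *+ 2).
  have degree2 m' : degree (fun k => O_weight g w k *+ 2) m' = (\sum_(k < n) O_weight g w k *+ m' k) *+ 2.
    by rewrite /degree -sumrMnl; apply: eq_bigr => k _; rewrite mulrnAC.
  move=> /(_ _ c (a0 *+ 2)) h; rewrite mulrnDl -(h _ _ x m mx) ?degree2.
  - by congr (_ - _ *+ 2); apply: eq_bigr => k _; rewrite (O_weight_moved sE gX' gO').
  - move=> y z; rewrite (alexander2E go rows) (alexander2E go' rows') -!mulrnBl.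
    exact: (pure_double (deltaP y z)).
  by move=> z m' /hc[+ _]; rewrite degree2.
have := @operator_graded _ _ (fun=> 1 + 1) (maslov g) (maslov g') K 0.
have degree2 m' : degree (fun=> 1 + 1) m' = (mdeg m')%:R * 2 :> rat.
  rewrite /degree mdegE natr_sum mulr_suml.
  by apply: eq_bigr => k _; rewrite -[LHS]mulr_natl.
move=> /(_ _ c d0%:~R) h; rewrite -degree2 addr0 -[RHS]addr0; apply: h mx.
- by move=> y z; rewrite subr0.
by move=> z m' /hc[_]; rewrite degree2.
Qed.
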